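(* Let $s>0$ be nonintegral. Part I. Let $g_1\in C^s(S^1,SL(2,\mathbb C))$. The following are equivalent: (I.1) $g_1$ is of the form $$g_1(z)=\begin{pmatrix}a_1(z)&b_1(z)\\ c_1^*(z)&d_1^*(z)\end{pmatrix},\quad z\in S^1,$$ where $a_1,b_1,c_1,d_1\in H^0(\Delta)$ have $C^s$ boundary values, $a_1(0)=d_1^*(\infty)\ne0$, and the pairs $a_1$ and $b_1$, and $c_1$ and $d_1$, do not simultaneously vanish at a point in $\Delta$. (I.3) There is a nonzero constant $\mathbf a_1\in\mathbb C$ such that $g_1$ and $g_1^{-*}$ have triangular factorizations of the form $$g_1=\begin{pmatrix}1&0\\ \sum_{j=0}^\infty \bar y_jz^{-j}&1\end{pmatrix}\begin{pmatrix}\mathbf a_1&0\\0&\mathbf a_1^{-1}\end{pmatrix}\begin{pmatrix}\alpha_1(z)&\beta_1(z)\\ \gamma_1(z)&\delta_1(z)\end{pmatrix}$$ and $$g_1^{-*}=\begin{pmatrix}1&0\\ \sum_{j=0}^\infty \bar{\mathbf y}_jz^{-j}&1\end{pmatrix}\begin{pmatrix}\overline{\mathbf a_1}&0\\0&\overline{\mathbf a_1}^{-1}\end{pmatrix}\begin{pmatrix}\alpha'_1(z)&\beta'_1(z)\\ \gamma'_1(z)&\delta'_1(z)\end{pmatrix},$$ where the factors have $C^s$ boundary values and the third factors are unipotent upper triangular at $z=0$. Part II. Let $g_2\in C^s(S^1,SL(2,\mathbb C))$. The following are equivalent: (II.1) $g_2$ is of the form $$g_2(z)=\begin{pmatrix}a_2^*(z)&b_2^*(z)\\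 c_2(z)&d_2(z)\end{pmatrix},\quad z\in S^1,$$ where $a_2,b_2,c_2,d_2\in H^0(\Delta)$ have $C^s$ boundary values, $b_2(0)=c_2(0)=0$, $a_2^*(\infty)=d_2(0)\ne0$, and the pairs $a_2$ and $b_2$, and $c_2$ and $d_2$, do not simultaneously vanish at a point in $\Delta$. (II.3) There is a nonzero constant $\mathbf a_2\in\mathbb C$ such that $g_2$ and $g_2^{-*}$ have triangular factorizations of the form $$g_2=\begin{pmatrix}1&\sum_{j=1}^\infty \bar x_jz^{-j}\\0&1\end{pmatrix}\begin{pmatrix}\mathbf a_2&0\\0&\mathbf a_2^{-1}\end{pmatrix}\begin{pmatrix}\alpha_2(z)&\beta_2(z)\\ \gamma_2(z)&\delta_2(z)\end{pmatrix}$$ and $$g_2^{-*}=\begin{pmatrix}1&\sum_{j=1}^\infty \bar{\mathbf x}_jz^{-j}\\0&1\end{pmatrix}\begin{pmatrix}\overline{\mathbf a_2}&0\\0&\overline{\mathbf a_2}^{-1}\end{pmatrix}\begin{pmatrix}\alpha'_2(z)&\beta'_2(z)\\ \gamma'_2(z)&\delta'_2(z)\end{pmatrix},$$ where all the factors have $C^s$ boundary values and the third factors are unipotent upper triangular at $z=0$.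
   Context: $\Delta$ is the open unit disk, $\Delta^*$ the open unit disk at $\infty$, $H^0(U)$ the holomorphic functions on $U$; $C^s$ is the Hölder class. For $f(z)=\sum f_nz^n$ put $f^*(z)=\sum\bar f_nz^{-n}$; if $f\in H^0(\Delta)$ then $f^*\in H^0(\Delta^* )$ and $f^*(\infty)=\overline{f(0)}$. For a matrix-valued loop $g$, $g^*$ is the pointwise Hermitian adjoint on $S^1$ and $g^{-*}:=(g^{-1})^*$. In the triangular factorizations (equalities on $S^1$) the first factor is holomorphic in $\Delta^*$ and the third factor is an $SL(2,\mathbb C)$-valued holomorphic function in $\Delta$. *)

(* Defs.v *)
From Stdlib Require Export Reals.
From Coquelicot Require Export Coquelicot.

Open Scope R_scope.

(** * Matrices and loops *)

Definition M2 : Type := @matrix C 2 2.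

Definition mat2 (a b c d : C) : M2 := [[a, b], [c, d]].

Definition entry (A : M2) (i j : nat) : C := coeff_mat (RtoC 0) A i j.

Definition mul2 (A B : M2) : M2 := @Mmult C_Ring 2 2 2 A B.

Definition det2 (A : M2) : C :=
  (entry A 0 0 * entry A 1 1 - entry A 0 1 * entry A 1 0)%C.

Definition inv2 (A : M2) : M2 :=
  mat2 (/ det2 A * entry A 1 1)%C (- / det2 A * entry A 0 1)%C
       (- / det2 A * entry A 1 0)%C (/ det2 A * entry A 0 0)%C.

Definition adj2 (A : M2) : M2 :=
  mk_matrix 2 2 (fun i j => Cconj (entry A j i)).

Lemma mul2E (a b c d a' b' c' d' : C) :
  mul2 (mat2 a b c d) (mat2 a' b' c' d') =
  mat2 (a * a' + b * c')%C (a * b' + b * d')%C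
       (c * a' + d * c')%C (c * b' + d * d')%C.
Proof.
unfold mul2, Mmult, mk_matrix; simpl.
rewrite !sum_Sn, !sum_O.
reflexivity.
Qed.

Lemma mul2_inv2 (A : M2) :
  det2 A <> RtoC 0 ->
  mul2 A (inv2 A) = mat2 1 0 0 1 /\ mul2 (inv2 A) A = mat2 1 0 0 1.
Proof.
destruct A as [[a [b []]] [[c [d []]] []]].
change (det2 (mat2 a b c d) <> RtoC 0 ->
  mul2 (mat2 a b c d) (inv2 (mat2 a b c d)) = mat2 1 0 0 1 /\
  mul2 (inv2 (mat2 a b c d)) (mat2 a b c d) = mat2 1 0 0 1).
unfold inv2; intros H; rewrite !mul2E.
unfold det2, entry, coeff_mat in *; simpl in *.
split; unfold mat2; repeat f_equal; field; exact H.
Qed.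

(* Functions on the unit circle are represented by functions on [C] whose
   values off the circle are irrelevant. *)
Definition inv_star (g : C -> M2) (z : C) : M2 := adj2 (inv2 (g z)).

(** * Hölder classes *)

Fixpoint Ck_holder (k : nat) (alpha : R) (u : R -> C) : Prop :=
  match k with
  | O => exists K : R, forall t t' : R, t <> t' ->
           Cmod (u t - u t') <= K * Rpower (Rabs (t - t')) alpha
  | S k' => exists u' : R -> C,
           (forall t : R, @is_derive R_AbsRing C_R_NormedModule u t (u' t)) /\
           Ck_holder k' alpha u'
  end.

(* [C^s(S^1)] for positive nonintegral [s]: with [k] the integer part of [s],
   the [k]-th derivative in the angular variable is Hölder of exponent
   [s - k].  By periodicity, a global Hölder bound on the line is the same as
   one for the distance on the circle. *)
Definition Cs_circle (s : R) (f : C -> C) : Prop :=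
  Ck_holder (Z.to_nat (Int_part s)) (frac_part s)
            (fun t : R => f (cos t, sin t)).

Definition Cs_SL2_loop (s : R) (g : C -> M2) : Prop :=
  (forall i j : nat, (i < 2)%nat -> (j < 2)%nat ->
     Cs_circle s (fun z => entry (g z) i j)) /\
  (forall z : C, Cmod z = 1 -> det2 (g z) = RtoC 1).

(** * Holomorphic functions in the disk *)

Definition holo_disk (f : C -> C) : Prop :=
  forall z : C, Cmod z < 1 -> @ex_derive C_AbsRing C_NormedModule f z.

(* For a function in the disk with boundary values, [f] itself carries the
   boundary function on the unit circle; its values outside the closed disk
   are irrelevant. *)
Definition Cs_bv_disk (s : R) (f : C -> C) : Prop :=
  (forall z : C, Cmod z = 1 ->
     filterlim f (within (fun w : C => Cmod w < 1) (locally z))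
                 (locally (f z))) /\
  Cs_circle s f.

Definition H0_Cs_disk (s : R) (f : C -> C) : Prop :=
  holo_disk f /\ Cs_bv_disk s f.

(** * Holomorphic functions in the disk at infinity *)

Inductive sphere : Type :=
  | Pt (z : C)
  | Infty.

Definition sphere_inv (w : C) : sphere :=
  if Ceq_dec w (RtoC 0) then Infty else Pt (/ w)%C.

(* Holomorphy at infinity included, through the chart [w = 1/z]. *)
Definition holo_ext (F : sphere -> C) : Prop :=
  holo_disk (fun w => F (sphere_inv w)).

Definition bv_ext (F : sphere -> C) : Prop :=
  forall z : C, Cmod z = 1 ->
    filterlim (fun w : C => F (Pt w))
              (within (fun w : C => 1 < Cmod w) (locally z))
              (locally (F (Pt z))).

Definition Cs_bv_ext (s : R) (F : sphere -> C) : Prop :=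
  bv_ext F /\ Cs_circle s (fun z => F (Pt z)).

(* [F(z) = sum_j c_j z^{-j}] in the disk at infinity, the value at infinity
   being the constant term. *)
Definition laurent_ext (c : nat -> C) (F : sphere -> C) : Prop :=
  F Infty = c 0%nat /\
  forall z : C, 1 < Cmod z ->
    @is_pseries C_AbsRing C_NormedModule c (/ z)%C (F (Pt z)).

(* [F] is [f^*], taken on the closed disk at infinity: its values on the unit
   circle are its boundary values. *)
Definition is_star (f : C -> C) (F : sphere -> C) : Prop :=
  (exists fn : nat -> C,
     (forall z : C, Cmod z < 1 ->
        @is_pseries C_AbsRing C_NormedModule fn z (f z)) /\
     laurent_ext (fun n => Cconj (fn n)) F) /\
  bv_ext F.

(** * Triangular factorizations *)

(* The last three conditions: [u(0)] is unipotent upper triangular. *)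
Definition third_factor (s : R) (u : C -> M2) : Prop :=
  (forall i j : nat, (i < 2)%nat -> (j < 2)%nat ->
     H0_Cs_disk s (fun z => entry (u z) i j)) /\
  (forall z : C, Cmod z < 1 -> det2 (u z) = RtoC 1) /\
  entry (u (RtoC 0)) 0 0 = RtoC 1 /\
  entry (u (RtoC 0)) 1 0 = RtoC 0 /\
  entry (u (RtoC 0)) 1 1 = RtoC 1.

Definition lower_factorization (s : R) (g : C -> M2) (a : C) : Prop :=
  exists (y : nat -> C) (Y : sphere -> C) (u : C -> M2),
    laurent_ext (fun j => Cconj (y j)) Y /\
    holo_ext Y /\ Cs_bv_ext s Y /\
    third_factor s u /\
    forall z : C, Cmod z = 1 ->
      g z = mul2 (mul2 (mat2 1 0 (Y (Pt z)) 1) (mat2 a 0 0 (/ a)%C)) (u z).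

Definition upper_factorization (s : R) (g : C -> M2) (a : C) : Prop :=
  exists (x : nat -> C) (X : sphere -> C) (u : C -> M2),
    laurent_ext
      (fun j => match j with O => RtoC 0 | S _ => Cconj (x j) end) X /\
    holo_ext X /\ Cs_bv_ext s X /\
    third_factor s u /\
    forall z : C, Cmod z = 1 ->
      g z = mul2 (mul2 (mat2 1 (X (Pt z)) 0 1) (mat2 a 0 0 (/ a)%C)) (u z).

(** * The equivalent conditions *)

Definition no_common_zero (f h : C -> C) : Prop :=
  forall z : C, Cmod z < 1 -> ~ (f z = RtoC 0 /\ h z = RtoC 0).

Definition condition_I1 (s : R) (g : C -> M2) : Prop :=
  exists (a b c d : C -> C) (cs ds : sphere -> C),
    H0_Cs_disk s a /\ H0_Cs_disk s b /\ H0_Cs_disk s c /\ H0_Cs_disk s d /\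
    is_star c cs /\ is_star d ds /\
    (forall z : C, Cmod z = 1 ->
       g z = mat2 (a z) (b z) (cs (Pt z)) (ds (Pt z))) /\
    a (RtoC 0) = ds Infty /\ ds Infty <> RtoC 0 /\
    no_common_zero a b /\ no_common_zero c d.

Definition condition_I3 (s : R) (g : C -> M2) : Prop :=
  exists a : C, a <> RtoC 0 /\
    lower_factorization s g a /\
    lower_factorization s (inv_star g) (Cconj a).

Definition condition_II1 (s : R) (g : C -> M2) : Prop :=
  exists (a b c d : C -> C) (as_ bs : sphere -> C),
    H0_Cs_disk s a /\ H0_Cs_disk s b /\ H0_Cs_disk s c /\ H0_Cs_disk s d /\
    is_star a as_ /\ is_star b bs /\
    (forall z : C, Cmod z = 1 ->
       g z = mat2 (as_ (Pt z)) (bs (Pt z)) (c z) (d z)) /\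
    b (RtoC 0) = RtoC 0 /\ c (RtoC 0) = RtoC 0 /\
    as_ Infty = d (RtoC 0) /\ d (RtoC 0) <> RtoC 0 /\
    no_common_zero a b /\ no_common_zero c d.

Definition condition_II3 (s : R) (g : C -> M2) : Prop :=
  exists a : C, a <> RtoC 0 /\
    upper_factorization s g a /\
    upper_factorization s (inv_star g) (Cconj a).

(* Main.v *)
(* In part I the first row (a, b) of g determines the third factor up to its
   second row, so the factorization of g amounts to writing the second row of
   g on the circle as Y (a, b) + (p, q), with Y holomorphic in the disk at
   infinity and p, q holomorphic in the disk.  If a q' - b p' = 1 in the disk,
   the second row minus (p', q') is f (a, b) for a loop f in C^s, and splitting
   f into a part holomorphic inside and a part holomorphic outside (possible
   in C^s by Privalov's theorem, s being nonintegral) gives Y, p and q.  The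
   Bezout identity exists because a and b have no common zero.  For g^{-*} the
   pair (a, b) is replaced by (d, -c), and part II exchanges the rows.

   The complex analysis is obtained from Goursat's lemma on polar rectangles,
   which makes the Fourier coefficients of f(r e^{it}) multiples of r^n, and
   from Poisson's formula.  Privalov's theorem follows from the bound
   (1 - |z|)^(alpha - 1) on the derivative of a Cauchy transform, as in Hardy
   and Littlewood. *)

From Stdlib Require Import ZArith Lra Lia Psatz.
From Stdlib Require Import Classical ClassicalEpsilon FunctionalExtensionality List.
Require Import Defs.

Local Open Scope C_scope.

(** The obstacle is the Bezout identity, which must hold among holomorphic functions with C^s
    boundary values, while the absence of common zeros in the open disk gives no uniform lower
    bound. The determinant supplies the circle: there the adjoints of d and c solve the equation,
    but they are holomorphic on the wrong side. Replacing them by z^{-N} times polynomials puts into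
    the ideal of a and b an element that is within 1/2 of z^N on the circle. It is a finite product
    of linear factors times a unit, and each linear factor can be cancelled in the ideal since a and
    b do not both vanish at its root.

    The two parts differ in normalization. The constant term of Y is free and serves to make the
    third factor triangular at 0; X has no constant term, and the vanishing of c(0) takes over. The
    equality of the constant terms on the diagonal of g says that the diagonal constants of the two
    factorizations are conjugate. Conversely, the triangular left factor leaves one row of each
    factorization holomorphic in the disk, and these two rows, one from g and one from g^{-*},
    determine g. *)

Ltac rpos := solve [repeat (lra || apply Rmult_lt_0_compat || apply Rdiv_lt_0_compat || apply Rinv_0_lt_compat)].

(** * Elementary facts on the modulus *)

Lemma Cmod_sub_sym (x y : C) : Cmod (x - y) = Cmod (y - x).
Proof. rewrite <- Cmod_opp; f_equal; ring. Qed.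

Lemma Cmod_minus_le (x y : C) : Cmod (x - y) <= Cmod x + Cmod y.
Proof. unfold Cminus; rewrite <- (Cmod_opp y); apply Cmod_triangle. Qed.

Lemma Cmod_mult_le (x y : C) (a b : R) :
  (Cmod x <= a -> Cmod y <= b -> Cmod (x * y) <= a * b).
Proof.
intros; rewrite Cmod_mult; apply Rmult_le_compat; auto; apply Cmod_ge_0.
Qed.

Lemma Cmod_sub_ge (x y : C) : Cmod x - Cmod y <= Cmod (x - y).
Proof.
pose proof (Cmod_triangle (x - y) y) as H.
replace (x - y + y) with x in H by ring; lra.
Qed.

Lemma norm_CR (x : C) : @norm R_AbsRing C_R_NormedModule x = Cmod x.
Proof. symmetry; apply Cmod_norm. Qed.

Lemma Cmod_RtoC_pos (x : R) : 0 <= x -> Cmod x = x.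
Proof. intros; rewrite Cmod_R; apply Rabs_pos_eq; auto. Qed.

Lemma Im_RtoC_mult (x : R) (z : C) : Im (x * z) = (x * Im z)%R.
Proof. destruct z; simpl; ring. Qed.

Lemma Re_RtoC_mult (x : R) (z : C) : Re (x * z) = (x * Re z)%R.
Proof. destruct z; simpl; ring. Qed.

Lemma Cconj_RtoC (x : R) : Cconj x = x.
Proof. unfold Cconj, RtoC; simpl; f_equal; ring. Qed.

Lemma Rabs_sqr (x : R) : (Rabs x * Rabs x = x * x)%R.
Proof. rewrite <- Rabs_mult; apply Rabs_pos_eq; nra. Qed.

Lemma exists_below (x y : R) : (0 < x -> 0 < y -> exists m, 0 < m /\ m <= x /\ m <= y).
Proof.
intros; exists (Rmin x y); split; [apply Rmin_glb_lt; auto|split; [apply Rmin_l|apply Rmin_r]].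
Qed.

Lemma C_small_eq (x y : C) :
  (forall eps : R, 0 < eps -> Cmod (x - y) <= eps) -> x = y.
Proof.
intros H.
replace x with ((x - y) + y) by ring.
replace (x - y) with (RtoC 0); [ring|symmetry; apply Cmod_eq_0].
pose proof (Cmod_ge_0 (x - y)).
destruct (Rle_lt_or_eq_dec _ _ H0); auto.
specialize (H (Cmod (x - y) / 2)%R); lra.
Qed.

(** * Limits of complex-valued functions along a filter *)

Section Limits.

Context {T : Type} (F : (T -> Prop) -> Prop) {FF : Filter F}.

Lemma filterlim_Cmod (f : T -> C) (l : C) :
  filterlim f F (locally l) <->
  forall eps, 0 < eps -> F (fun x => (Cmod (f x - l) < eps)).
Proof.
split.
- intros H eps Heps.
  apply (H (fun y => (Cmod (y - l) < eps))).
  (* The balls of [C] come from a product structure, hence are squares; a square of half-side r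
     reaches distance r * sqrt 2 from its centre. *)
  assert (Hs : 0 < sqrt 2) by (apply sqrt_lt_R0; lra).
  assert (He : 0 < eps / sqrt 2) by (apply Rdiv_lt_0_compat; lra).
  exists (mkposreal _ He); intros y Hy.
  apply C_NormedModule_mixin_compat2 in Hy; simpl in Hy.
  replace (sqrt 2 * (eps / sqrt 2))%R with eps in Hy by (field; lra).
  exact Hy.
- intros H P [d Hd].
  unfold filtermap.
  apply filter_imp with (2 := H d (cond_pos d)).
  intros x Hx; apply Hd, C_NormedModule_mixin_compat1, Hx.
Qed.

Lemma filterlim_C_plus (f g : T -> C) (l m : C) :
  filterlim f F (locally l) -> filterlim g F (locally m) ->
  filterlim (fun x => f x + g x) F (locally (l + m)).
Proof.
intros Hf Hg; apply filterlim_Cmod; intros eps He.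
rewrite filterlim_Cmod in Hf, Hg.
assert (Hh : 0 < eps / 2) by lra.
generalize (filter_and _ _ (Hf _ Hh) (Hg _ Hh)).
apply filter_imp; intros x [H1 H2].
replace (f x + g x - (l + m)) with ((f x - l) + (g x - m)) by ring.
eapply Rle_lt_trans; [apply Cmod_triangle|lra].
Qed.

Lemma filterlim_C_mult (f g : T -> C) (l m : C) :
  filterlim f F (locally l) -> filterlim g F (locally m) ->
  filterlim (fun x => f x * g x) F (locally (l * m)).
Proof.
intros Hf Hg; apply filterlim_Cmod; intros eps He.
rewrite filterlim_Cmod in Hf, Hg.
pose proof (Cmod_ge_0 l); pose proof (Cmod_ge_0 m).
set (e := Rmin 1 (eps / (2 + Cmod l + Cmod m))).
assert (e0 : 0 < e) by (apply Rmin_glb_lt; [|apply Rdiv_lt_0_compat]; lra).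
generalize (filter_and _ _ (Hf e e0) (Hg e e0)).
apply filter_imp; intros x [H1 H2].
replace (f x * g x - (l * m)) with
  ((f x - l) * (g x - m) + (l * (g x - m) + (f x - l) * m)) by ring.
assert (e1 : e <= 1) by apply Rmin_l.
assert (e2 : e * (2 + Cmod l + Cmod m) <= eps).
{ replace eps with (eps / (2 + Cmod l + Cmod m) * (2 + Cmod l + Cmod m))%R
    by (field; lra).
  apply Rmult_le_compat_r; [lra|apply Rmin_r]. }
pose proof (Cmod_ge_0 (f x - l)); pose proof (Cmod_ge_0 (g x - m)).
eapply Rle_lt_trans; [apply Cmod_triangle|].
eapply Rle_lt_trans; [apply Rplus_le_compat_l, Cmod_triangle|].
rewrite !Cmod_mult; nra.
Qed.

Lemma filterlim_C_conj (f : T -> C) (l : C) :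
  filterlim f F (locally l) ->
  filterlim (fun x => Cconj (f x)) F (locally (Cconj l)).
Proof.
intros Hf; apply filterlim_Cmod; intros eps He.
rewrite filterlim_Cmod in Hf; generalize (Hf eps He).
apply filter_imp; intros x H; rewrite <- Cminus_conj, Cmod_conj; exact H.
Qed.

Lemma filterlim_C_opp (f : T -> C) (l : C) :
  filterlim f F (locally l) ->
  filterlim (fun x => - f x) F (locally (- l)).
Proof.
intros Hf; replace (- l) with (-(1) * l) by ring.
apply (filterlim_ext (fun x => -(1) * f x)); [intros; ring|].
apply filterlim_C_mult; [apply filterlim_const|auto].
Qed.

Lemma filterlim_C_minus (f g : T -> C) (l m : C) :
  filterlim f F (locally l) -> filterlim g F (locally m) ->
  filterlim (fun x => f x - g x) F (locally (l - m)).
Proof.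
intros; apply filterlim_C_plus; auto using filterlim_C_opp.
Qed.

Lemma filterlim_C_inv (f : T -> C) (l : C) :
  filterlim f F (locally l) -> l <> 0 ->
  filterlim (fun x => / f x) F (locally (/ l)).
Proof.
intros Hf Hl; apply filterlim_Cmod; intros eps He.
rewrite filterlim_Cmod in Hf.
assert (H0 : 0 < Cmod l) by (apply Cmod_gt_0; auto).
set (e := Rmin (Cmod l / 2) (eps * (Cmod l * Cmod l) / 2)).
assert (e0 : 0 < e).
{ apply Rmin_glb_lt; [lra|].
  apply Rdiv_lt_0_compat; [|lra].
  apply Rmult_lt_0_compat; auto; nra. }
generalize (Hf e e0).
apply filter_imp; intros x H1.
assert (e1 : e <= Cmod l / 2) by apply Rmin_l.
assert (e2 : e <= eps * (Cmod l * Cmod l) / 2) by apply Rmin_r.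
assert (H2 : Cmod l / 2 < Cmod (f x)).
{ pose proof (Cmod_sub_ge l (l - f x)) as H.
  replace (l - (l - f x)) with (f x) in H by ring.
  rewrite (Cmod_sub_sym l) in H; lra. }
assert (H3 : f x <> 0) by (apply Cmod_gt_0; lra).
replace (/ f x - / l) with ((l - f x) * / (f x * l)) by (field; auto).
rewrite Cmod_mult, Cmod_inv, Cmod_mult, Cmod_sub_sym by (apply Cmult_neq_0; auto).
apply Rmult_lt_reg_r with (Cmod (f x) * Cmod l)%R; [nra|].
rewrite Rmult_assoc, Rinv_l by nra; nra.
Qed.

End Limits.

Lemma locally_C (z : C) (P : C -> Prop) :
  locally z P <-> exists d, 0 < d /\ forall w, Cmod (w - z) < d -> P w.
Proof.
split.
- intros [[d d0] H]; exists d; split; auto; intros w Hw; apply H.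
  apply C_NormedModule_mixin_compat1; exact Hw.
- intros [d [d0 H]].
  assert (L := filterlim_id C (locally z)); rewrite (filterlim_Cmod (locally z)) in L.
  generalize (L d d0); apply filter_imp; auto.
Qed.

(** * Derivatives along a subset of the plane *)

(* The set [A] is the whole plane for complex derivatives and the real line
   for derivatives with respect to a real variable. *)
Definition der (A : C -> Prop) (f : C -> C) (z l : C) : Prop :=
  forall eps : R, 0 < eps -> exists d : R, 0 < d /\
    forall w, A w -> Cmod (w - z) < d ->
      Cmod (f w - f z - (w - z) * l) <= eps * Cmod (w - z).

Definition Real (w : C) : Prop := exists t : R, w = RtoC t.

Definition derC (f : C -> C) (z l : C) : Prop := der (fun _ => True) f z l.

(** Precomposition with [Re] makes a function of a real variable a function on the plane, so that
    rules proved once for an arbitrary [A] serve both calculi. *)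
Definition derR (u : R -> C) (t : R) (l : C) : Prop :=
  der Real (fun w => u (Re w)) t l.

Section Derivatives.

Context (A : C -> Prop).

Lemma der_const (c z : C) : der A (fun _ => c) z 0.
Proof.
intros eps He; exists 1%R; split; [lra|]; intros w _ _.
replace (c - c - (w - z) * 0) with (RtoC 0) by ring; rewrite Cmod_0.
pose proof (Cmod_ge_0 (w - z)); nra.
Qed.

Lemma der_id (z : C) : der A (fun w => w) z 1.
Proof.
intros eps He; exists 1%R; split; [lra|]; intros w _ _.
replace (w - z - (w - z) * 1) with (RtoC 0) by ring; rewrite Cmod_0.
pose proof (Cmod_ge_0 (w - z)); nra.
Qed.

Lemma der_lipschitz (f : C -> C) (z l : C) : der A f z l ->
  exists d : R, 0 < d /\ forall w, A w -> Cmod (w - z) < d ->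
    Cmod (f w - f z) <= (1 + Cmod l) * Cmod (w - z).
Proof.
intros H; destruct (H 1%R ltac:(lra)) as [d [d0 Hd]].
exists d; split; auto; intros w Aw Hw.
specialize (Hd w Aw Hw).
replace (f w - f z) with ((f w - f z - (w - z) * l) + (w - z) * l) by ring.
eapply Rle_trans; [apply Cmod_triangle|]; rewrite Cmod_mult; lra.
Qed.

Lemma der_continuous_eps (f : C -> C) (z l : C) (eps : R) : der A f z l -> 0 < eps ->
  exists d : R, 0 < d /\ forall w, A w -> Cmod (w - z) < d ->
    Cmod (f w - f z) < eps.
Proof.
intros H He; destruct (der_lipschitz _ _ _ H) as [d [d0 Hd]]; pose proof (Cmod_ge_0 l).
assert (e0 : 0 < eps / (1 + Cmod l)) by (apply Rdiv_lt_0_compat; lra).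
destruct (exists_below d (eps / (1 + Cmod l)) d0 e0) as [m [m0 [m1 m2]]].
exists m; split; auto; intros w Aw Hw; eapply Rle_lt_trans; [apply Hd; auto; lra|].
replace eps with ((1 + Cmod l) * (eps / (1 + Cmod l)))%R by (field; lra).
apply Rmult_lt_compat_l; lra.
Qed.

Let punctured (z : C) := within (fun w => A w /\ w <> z) (locally z).

Let punctured_filter (z : C) : Filter (punctured z).
Proof. apply within_filter, locally_filter. Qed.

Lemma sub_neq_0 (w z : C) : w <> z -> w - z <> 0.
Proof. intros H K; apply H; replace w with (w - z + z) by ring; rewrite K; ring. Qed.

(** Slopes reduce the rules of differentiation to rules for limits. The definition of [der] avoids
    the division, which makes it the convenient form in estimates. *)
Lemma der_slope (f : C -> C) (z l : C) :
  der A f z l <-> filterlim (fun w => (f w - f z) * / (w - z)) (punctured z) (locally l).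
Proof.
rewrite filterlim_Cmod by auto.
assert (E : forall w, w <> z ->
  Cmod (f w - f z - (w - z) * l) = (Cmod ((f w - f z) * / (w - z) - l) * Cmod (w - z))%R).
{ intros w Hw; rewrite <- Cmod_mult; f_equal; field; apply sub_neq_0; auto. }
split; intros H eps He.
- destruct (H (eps / 2)%R) as [d [d0 Hd]]; [lra|].
  apply locally_C; exists d; split; auto; intros w Hw [Aw wz].
  specialize (Hd w Aw Hw); rewrite E in Hd by auto.
  assert (P : 0 < Cmod (w - z)) by (apply Cmod_gt_0, sub_neq_0; auto).
  apply Rmult_le_reg_r in Hd; lra.
- specialize (H eps He); apply locally_C in H as [d [d0 Hd]].
  exists d; split; auto; intros w Aw Hw; destruct (Ceq_dec w z) as [->|wz].
  + replace (f z - f z - (z - z) * l) with (RtoC 0) by ring; rewrite Cmod_0.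
    apply Rmult_le_pos; [lra|apply Cmod_ge_0].
  + rewrite E by auto; apply Rmult_le_compat_r; [apply Cmod_ge_0|].
    apply Rlt_le, Hd; auto.
Qed.

Lemma der_continuous (f : C -> C) (z l : C) : der A f z l ->
  filterlim f (punctured z) (locally (f z)).
Proof.
intros H; apply filterlim_Cmod; [auto|]; intros eps He.
destruct (der_continuous_eps f z l eps H He) as [d [d0 Hd]].
apply locally_C; exists d; split; auto; intros w Hw [Aw _]; auto.
Qed.

Lemma der_plus (f g : C -> C) (z l m : C) :
  der A f z l -> der A g z m -> der A (fun w => f w + g w) z (l + m).
Proof.
rewrite !der_slope; intros Hf Hg.
eapply filterlim_ext; [|apply (filterlim_C_plus _ _ _ _ _ Hf Hg)]; intros; simpl; ring.
Qed.

Lemma der_mult (f g : C -> C) (z l m : C) :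
  der A f z l -> der A g z m ->
  der A (fun w => f w * g w) z (l * g z + f z * m).
Proof.
intros Hf Hg; pose proof (der_continuous g z m Hg) as Cg; rewrite der_slope in *.
eapply filterlim_ext; [|apply filterlim_C_plus; [auto|apply (filterlim_C_mult _ _ _ _ _ Hf Cg)|
  apply (filterlim_C_mult _ _ _ _ _ (filterlim_const (f z)) Hg)]].
intros; simpl; ring.
Qed.

Lemma der_scale (c : C) (f : C -> C) (z l : C) : der A f z l -> der A (fun w => c * f w) z (c * l).
Proof.
intros H; replace (c * l) with (0 * f z + c * l) by ring.
apply (der_mult (fun _ => c)); auto using der_const.
Qed.

Lemma der_inv (f : C -> C) (z l : C) :
  der A f z l -> f z <> 0 ->
  der A (fun w => / f w) z (- (l * (/ f z * / f z))).
Proof.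
intros Hf H0; pose proof (der_continuous f z l Hf) as Cf; rewrite der_slope in *.
apply (filterlim_ext_loc (fun w => - ((f w - f z) * / (w - z) * (/ f w * / f z)))).
- assert (P : 0 < Cmod (f z)) by (apply Cmod_gt_0; auto).
  rewrite filterlim_Cmod in Cf by auto; specialize (Cf _ P); unfold punctured, within in *.
  generalize Cf; apply filter_imp; intros w Hw [Aw wz]; specialize (Hw (conj Aw wz)).
  assert (f w <> 0).
  { intros K; rewrite K in Hw; replace (0 - f z) with (- f z) in Hw by ring.
    rewrite Cmod_opp in Hw; lra. }
  field; repeat split; auto; apply sub_neq_0; auto.
- apply filterlim_C_opp, filterlim_C_mult; auto.
  apply filterlim_C_mult; auto; [apply filterlim_C_inv; auto|apply filterlim_const].
Qed.

(** Real increments are available for both choices of [A] in use, and they already determine the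
    derivative. *)
Lemma der_unique (f : C -> C) (z l m : C) : (forall x : R, A (z + x)) ->
  der A f z l -> der A f z m -> l = m.
Proof.
intros HA Hl Hm; apply C_small_eq; intros eps He.
destruct (Hl (eps / 2)%R ltac:(lra)) as [d [d0 Hd]].
destruct (Hm (eps / 2)%R ltac:(lra)) as [d' [d0' Hd']].
destruct (exists_below (d / 2) (d' / 2)) as [x [x0 [x1 x2]]]; [lra|lra|].
assert (E : Cmod (z + x - z) = x).
{ replace (z + x - z) with (RtoC x) by ring; apply Cmod_RtoC_pos; lra. }
specialize (Hd _ (HA x) ltac:(lra)); specialize (Hd' _ (HA x) ltac:(lra)).
apply Rmult_le_reg_r with (Cmod (z + x - z)); [lra|]; rewrite <- Cmod_mult.
replace ((l - m) * (z + x - z)) with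
  ((f (z + x) - f z - (z + x - z) * m) - (f (z + x) - f z - (z + x - z) * l)) by ring.
eapply Rle_trans; [apply Cmod_minus_le|]; lra.
Qed.

End Derivatives.

Lemma derC_local (f g : C -> C) (z l : C) (d : R) : 0 < d ->
  (forall w, Cmod (w - z) < d -> f w = g w) -> derC f z l -> derC g z l.
Proof.
intros d0 E H eps He; destruct (H eps He) as [d' [d0' Hd']].
exists (Rmin d d'); split; [apply Rmin_glb_lt; auto|]; intros w _ Hw.
apply Rmin_Rgt in Hw as [Hw1 Hw2]; rewrite <- !E; auto.
replace (z - z) with (RtoC 0) by ring; rewrite Cmod_0; auto.
Qed.

Lemma derC_local_disk (f g : C -> C) (z l : C) : Cmod z < 1 ->
  (forall w, Cmod w < 1 -> f w = g w) -> derC f z l -> derC g z l.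
Proof.
intros Hz E; apply derC_local with (1 - Cmod z)%R; [lra|]; intros w Hw; apply E.
replace w with ((w - z) + z) by ring; eapply Rle_lt_trans; [apply Cmod_triangle|lra].
Qed.

Lemma derC_unique (f : C -> C) (z l m : C) : derC f z l -> derC f z m -> l = m.
Proof. apply der_unique; auto. Qed.

(** Carries an identity to a point that is only approached by points where it is known, such as the
    origin in polar coordinates. *)
Lemma continuous_agree (f g : C -> C) (z : C) :
  filterlim f (locally z) (locally (f z)) -> filterlim g (locally z) (locally (g z)) ->
  (forall d, 0 < d -> exists w, Cmod (w - z) < d /\ f w = g w) -> f z = g z.
Proof.
intros Hf Hg H; apply C_small_eq; intros eps He.
pose proof (filterlim_C_minus _ _ _ _ _ Hf Hg) as D.
rewrite filterlim_Cmod in D by apply locally_filter.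
specialize (D eps He); apply locally_C in D as [d [d0 Hd]].
destruct (H d d0) as [w [Hw E]]; specialize (Hd w Hw); rewrite E in Hd.
replace (g w - g w - (f z - g z)) with (- (f z - g z)) in Hd by ring.
rewrite Cmod_opp in Hd; lra.
Qed.

Lemma derC_is_derive (f : C -> C) (z l : C) :
  @is_derive C_AbsRing C_NormedModule f z l <-> derC f z l.
Proof.
split.
- intros [_ H] eps He.
  destruct (H z (fun P HP => HP) (mkposreal _ He)) as [d Hd].
  exists d; split; [apply cond_pos|]; intros w _ Hw.
  exact (Hd w Hw).
- intros H; split; [apply is_linear_scal_l|].
  intros x Hx.
  assert (E : z = x) by (apply (is_filter_lim_locally_unique (V := AbsRing_NormedModule C_AbsRing)); exact Hx).
  subst x; intros eps.
  destruct (H eps (cond_pos eps)) as [d [d0 Hd]].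
  exists (mkposreal d d0); intros w Hw; exact (Hd w I Hw).
Qed.

Lemma derR_is_derive (u : R -> C) (t : R) (l : C) :
  @is_derive R_AbsRing C_R_NormedModule u t l <-> derR u t l.
Proof.
assert (S : forall w : R, Cmod (RtoC w - RtoC t) = Rabs (w - t)).
{ intros; rewrite <- RtoC_minus, Cmod_R; auto. }
assert (Q : forall w : R, @norm R_AbsRing C_R_NormedModule
   (minus (minus (u w) (u t)) (@scal R_AbsRing C_R_NormedModule (minus w t) l)) =
   Cmod (u w - u t - (RtoC w - RtoC t) * l)).
{ intros w; rewrite norm_CR; f_equal.
  destruct l, (u w), (u t); unfold minus, plus, opp, scal; simpl;
  unfold prod_plus, prod_opp, prod_scal; simpl;
  unfold Cminus, Cplus, Copp, Cmult, RtoC, plus, opp, scal, mult; simpl.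
  unfold mult; simpl.
  f_equal; ring. }
split.
- intros [_ H] eps He.
  destruct (H t (fun P HP => HP) (mkposreal _ He)) as [d Hd].
  exists d; split; [apply cond_pos|]; intros w [w' ->] Hw; simpl.
  rewrite S in Hw |- *; specialize (Hd w' Hw).
  eapply Rle_trans; [right; symmetry; exact (Q w')|exact Hd].
- intros H; split; [apply is_linear_scal_l|].
  intros x Hx.
  assert (E : t = x) by (apply (is_filter_lim_locally_unique (V := R_NormedModule)); exact Hx).
  subst x; intros eps.
  destruct (H eps (cond_pos eps)) as [d [d0 Hd]].
  exists (mkposreal d d0); intros w Hw.
  eapply Rle_trans; [right; exact (Q w)|].
  specialize (Hd (RtoC w) (ex_intro _ w eq_refl)).
  rewrite S in Hd; exact (Hd Hw).
Qed.

Lemma derC_continuous (f : C -> C) (z l : C) :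
  derC f z l -> filterlim f (locally z) (locally (f z)).
Proof.
intros H; apply filterlim_Cmod; [apply _|]; intros eps He.
destruct (der_continuous_eps _ _ _ _ _ H He) as [d [d0 Hd]].
apply locally_C; exists d; split; auto.
Qed.

Lemma derR_continuous (u : R -> C) (t : R) (l : C) :
  derR u t l -> filterlim u (locally t) (locally (u t)).
Proof.
intros H; apply filterlim_Cmod; [apply _|]; intros eps He.
destruct (der_continuous_eps _ _ _ _ _ H He) as [d [d0 Hd]].
exists (mkposreal d d0); intros w Hw; apply (Hd (RtoC w)); [exists w; auto|].
rewrite <- RtoC_minus, Cmod_R; exact Hw.
Qed.

Lemma derR_Re (u : R -> C) (t : R) (l : C) :
  derR u t l -> is_derive (fun x => Re (u x)) t (Re l).
Proof.
intros H; apply is_derive_Reals; intros eps He.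
destruct (H (eps / 2)%R) as [d [d0 Hd]]; [lra|].
exists (mkposreal d d0); intros h h0 Hh; simpl in Hh.
specialize (Hd (RtoC (t + h)) (ex_intro _ _ eq_refl)).
rewrite <- RtoC_minus, Cmod_R in Hd.
replace (t + h - t)%R with h in Hd by ring.
specialize (Hd Hh); simpl in Hd.
assert (h1 : 0 < Rabs h) by (apply Rabs_pos_lt; auto).
replace ((Re (u (t + h)%R) - Re (u t)) / h - Re l)%R with
  (Re (u (t + h)%R - u t - h * l) / h)%R
  by (destruct (u (t + h)%R), (u t), l; simpl; field; auto).
rewrite Rabs_div by auto.
apply Rle_lt_trans with (eps / 2)%R; [|lra].
apply Rmult_le_reg_r with (Rabs h); auto.
unfold Rdiv; rewrite Rmult_assoc, Rinv_l, Rmult_1_r by lra.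
eapply Rle_trans; [apply re_le_Cmod|]; exact Hd.
Qed.

Lemma derR_pair (f g : R -> R) (t l m : R) :
  is_derive f t l -> is_derive g t m -> derR (fun x => (f x, g x)) t (l, m).
Proof.
intros Hf Hg eps He.
apply is_derive_Reals in Hf; apply is_derive_Reals in Hg.
destruct (Hf (eps / 2)%R) as [d Hd]; [lra|].
destruct (Hg (eps / 2)%R) as [d' Hd']; [lra|].
exists (Rmin d d'); split; [apply Rmin_glb_lt; apply cond_pos|].
intros w [s ->] Hw; simpl; rewrite <- RtoC_minus, Cmod_R in Hw |- *.
apply Rmin_Rgt in Hw as [Hw1 Hw2].
destruct (Req_dec s t) as [->|st].
{ replace ((f t, g t) - (f t, g t) - RtoC (t - t) * (l, m)) with (RtoC 0).
  rewrite Cmod_0; pose proof (Rabs_pos (t - t)); nra.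
  rewrite Rminus_diag; ring. }
assert (st' : (s - t <> 0)%R) by lra.
specialize (Hd _ st' Hw1); specialize (Hd' _ st' Hw2).
replace (t + (s - t))%R with s in * by ring.
assert (P : forall a b L c : R, (Rabs ((a - b) / (s - t) - L) < c ->
   Rabs (a - b - (s - t) * L) <= c * Rabs (s - t))).
{ intros a b L c Hc.
  replace (a - b - (s - t) * L)%R with (((a - b) / (s - t) - L) * (s - t))%R by (field; auto).
  rewrite Rabs_mult; apply Rmult_le_compat_r; [apply Rabs_pos|lra]. }
apply P in Hd; apply P in Hd'.
set (x := (f s - f t - (s - t) * l)%R) in *.
set (y := (g s - g t - (s - t) * m)%R) in *.
replace ((f s, g s) - (f t, g t) - RtoC (s - t) * (l, m)) with (RtoC x + Ci * RtoC y).
2:{ unfold x, y, Ci, RtoC, Cminus, Cplus, Copp, Cmult; simpl; f_equal; ring. }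
eapply Rle_trans; [apply Cmod_triangle|].
rewrite Cmod_mult, Cmod_Ci, !Cmod_R; lra.
Qed.

Lemma derR_comp (f : C -> C) (g : R -> C) (t : R) (l m : C) :
  derC f (g t) l -> derR g t m -> derR (fun x => f (g x)) t (m * l).
Proof.
intros Hf Hg eps He.
destruct (der_lipschitz _ _ _ _ Hg) as [d1 [d10 Hd1]].
pose proof (Cmod_ge_0 l); pose proof (Cmod_ge_0 m).
set (e := (eps / (2 * (1 + Cmod m)))%R).
assert (e0 : 0 < e) by (unfold e; rpos).
set (e' := (eps / (2 * (1 + Cmod l)))%R).
assert (e0' : 0 < e') by (unfold e'; rpos).
destruct (Hf e e0) as [d2 [d20 Hd2]].
destruct (Hg e' e0') as [d3 [d30 Hd3]].
set (d4 := (d2 / (1 + Cmod m))%R).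
assert (d40 : 0 < d4) by (unfold d4; rpos).
exists (Rmin d1 (Rmin d3 d4)); split; [repeat apply Rmin_glb_lt; auto|].
intros w Aw Hw.
apply Rmin_Rgt in Hw as [Hw1 Hw2]; apply Rmin_Rgt in Hw2 as [Hw2 Hw3].
specialize (Hd1 w Aw Hw1); specialize (Hd3 w Aw Hw2).
pose proof (Cmod_ge_0 (w - t)) as W.
simpl (Re (RtoC t)) in *.
assert (K : Cmod (g (Re w) - g t) < d2).
{ eapply Rle_lt_trans; [exact Hd1|].
  replace d2 with ((1 + Cmod m) * d4)%R by (unfold d4; field; lra).
  apply Rmult_lt_compat_l; lra. }
specialize (Hd2 _ I K).
replace (f (g (Re w)) - f (g t) - (w - t) * (m * l)) with
  ((f (g (Re w)) - f (g t) - (g (Re w) - g t) * l) +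
   (g (Re w) - g t - (w - t) * m) * l) by ring.
eapply Rle_trans; [apply Cmod_triangle|]; rewrite Cmod_mult.
apply Rle_trans with (e * ((1 + Cmod m) * Cmod (w - t)) + e' * Cmod (w - t) * (1 + Cmod l))%R.
- apply Rplus_le_compat.
  + eapply Rle_trans; [exact Hd2|]; apply Rmult_le_compat_l; lra.
  + apply Rmult_le_compat; auto using Cmod_ge_0; lra.
- right; unfold e, e'; field; lra.
Qed.

Lemma derR_mult (u v : R -> C) (t : R) (l m : C) :
  derR u t l -> derR v t m -> derR (fun x => u x * v x) t (l * v t + u t * m).
Proof. exact (der_mult Real (fun w => u (Re w)) (fun w => v (Re w)) t l m). Qed.

Lemma derR_plus (u v : R -> C) (t : R) (l m : C) :
  derR u t l -> derR v t m -> derR (fun x => u x + v x) t (l + m).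
Proof. exact (der_plus Real (fun w => u (Re w)) (fun w => v (Re w)) t l m). Qed.

Lemma derR_const (c : C) (t : R) : derR (fun _ => c) t 0.
Proof. apply der_const. Qed.

Lemma derR_mult_l (c : C) (u : R -> C) (t : R) (l : C) :
  derR u t l -> derR (fun x => c * u x) t (c * l).
Proof.
exact (der_scale Real c (fun w => u (Re w)) t l).
Qed.

(** * The unit circle *)

Definition expi (t : R) : C := (cos t, sin t).

Lemma expi_plus (a b : R) : expi (a + b) = expi a * expi b.
Proof.
unfold expi, Cmult; simpl; rewrite cos_plus, sin_plus; f_equal; ring.
Qed.

Lemma expi_opp (a : R) : expi (- a) = Cconj (expi a).
Proof. unfold expi, Cconj; simpl; rewrite cos_neg, sin_neg; auto. Qed.

Lemma expi_0 : expi 0 = 1.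
Proof. unfold expi; rewrite cos_0, sin_0; auto. Qed.

Lemma Cmod_expi (a : R) : Cmod (expi a) = 1%R.
Proof.
unfold Cmod, expi; simpl.
replace (cos a * (cos a * 1) + sin a * (sin a * 1))%R with (Rsqr (sin a) + Rsqr (cos a))%R
  by (unfold Rsqr; ring).
rewrite sin2_cos2; apply sqrt_1.
Qed.

Lemma expi_neq_0 (a : R) : expi a <> 0.
Proof. apply Cmod_gt_0; rewrite Cmod_expi; lra. Qed.

Lemma expi_opp_l (a : R) : expi (- a) * expi a = 1.
Proof.
rewrite <- expi_plus; replace (- a + a)%R with 0%R by ring; apply expi_0.
Qed.

Lemma expi_period (a : R) : expi (a + 2 * PI) = expi a.
Proof.
unfold expi; replace (a + 2 * PI)%R with (a + 2 * INR 1 * PI)%R by (simpl; ring).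
rewrite cos_period, sin_period; auto.
Qed.

Lemma expi_pow (t : R) (n : nat) : expi t ^ n = expi (INR n * t).
Proof.
induction n as [|n IH].
- simpl; rewrite Rmult_0_l, expi_0; auto.
- rewrite Cpow_S, IH, <- expi_plus, S_INR; f_equal; ring.
Qed.

Lemma derR_expi (t : R) : derR expi t (Ci * expi t).
Proof.
replace (Ci * expi t) with (- sin t, cos t)%R
  by (unfold Ci, expi, Cmult; simpl; f_equal; ring).
apply derR_pair; auto_derive; auto; ring.
Qed.

Lemma derR_RtoC (t : R) : derR RtoC t 1.
Proof. apply derR_pair; auto_derive; auto. Qed.

Lemma Cmod1_expi (z : C) : Cmod z = 1%R ->
  exists t : R, - PI <= t <= PI /\ z = expi t.
Proof.
intros Hz; destruct z as [x y].
assert (E : (x * x + y * y = 1)%R).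
{ pose proof (Cmod2_alt (x, y)) as K; rewrite Hz in K; simpl in K; lra. }
assert (X : -1 <= x <= 1) by nra.
pose proof (acos_bound x) as B.
assert (S : (sin (acos x) = sqrt (y * y))%R).
{ rewrite sin_acos by auto; f_equal; unfold Rsqr; lra. }
destruct (Rle_dec 0 y) as [Y|Y].
- exists (acos x); split; [lra|].
  unfold expi; rewrite cos_acos, S, sqrt_square by auto; auto.
- exists (- acos x)%R; split; [lra|].
  unfold expi; rewrite cos_neg, sin_neg, cos_acos, S by auto.
  replace (y * y)%R with ((- y) * (- y))%R by ring.
  rewrite sqrt_square by lra; f_equal; ring.
Qed.

Lemma polar_form (z : C) : exists t : R, - PI <= t <= PI /\ z = Cmod z * expi t.
Proof.
destruct (Ceq_dec z 0) as [->|H].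
- exists 0%R; pose proof PI_RGT_0; split; [lra|rewrite Cmod_0; ring].
- assert (H0 : 0 < Cmod z) by (apply Cmod_gt_0; auto).
  destruct (Cmod1_expi (z / Cmod z)) as [t [It Ht]].
  + rewrite Cmod_div, Cmod_RtoC_pos; [field; lra|lra|].
    intros K; apply RtoC_inj in K; lra.
  + exists t; split; auto; rewrite <- Ht; field; intros K; apply RtoC_inj in K; lra.
Qed.

(* The mean value inequality, by projecting on the direction of the
   increment. *)
Lemma mean_value_dominated (u u' : R -> C) (g g' : R -> R) (a b : R) :
  a <= b ->
  (forall t, a <= t <= b -> derR u t (u' t)) ->
  (forall t, a <= t <= b -> is_derive g t (g' t)) ->
  (forall t, a <= t <= b -> Cmod (u' t) <= g' t) ->
  Cmod (u b - u a) <= g b - g a.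
Proof.
intros ab Hu Hg HM; destruct (polar_form (u b - u a)) as [th [_ Eth]].
set (c := expi (- th)).
set (phi := fun t => (Re (c * u t) - g t)%R).
assert (D : forall t, a <= t <= b -> is_derive phi t (Re (c * u' t) - g' t)%R).
{ intros t Ht; apply (is_derive_minus (V := R_NormedModule)); [|auto].
  apply (derR_Re (fun t => c * u t)), derR_mult_l, Hu, Ht. }
destruct (MVT_gen phi a b (fun t => Re (c * u' t) - g' t)%R) as [s [Hs E]];
  rewrite Rmin_left, Rmax_right in * by auto.
- intros t Ht; apply D; lra.
- intros t Ht; apply continuity_pt_filterlim.
  apply (ex_derive_continuous phi); eexists; apply D; lra.
- assert (E' : (phi b - phi a = Cmod (u b - u a) - (g b - g a))%R).
  { replace (Cmod (u b - u a)) with (Re (c * (u b - u a))).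
    - unfold phi; destruct c, (u b), (u a); simpl; ring.
    - rewrite Eth at 1; unfold c; rewrite (Cmult_comm (expi _)), <- Cmult_assoc, (Cmult_comm (expi th)).
      rewrite expi_opp_l, Cmult_1_r; auto. }
  assert (K : Re (c * u' s) <= g' s).
  { eapply Rle_trans; [apply Rle_abs|]; eapply Rle_trans; [apply re_le_Cmod|].
    unfold c; rewrite Cmod_mult, Cmod_expi, Rmult_1_l; auto. }
  assert ((Re (c * u' s) - g' s) * (b - a) <= 0) by nra; lra.
Qed.

Lemma mean_value_Cmod (u u' : R -> C) (a b M : R) :
  a <= b ->
  (forall t, a <= t <= b -> derR u t (u' t) /\ Cmod (u' t) <= M) ->
  Cmod (u b - u a) <= M * (b - a).
Proof.
intros ab H.
replace (M * (b - a))%R with (M * b - M * a)%R by ring.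
apply (mean_value_dominated u u' (fun t => M * t)%R (fun _ => M)); auto;
  try (intros t Ht; apply H; auto).
intros t _; auto_derive; auto; ring.
Qed.

Lemma mean_value_Rabs (u u' : R -> C) (s t M : R) :
  (forall x, Rabs (x - t) <= Rabs (s - t) -> derR u x (u' x) /\ Cmod (u' x) <= M) ->
  Cmod (u s - u t) <= M * Rabs (s - t).
Proof.
intros H; destruct (Rle_dec t s) as [L|L].
- rewrite Rabs_pos_eq in * by lra; apply (mean_value_Cmod u u'); auto.
  intros x Hx; apply H; rewrite Rabs_pos_eq; lra.
- rewrite Rabs_left1 in * by lra; replace (- (s - t))%R with (t - s)%R in * by ring.
  rewrite Cmod_sub_sym; apply (mean_value_Cmod u u'); [lra|].
  intros x Hx; apply H; rewrite Rabs_left1; lra.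
Qed.

Lemma expi_lipschitz (a b : R) : Cmod (expi a - expi b) <= Rabs (a - b).
Proof.
rewrite <- Rmult_1_l; apply (mean_value_Rabs expi (fun t => Ci * expi t)).
intros t _; split; [apply derR_expi|rewrite Cmod_mult, Cmod_Ci, Cmod_expi; lra].
Qed.

(** On [0, 1] the Taylor bound x - x^3/6 gives 5x/6. On [1, pi/2] monotonicity gives sin y >= sin 1
    >= 5/6, and y <= 2 halves the slope to 5/12. *)
Lemma sin_lower (y : R) : (0 <= y <= PI / 2 -> 5 / 12 * y <= sin y).
Proof.
intros [y0 y1].
pose proof PI_4.
assert (L : forall x, (0 <= x <= 1 -> 5 / 6 * x <= sin x)).
{ intros x Hx; destruct (pre_sin_bound x 0) as [K _]; try lra.
  replace (sin_approx x (2 * 0 + 1)) with (x - x * (x * x) / 6)%R in K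
    by (unfold sin_approx, sin_term; simpl; field).
  nra. }
destruct (Rle_dec y 1).
- specialize (L y); lra.
- apply Rle_trans with (sin 1); [specialize (L 1%R); lra|].
  apply sin_incr_1; lra.
Qed.

(** By 1 - cos x = 2 sin^2(x/2) and the slope 5/12, the left side is at least (25/288) x^2, which
    exceeds x^2/12. *)
Lemma one_minus_cos_lower (x : R) :
  (Rabs x <= PI -> x * x / 12 <= 1 - cos x).
Proof.
intros Hx.
assert (K : forall x, (0 <= x <= PI -> x * x / 12 <= 1 - cos x)).
{ intros y Hy.
  assert (S : 5 / 12 * (y / 2) <= sin (y / 2)) by (apply sin_lower; lra).
  replace y with (2 * (y / 2))%R at 3 by field.
  rewrite cos_2a_sin.
  set (q := sin (y / 2)) in *.
  assert (0 <= 5 / 12 * (y / 2)) by lra.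
  assert ((5 / 12 * (y / 2)) * (5 / 12 * (y / 2)) <= q * q) by (apply Rmult_le_compat; lra).
  nra. }
destruct (Rle_dec 0 x).
- apply K; rewrite Rabs_pos_eq in Hx; lra.
- rewrite <- cos_neg; replace (x * x)%R with (- x * - x)%R by ring.
  apply K; rewrite Rabs_left in Hx; lra.
Qed.

(** The square of the chord is 2 (1 - cos x) >= x^2/6 >= x^2/9. It turns closeness in the plane into
    closeness of angles. *)
Lemma Cmod_expi_sub1_lower (x : R) :
  (Rabs x <= PI -> Rabs x <= 3 * Cmod (expi x - 1)).
Proof.
intros Hx; pose proof (one_minus_cos_lower x Hx) as K.
assert (E : (Cmod (expi x - 1) ^ 2 = 2 * (1 - cos x))%R).
{ rewrite Cmod2_alt; unfold expi; simpl.
  pose proof (sin2_cos2 x); unfold Rsqr in *; nra. }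
pose proof (Cmod_ge_0 (expi x - 1)); pose proof (Rabs_pos x).
pose proof (Rabs_sqr x).
nra.
Qed.

Lemma Cmod_kernel_sqr (r x : R) :
  (Cmod (1 - r * expi (- x)) ^ 2 = (1 - r) * (1 - r) + 2 * r * (1 - cos x))%R.
Proof.
rewrite Cmod2_alt; unfold expi; simpl; rewrite cos_neg, sin_neg.
pose proof (sin2_cos2 x); unfold Rsqr in *; nra.
Qed.

(** With h = 1 - r the square is h^2 + 2r (1 - cos x) >= h^2 + x^2/12, as 2r >= 1, and (h + |x|)^2
    <= 2 (h^2 + x^2) yields the constant 24. All estimates of the Cauchy and Poisson kernels near
    the circle rest on this comparison. *)
Lemma Cmod_kernel_lower (r x : R) :
  (1 / 2 <= r < 1 -> Rabs x <= PI ->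
   (1 - r + Rabs x) ^ 2 / 24 <= Cmod (1 - r * expi (- x)) ^ 2).
Proof.
intros Hr Hx; rewrite Cmod_kernel_sqr.
pose proof (one_minus_cos_lower x Hx).
pose proof (Rabs_sqr x).
set (c := (1 - cos x)%R) in *; set (a := Rabs x) in *; clearbody a c.
assert ((1 - r + a) ^ 2 <= 2 * ((1 - r) * (1 - r) + a * a))
  by (pose proof (Rle_0_sqr (1 - r - a)); unfold Rsqr in *; nra).
assert (0 <= a * a) by (apply Rle_0_sqr).
assert (a * a / 12 <= 2 * r * c) by nra.
assert (0 <= (1 - r) * (1 - r)) by (apply Rle_0_sqr).
lra.
Qed.

Lemma one_minus_neq_0 (w : C) : Cmod w < 1 -> 1 - w <> 0.
Proof.
intros H K; assert (E : w = 1) by (replace w with (1 - (1 - w)) by ring; rewrite K; ring).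
subst w; rewrite Cmod_1 in H; lra.
Qed.

(** * Integrals of complex-valued functions of a real variable *)

Notation is_CInt := (@is_RInt C_R_NormedModule).
Definition CInt (u : R -> C) (a b : R) : C := @RInt C_R_CompleteNormedModule u a b.
Definition contR_at (u : R -> C) (t : R) : Prop :=
  filterlim u (locally t) (locally (u t)).
Definition contR (u : R -> C) : Prop := forall t, contR_at u t.

Lemma is_CInt_components (u : R -> C) (a b : R) (I : C) :
  is_CInt u a b I <->
  is_RInt (fun t => Re (u t)) a b (Re I) /\ is_RInt (fun t => Im (u t)) a b (Im I).
Proof.
split.
- intros H; split.
  + apply (is_RInt_fct_extend_fst (U := R_NormedModule) (V := R_NormedModule) _ _ _ _ H).
  + apply (is_RInt_fct_extend_snd (U := R_NormedModule) (V := R_NormedModule) _ _ _ _ H).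
- intros [H1 H2]; destruct I as [x y].
  apply (is_RInt_fct_extend_pair (U := R_NormedModule) (V := R_NormedModule) _ _ _ _ _ H1 H2).
Qed.

Lemma CInt_correct (u : R -> C) (a b : R) : a <= b ->
  (forall t, a <= t <= b -> contR_at u t) -> is_CInt u a b (CInt u a b).
Proof.
intros ab H; apply (@RInt_correct C_R_CompleteNormedModule).
apply (@ex_RInt_continuous C_R_CompleteNormedModule).
rewrite Rmin_left, Rmax_right by auto; exact H.
Qed.

Lemma is_CInt_unique (u : R -> C) (a b : R) (I : C) :
  is_CInt u a b I -> CInt u a b = I.
Proof. apply (@is_RInt_unique C_R_CompleteNormedModule). Qed.

Lemma is_CInt_plus (u v : R -> C) (a b : R) (I J : C) :
  is_CInt u a b I -> is_CInt v a b J -> is_CInt (fun t => u t + v t) a b (I + J).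
Proof. apply (@is_RInt_plus C_R_NormedModule). Qed.

Lemma is_CInt_mult_l (u : R -> C) (a b : R) (c I : C) :
  is_CInt u a b I -> is_CInt (fun t => c * u t) a b (c * I).
Proof.
rewrite !is_CInt_components; intros [H1 H2]; destruct c as [x y]; split.
- apply (is_RInt_minus _ _ _ _ _ _ (is_RInt_scal _ _ _ x _ H1) (is_RInt_scal _ _ _ y _ H2)).
- apply (is_RInt_plus _ _ _ _ _ _ (is_RInt_scal _ _ _ x _ H2) (is_RInt_scal _ _ _ y _ H1)).
Qed.

Lemma is_CInt_conj (u : R -> C) (a b : R) (I : C) :
  is_CInt u a b I -> is_CInt (fun t => Cconj (u t)) a b (Cconj I).
Proof.
rewrite !is_CInt_components; intros [H1 H2]; split; auto.
apply (is_RInt_opp _ _ _ _ H2).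
Qed.

Lemma is_CInt_const (c : C) (a b : R) : is_CInt (fun _ => c) a b (RtoC (b - a) * c).
Proof.
rewrite is_CInt_components; split.
- rewrite Re_RtoC_mult; apply (is_RInt_const (V := R_NormedModule)).
- rewrite Im_RtoC_mult; apply (is_RInt_const (V := R_NormedModule)).
Qed.

Lemma is_CInt_bound (u : R -> C) (g : R -> R) (a b : R) (I : C) (J : R) :
  a <= b -> (forall t, a <= t <= b -> Cmod (u t) <= g t) ->
  is_CInt u a b I -> is_RInt g a b J -> Cmod I <= J.
Proof.
intros ab H HI HJ.
rewrite <- norm_CR.
apply (norm_RInt_le _ _ _ _ _ _ ab) with (2 := HI) (3 := HJ).
intros; rewrite norm_CR; auto.
Qed.

Lemma is_CInt_bound_const (u : R -> C) (M : R) (a b : R) (I : C) :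
  a <= b -> (forall t, a <= t <= b -> Cmod (u t) <= M) ->
  is_CInt u a b I -> Cmod I <= M * (b - a).
Proof.
intros ab H HI.
apply (is_CInt_bound u (fun _ => M) a b I _ ab H HI).
replace (M * (b - a))%R with (scal (b - a)%R M) by (unfold scal; simpl; unfold mult; simpl; ring).
apply (is_RInt_const (V := R_NormedModule)).
Qed.

Lemma is_CInt_Chasles (u : R -> C) (a b c : R) (I J : C) :
  is_CInt u a b I -> is_CInt u b c J -> is_CInt u a c (I + J).
Proof. apply (@is_RInt_Chasles C_R_NormedModule). Qed.

Lemma is_CInt_derive (U U' : R -> C) (a b : R) : a <= b ->
  (forall t, a <= t <= b -> derR U t (U' t)) ->
  (forall t, a <= t <= b -> contR_at U' t) ->
  is_CInt U' a b (U b - U a).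
Proof.
intros ab HU HC.
apply (@is_RInt_derive C_R_CompleteNormedModule);
  rewrite Rmin_left, Rmax_right by auto; intros t Ht.
- apply derR_is_derive; auto.
- apply HC; auto.
Qed.

Lemma is_CInt_minus (u v : R -> C) (a b : R) (I J : C) :
  is_CInt u a b I -> is_CInt v a b J -> is_CInt (fun t => u t - v t) a b (I - J).
Proof. apply (@is_RInt_minus C_R_NormedModule). Qed.

Lemma is_CInt_near_derive (u U U' : R -> C) (a b M : R) (I : C) : a <= b ->
  (forall t, a <= t <= b -> derR U t (U' t)) ->
  (forall t, a <= t <= b -> contR_at U' t) ->
  (forall t, a <= t <= b -> Cmod (u t - U' t) <= M) ->
  is_CInt u a b I ->
  Cmod (I - (U b - U a)) <= M * (b - a).
Proof.
intros ab HU HC HM HI.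
apply (is_CInt_bound_const (fun t => u t - U' t) M a b _ ab HM).
apply is_CInt_minus; auto; apply is_CInt_derive; auto.
Qed.

(** * Averages over the circle *)

Definition avg (u : R -> C) : C := RtoC (/ (2 * PI)) * CInt u (- PI) PI.

Lemma contR_plus (u v : R -> C) : contR u -> contR v -> contR (fun t => u t + v t).
Proof. intros Hu Hv t; apply filterlim_C_plus; [apply _|apply Hu|apply Hv]. Qed.

Lemma contR_mult (u v : R -> C) : contR u -> contR v -> contR (fun t => u t * v t).
Proof. intros Hu Hv t; apply filterlim_C_mult; [apply _|apply Hu|apply Hv]. Qed.

Lemma contR_minus (u v : R -> C) : contR u -> contR v -> contR (fun t => u t - v t).
Proof. intros Hu Hv t; apply filterlim_C_minus; [apply _|apply Hu|apply Hv]. Qed.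

Lemma contR_conj (u : R -> C) : contR u -> contR (fun t => Cconj (u t)).
Proof. intros Hu t; apply filterlim_C_conj; [apply _|apply Hu]. Qed.

Lemma contR_const (c : C) : contR (fun _ => c).
Proof. intros t; apply filterlim_const. Qed.

Lemma contR_inv (u : R -> C) : contR u -> (forall t, u t <> 0) -> contR (fun t => / u t).
Proof. intros Hu H0 t; apply filterlim_C_inv; [apply _|apply Hu|apply H0]. Qed.

Lemma contR_expi : contR expi.
Proof. intros t; eapply derR_continuous, derR_expi. Qed.

Lemma contR_comp (u : R -> C) (g : R -> R) :
  contR u -> (forall t, continuous g t) -> contR (fun t => u (g t)).
Proof.
intros Hu Hg t; unfold contR_at.
eapply filterlim_comp; [apply Hg|apply Hu].
Qed.

Lemma contR_pow (u : R -> C) (n : nat) : contR u -> contR (fun t => u t ^ n).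
Proof.
intros Hu; induction n as [|n IH]; [exact (contR_const 1)|].
apply (contR_mult u (fun t => u t ^ n)); auto.
Qed.

Lemma continuous_opp_R (t : R) : continuous Ropp t.
Proof. apply (continuous_opp (K := R_AbsRing) (V := R_NormedModule) (fun x => x)), continuous_id. Qed.

Lemma contR_expi_opp : contR (fun t => expi (- t)).
Proof. apply (contR_comp expi); [apply contR_expi|apply continuous_opp_R]. Qed.

Ltac contR_step tac :=
  match goal with
  | H : contR ?u |- contR ?u => exact H
  | |- contR (fun _ => ?c) => exact (contR_const c)
  | |- contR (fun t => @?f t * @?g t) => apply (contR_mult f g)
  | |- contR (fun t => @?f t - @?g t) => apply (contR_minus f g)
  | |- contR (fun t => @?f t + @?g t) => apply (contR_plus f g)
  | |- contR (fun t => Cpow (@?f t) ?n) => apply (contR_pow f n)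
  | |- contR (fun t => Cconj (@?f t)) => apply (contR_conj f)
  | |- contR (fun t => expi (- t)) => exact contR_expi_opp
  | |- contR (fun t => ?u t) => change (contR u)
  | |- _ => tac
  end.

Ltac solve_contR := repeat contR_step ltac:(solve [auto]).

Lemma PI_range : - PI <= PI.
Proof. pose proof PI_RGT_0; lra. Qed.

Lemma two_PI_neq_0 : RtoC (2 * PI) <> 0.
Proof. intros K; apply RtoC_inj in K; pose proof PI_RGT_0; lra. Qed.

Lemma avg_correct (u : R -> C) : contR u ->
  is_CInt u (- PI) PI (RtoC (2 * PI) * avg u).
Proof.
intros Hu; pose proof PI_RGT_0.
replace (RtoC (2 * PI) * avg u) with (CInt u (- PI) PI).
- apply CInt_correct; auto; apply PI_range.
- unfold avg; rewrite RtoC_inv by lra; field; apply two_PI_neq_0.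
Qed.

Lemma avg_unique (u : R -> C) (c : C) :
  is_CInt u (- PI) PI (RtoC (2 * PI) * c) -> avg u = c.
Proof.
intros H; pose proof PI_RGT_0; unfold avg; rewrite (is_CInt_unique _ _ _ _ H), RtoC_inv by lra.
field; apply two_PI_neq_0.
Qed.

Lemma avg_ext (u v : R -> C) : (forall t, u t = v t) -> avg u = avg v.
Proof. intros H; replace v with u; auto; apply functional_extensionality; auto. Qed.

Lemma avg_plus (u v : R -> C) : contR u -> contR v ->
  avg (fun t => u t + v t) = avg u + avg v.
Proof.
intros Hu Hv; apply avg_unique.
rewrite Cmult_plus_distr_l; apply is_CInt_plus; apply avg_correct; auto.
Qed.

Lemma avg_mult_l (u : R -> C) (c : C) : contR u -> avg (fun t => c * u t) = c * avg u.
Proof.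
intros Hu; apply avg_unique.
replace (RtoC (2 * PI) * (c * avg u)) with (c * (RtoC (2 * PI) * avg u)) by ring.
apply is_CInt_mult_l, avg_correct; auto.
Qed.

Lemma avg_minus (u v : R -> C) : contR u -> contR v ->
  avg (fun t => u t - v t) = avg u - avg v.
Proof.
intros Hu Hv; apply avg_unique.
replace (RtoC (2 * PI) * (avg u - avg v)) with
  (RtoC (2 * PI) * avg u - RtoC (2 * PI) * avg v) by ring.
apply is_CInt_minus; apply avg_correct; auto.
Qed.

Lemma avg_conj (u : R -> C) : contR u -> avg (fun t => Cconj (u t)) = Cconj (avg u).
Proof.
intros Hu; apply avg_unique.
replace (RtoC (2 * PI) * Cconj (avg u)) with (Cconj (RtoC (2 * PI) * avg u)).
- apply is_CInt_conj, avg_correct; auto.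
- rewrite Cmult_conj, Cconj_RtoC; auto.
Qed.

Lemma avg_const (c : C) : avg (fun _ => c) = c.
Proof.
apply avg_unique.
replace (2 * PI)%R with (PI - - PI)%R by ring; apply is_CInt_const.
Qed.

Lemma avg_bound (u : R -> C) (g : R -> R) (J : R) : contR u ->
  (forall t, - PI <= t <= PI -> Cmod (u t) <= g t) ->
  is_RInt g (- PI) PI J -> Cmod (avg u) <= J / (2 * PI).
Proof.
intros Hu H HJ; pose proof PI_RGT_0.
pose proof (is_CInt_bound _ _ _ _ _ _ PI_range H (avg_correct u Hu) HJ) as K.
rewrite Cmod_mult, Cmod_RtoC_pos in K by lra.
apply Rmult_le_reg_r with (2 * PI)%R; [lra|].
unfold Rdiv; rewrite Rmult_assoc, Rinv_l by lra; lra.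
Qed.

Lemma avg_bound_const (u : R -> C) (M : R) : contR u ->
  (forall t, - PI <= t <= PI -> Cmod (u t) <= M) -> Cmod (avg u) <= M.
Proof.
intros Hu H; pose proof PI_RGT_0.
pose proof (is_CInt_bound_const _ _ _ _ _ PI_range H (avg_correct u Hu)) as K.
rewrite Cmod_mult, Cmod_RtoC_pos in K by lra.
apply Rmult_le_reg_r with (2 * PI)%R; lra.
Qed.

Lemma avg_Re_lower (u : R -> C) (m : R) : contR u ->
  (forall t, m <= Re (u t)) -> m <= Re (avg u).
Proof.
intros Hu H; pose proof PI_RGT_0.
pose proof (avg_correct u Hu) as K; apply is_CInt_components in K as [K _].
rewrite Re_RtoC_mult in K.
assert (L := is_RInt_const (V := R_NormedModule) (- PI) PI m).
pose proof (is_RInt_le _ _ _ _ _ _ PI_range L K (fun t _ => H t)) as P.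
change ((PI - - PI) * m <= 2 * PI * Re (avg u)) in P.
apply Rmult_le_reg_l with (2 * PI)%R; lra.
Qed.

Lemma is_CInt_shift (u : R -> C) (a b s : R) (I : C) :
  is_CInt u (a + s) (b + s) I -> is_CInt (fun t => u (t + s)%R) a b I.
Proof.
intros H.
assert (E : is_CInt (fun t => @scal R_AbsRing C_R_NormedModule 1%R (u (1 * t + s)%R)) a b I).
{ apply is_RInt_comp_lin; rewrite !Rmult_1_l; exact H. }
apply is_RInt_ext with (2 := E); intros x _.
rewrite Rmult_1_l; apply (@scal_one R_AbsRing C_R_NormedModule).
Qed.

Lemma periodic_Z (u : R -> C) : (forall t, u (t + 2 * PI)%R = u t) ->
  forall (n : Z) t, u (t + IZR n * (2 * PI))%R = u t.
Proof.
intros H; assert (K : forall (n : nat) t, u (t + INR n * (2 * PI))%R = u t).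
{ induction n as [|n IH]; intros t; [simpl; f_equal; ring|].
  rewrite S_INR, <- (IH t), <- (H (t + INR n * (2 * PI))%R); f_equal; ring. }
intros [|p|p] t.
- f_equal; ring.
- rewrite <- (K (Pos.to_nat p) t); f_equal; rewrite INR_IZR_INZ, positive_nat_Z; auto.
- rewrite <- (K (Pos.to_nat p) (t + IZR (Z.neg p) * (2 * PI))%R); f_equal.
  rewrite INR_IZR_INZ, positive_nat_Z.
  replace (Z.neg p) with (- Z.pos p)%Z by auto; rewrite opp_IZR; ring.
Qed.

(** The intervals [-pi + s, pi + s] and [-pi, pi] differ by two pieces that periodicity identifies.
    The integrals are oriented, so the sign of [s] does not matter. *)
Lemma avg_shift (u : R -> C) (s : R) : contR u ->
  (forall t, u (t + 2 * PI)%R = u t) -> avg (fun t => u (t + s)%R) = avg u.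
Proof.
intros Hu Hp; apply avg_unique, is_CInt_shift.
assert (A : (is_CInt u (- PI + s) (- PI) (CInt u (- PI + s) (- PI)))).
{ apply (@RInt_correct C_R_CompleteNormedModule).
  apply (@ex_RInt_continuous C_R_CompleteNormedModule); intros; apply Hu. }
replace (RtoC (2 * PI) * avg u) with
  ((CInt u (- PI + s) (- PI) + RtoC (2 * PI) * avg u) - CInt u (- PI + s) (- PI)) by ring.
apply (is_CInt_Chasles u _ PI).
- apply is_CInt_Chasles with (- PI)%R; auto; apply avg_correct; auto.
- apply (is_RInt_swap (V := C_R_NormedModule)).
  apply is_RInt_ext with (fun t => u (t + - (2 * PI))%R).
  { intros x _; rewrite <- (Hp (x + - (2 * PI))%R); f_equal; ring. }
  apply is_CInt_shift.
  replace (PI + s + - (2 * PI))%R with (- PI + s)%R by ring.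
  replace (PI + - (2 * PI))%R with (- PI)%R by ring; exact A.
Qed.

Lemma avg_expi_pow (n : nat) : avg (fun t => expi (- t) ^ S n) = 0.
Proof.
apply avg_unique.
set (m := INR (S n)).
assert (m0 : 0 < m) by (apply lt_0_INR; lia).
assert (mC : RtoC m <> 0) by (intros K; apply RtoC_inj in K; lra).
(* A primitive of e^{-imt}, with m = n + 1 nonzero; it takes equal values at -pi and pi. *)
set (U := fun t => (Ci / m) * expi (- t) ^ S n).
replace (RtoC (2 * PI) * 0) with (U PI - U (- PI)%R).
- apply (is_CInt_derive U); [apply PI_range| |].
  + intros t _; unfold U.
    replace (expi (- t) ^ S n) with
      ((Ci / m) * (- m * (Ci * expi (- t) ^ S n))).
    2:{ replace (Ci / m * (- m * (Ci * expi (- t) ^ S n)))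
         with (- (Ci * Ci) * expi (- t) ^ S n) by (field; auto).
        replace (Ci * Ci) with (- (1)) by (unfold Ci, RtoC, Cmult, Copp; simpl; f_equal; ring).
        ring. }
    apply derR_mult_l.
    replace (fun t => expi (- t) ^ S n) with (fun t => expi (- m * t)).
    2:{ apply functional_extensionality; intros x; rewrite expi_pow; f_equal; fold m; ring. }
    rewrite expi_pow; fold m.
    replace (m * - t)%R with (- m * t)%R by ring.
    unfold expi; replace (- m * (Ci * (cos (- m * t), sin (- m * t)))) with
      (m * sin (- m * t), - m * cos (- m * t))%R
      by (unfold Ci, RtoC, Cmult, Copp; simpl; f_equal; ring).
    apply derR_pair; auto_derive; auto; ring.
  + intros t _; apply (contR_pow (fun t => expi (- t))), contR_expi_opp.
- unfold U; replace (expi (- - PI)) with (expi (- PI)); [ring|].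
  rewrite <- (expi_period (- PI)); f_equal; ring.
Qed.

(** * Goursat's lemma in polar coordinates *)

Section Bisection.

Context (E : R -> R -> R -> R -> C) (A B S T : R) (AB : A < B) (ST : S < T).

Context (add_l : forall a m b s t, A <= a <= m -> m <= b <= B ->
  S <= s <= t -> t <= T -> E a b s t = E a m s t + E m b s t).

Context (add_r : forall a b s m t, A <= a <= b -> b <= B ->
  S <= s <= m -> m <= t <= T -> E a b s t = E a b s m + E a b m t).

Context (small : forall x y, A <= x <= B -> S <= y <= T ->
  forall eps, 0 < eps -> exists d, 0 < d /\
  forall a b s t, A <= a <= x -> x <= b <= B -> S <= s <= y ->
    y <= t <= T -> b - a < d -> t - s < d ->
    Cmod (E a b s t) <= eps * (b - a + (t - s)) ^ 2).

Record box := Box { box_l : R; box_r : R; box_b : R; box_t : R;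
  boxP : (A <= box_l <= box_r /\ box_r <= B /\ S <= box_b <= box_t /\ box_t <= T) }.

Definition Ebox (Q : box) : C := E (box_l Q) (box_r Q) (box_b Q) (box_t Q).

Definition half_box (Q Q' : box) : Prop :=
  (box_l Q <= box_l Q' /\ box_r Q' <= box_r Q /\ box_b Q <= box_b Q' /\ box_t Q' <= box_t Q /\
   box_r Q' - box_l Q' = (box_r Q - box_l Q) / 2 /\ box_t Q' - box_b Q' = (box_t Q - box_b Q) / 2 /\
   Cmod (Ebox Q) <= 4 * Cmod (Ebox Q'))%R.

Lemma half_box_exists (Q : box) : exists Q', half_box Q Q'.
Proof.
destruct Q as [a b s t [Ha [Hb [Hs Ht]]]].
set (m := ((a + b) / 2)%R); set (n := ((s + t) / 2)%R).
assert (P1 : (A <= a <= m /\ m <= B /\ S <= s <= n /\ n <= T)) by (unfold m, n; repeat split; lra).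
assert (P2 : (A <= m <= b /\ b <= B /\ S <= s <= n /\ n <= T)) by (unfold m, n; repeat split; lra).
assert (P3 : (A <= a <= m /\ m <= B /\ S <= n <= t /\ t <= T)) by (unfold m, n; repeat split; lra).
assert (P4 : (A <= m <= b /\ b <= B /\ S <= n <= t /\ t <= T)) by (unfold m, n; repeat split; lra).
assert (D : E a b s t = (E a m s n + E a m n t) + (E m b s n + E m b n t)).
{ rewrite (add_l a m b), (add_r a m s n t), (add_r m b s n t); auto; unfold m, n; lra. }
assert (K : Cmod (E a b s t) <= (Cmod (E a m s n) + Cmod (E a m n t)) +
   (Cmod (E m b s n) + Cmod (E m b n t))).
{ rewrite D; eapply Rle_trans; [apply Cmod_triangle|].
  apply Rplus_le_compat; apply Cmod_triangle. }
destruct (Rle_dec (Cmod (E a b s t)) (4 * Cmod (E a m s n))) as [H|H];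
 [exists (Box _ _ _ _ P1); unfold half_box, Ebox, m, n in *; simpl; repeat split; lra|].
destruct (Rle_dec (Cmod (E a b s t)) (4 * Cmod (E m b s n))) as [H2|H2];
 [exists (Box _ _ _ _ P2); unfold half_box, Ebox, m, n in *; simpl; repeat split; lra|].
destruct (Rle_dec (Cmod (E a b s t)) (4 * Cmod (E a m n t))) as [H3|H3];
 [exists (Box _ _ _ _ P3); unfold half_box, Ebox, m, n in *; simpl; repeat split; lra|].
exists (Box _ _ _ _ P4); unfold half_box, Ebox, m, n in *; simpl; repeat split; lra.
Qed.

Definition next_box (Q : box) : box :=
  proj1_sig (constructive_indefinite_description _ (half_box_exists Q)).

Lemma next_boxP (Q : box) : half_box Q (next_box Q).
Proof. unfold next_box; destruct constructive_indefinite_description; auto. Qed.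

Lemma nested_point (a b : nat -> R) :
  (forall n, a n <= a (n + 1)%nat) -> (forall n, b (n + 1)%nat <= b n) ->
  (forall n, a n <= b n) -> exists x, forall n, a n <= x <= b n.
Proof.
intros Ha Hb Hab.
assert (Ma : forall n k, a n <= a (n + k)%nat).
{ intros n; induction k as [|k IH]; [rewrite Nat.add_0_r; lra|].
  replace (n + Datatypes.S k)%nat with (n + k + 1)%nat by lia.
  specialize (Ha (n + k)%nat); lra. }
assert (Mb : forall n k, b (n + k)%nat <= b n).
{ intros n; induction k as [|k IH]; [rewrite Nat.add_0_r; lra|].
  replace (n + Datatypes.S k)%nat with (n + k + 1)%nat by lia.
  specialize (Hb (n + k)%nat); lra. }
assert (U : forall n m, a m <= b n).
{ intros n m; specialize (Ma m n); specialize (Mb n m); specialize (Hab (n + m)%nat).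
  rewrite (Nat.add_comm m n) in Ma; lra. }
destruct (completeness (fun x => exists n, x = a n)) as [x [Hx1 Hx2]].
- exists (b 0%nat); intros y [n ->]; auto.
- exists (a 0%nat), 0%nat; auto.
- exists x; intros n; split; [apply Hx1; exists n; auto|].
  apply Hx2; intros y [m ->]; auto.
Qed.

(** Goursat's argument for any function of rectangles that is additive in both directions. Smallness
    is asked only of rectangles containing the given point, which is what differentiability at that
    point provides; the nested boxes meet in such a point. *)
Lemma bisection_zero : E A B S T = 0.
Proof.
assert (P : (A <= A <= B /\ B <= B /\ S <= S <= T /\ T <= T)) by (repeat split; lra).
set (Q0 := Box A B S T P).
set (Q := fun n => Nat.iter n next_box Q0).
assert (HQ : forall n, half_box (Q n) (Q (n + 1)%nat)).
{ intros n; rewrite Nat.add_1_r; apply next_boxP. }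
assert (W : forall n, ((box_r (Q n) - box_l (Q n)) * 2 ^ n = B - A /\
   (box_t (Q n) - box_b (Q n)) * 2 ^ n = T - S /\
   Cmod (E A B S T) <= Cmod (Ebox (Q n)) * (2 ^ n * 2 ^ n))%R).
{ induction n as [|n [I1 [I2 I3]]].
  - simpl; unfold Ebox; simpl; repeat split; lra.
  - destruct (HQ n) as [_ [_ [_ [_ [J1 [J2 J3]]]]]].
    rewrite Nat.add_1_r in J1, J2, J3.
    simpl pow; rewrite J1, J2; split; [lra|split; [lra|]].
    assert (0 < 2 ^ n) by (apply pow_lt; lra).
    eapply Rle_trans; [exact I3|].
    replace (Cmod (Ebox (Q (Datatypes.S n))) * (2 * 2 ^ n * (2 * 2 ^ n)))%R with
      ((4 * Cmod (Ebox (Q (Datatypes.S n)))) * (2 ^ n * 2 ^ n))%R by ring.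
    apply Rmult_le_compat_r; nra. }
destruct (nested_point (fun n => box_l (Q n)) (fun n => box_r (Q n))) as [x Hx].
{ intros n; apply (HQ n). }
{ intros n; apply (HQ n). }
{ intros n; apply (boxP (Q n)). }
destruct (nested_point (fun n => box_b (Q n)) (fun n => box_t (Q n))) as [y Hy].
{ intros n; apply (HQ n). }
{ intros n; apply (HQ n). }
{ intros n; apply (boxP (Q n)). }
replace (E A B S T) with (E A B S T - 0 + 0) by ring.
apply C_small_eq; intros eps He.
set (L := (B - A + (T - S))%R); assert (L0 : 0 < L) by (unfold L; lra).
(* After N halvings width plus height is L / 2^N, so the factor 4^N lost in the descent cancels and
   the bound is e * L^2 = eps. *)
set (e := (eps / (L * L))%R); assert (e0 : 0 < e) by (unfold e; rpos).
destruct (small x y) with (eps := e) as [d [d0 Hd]]; auto.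
{ specialize (Hx 0%nat); simpl in Hx; lra. }
{ specialize (Hy 0%nat); simpl in Hy; lra. }
destruct (Pow_x_infinity 2 ltac:(rewrite Rabs_pos_eq; lra) (L / d + 1)%R) as [N HN].
specialize (HN N (le_n N)).
assert (Z : 0 < 2 ^ N) by (apply pow_lt; lra).
rewrite Rabs_pos_eq in HN by lra.
destruct (W N) as [W1 [W2 W3]].
assert (HL : L < d * 2 ^ N).
{ replace L with (d * (L / d))%R by (field; lra).
  apply Rmult_lt_compat_l; lra. }
destruct (boxP (Q N)) as [R1 [R2 [R3 R4]]].
specialize (Hx N); specialize (Hy N).
assert (K : Cmod (Ebox (Q N)) <= e * (box_r (Q N) - box_l (Q N) + (box_t (Q N) - box_b (Q N))) ^ 2).
{ apply Hd; try lra; apply Rmult_lt_reg_r with (2 ^ N)%R; auto; unfold L in HL; lra. }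
replace (E A B S T - 0 + 0 - 0) with (E A B S T) by ring.
eapply Rle_trans; [exact W3|].
apply Rle_trans with (e * (box_r (Q N) - box_l (Q N) + (box_t (Q N) - box_b (Q N))) ^ 2 * (2 ^ N * 2 ^ N))%R.
{ apply Rmult_le_compat_r; nra. }
right.
replace (e * (box_r (Q N) - box_l (Q N) + (box_t (Q N) - box_b (Q N))) ^ 2 * (2 ^ N * 2 ^ N))%R with
 (e * ((box_r (Q N) - box_l (Q N)) * 2 ^ N + (box_t (Q N) - box_b (Q N)) * 2 ^ N) ^ 2)%R by ring.
rewrite W1, W2; fold L; unfold e; field; lra.
Qed.

End Bisection.

Lemma Cmod_polar (r t : R) : 0 <= r -> Cmod (r * expi t) = r.
Proof. intros; rewrite Cmod_mult, Cmod_expi, Cmod_RtoC_pos; lra. Qed.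

Lemma derR_radius (t r : R) : derR (fun r : R => r * expi t) r (expi t).
Proof.
assert (H : derR (fun r : R => r * expi t) r (1 * expi t + r * 0))
  by exact (derR_mult RtoC (fun _ => expi t) r 1 0 (derR_RtoC r) (derR_const _ _)).
replace (1 * expi t + r * 0) with (expi t) in H by ring; exact H.
Qed.

Lemma derR_angle (r t : R) : derR (fun t => r * expi t) t (r * (Ci * expi t)).
Proof. apply derR_mult_l, derR_expi. Qed.

Lemma contR_tangent (r : R) : contR (fun t => r * (Ci * expi t)).
Proof. pose proof contR_expi; solve_contR. Qed.

Lemma Cmod_polar_sub (r r' t t' : R) : 0 <= r' <= 1 ->
  Cmod (r * expi t - r' * expi t') <= Rabs (r - r') + Rabs (t - t').
Proof.
intros H.
replace (r * expi t - r' * expi t') with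
  (RtoC (r - r') * expi t + r' * (expi t - expi t')) by (rewrite RtoC_minus; ring).
eapply Rle_trans; [apply Cmod_triangle|].
rewrite !Cmod_mult, Cmod_expi, Cmod_R, Cmod_RtoC_pos by lra.
pose proof (expi_lipschitz t t'); pose proof (Cmod_ge_0 (expi t - expi t')); nra.
Qed.

Section PolarGoursat.

Context (f : C -> C).
Context (holo : forall z, 0 < Cmod z < 1 -> exists l, derC f z l).

(** [Fr] and [Ft] are the integrands of f(w) dw along a ray, where dw = e^{it} dr, and along an arc,
    where dw = i r e^{it} dt. *)
Definition Fr (t r : R) : C := f (r * expi t) * expi t.
Definition Ft (r t : R) : C := f (r * expi t) * (r * (Ci * expi t)).

Lemma contR_Fr (t r : R) : 0 < r < 1 -> contR_at (Fr t) r.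
Proof.
intros Hr; destruct (holo (r * expi t)) as [l Hl]; [rewrite Cmod_polar; lra|].
apply filterlim_C_mult; [apply _| |apply filterlim_const].
apply (derR_continuous (fun r : R => f (r * expi t)) r (expi t * l)).
apply (derR_comp f (fun r : R => r * expi t)); auto; apply derR_radius.
Qed.

Lemma contR_Ft (r t : R) : 0 < r < 1 -> contR_at (Ft r) t.
Proof.
intros Hr; destruct (holo (r * expi t)) as [l Hl]; [rewrite Cmod_polar; lra|].
apply filterlim_C_mult; [apply _| |].
- apply (derR_continuous (fun t => f (r * expi t)) t (r * (Ci * expi t) * l)).
  apply (derR_comp f (fun t => r * expi t)); auto; apply derR_angle.
- apply contR_tangent.
Qed.

(** The boundary of a polar rectangle: out along the ray at angle [s], along the outer arc, back
    along the ray at angle [t], back along the inner arc. *)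
Definition polar_contour (a b s t : R) : C :=
  CInt (Fr s) a b + CInt (Ft b) s t - CInt (Fr t) a b - CInt (Ft a) s t.

Lemma is_CInt_Fr (t a b : R) : 0 < a <= b -> b < 1 ->
  is_CInt (Fr t) a b (CInt (Fr t) a b).
Proof. intros; apply CInt_correct; [lra|]; intros; apply contR_Fr; lra. Qed.

Lemma is_CInt_Ft (r a b : R) : a <= b -> 0 < r < 1 ->
  is_CInt (Ft r) a b (CInt (Ft r) a b).
Proof. intros; apply CInt_correct; [lra|]; intros; apply contR_Ft; lra. Qed.

Lemma CInt_Fr_split (t a m b : R) : 0 < a <= m -> m <= b < 1 ->
  CInt (Fr t) a b = CInt (Fr t) a m + CInt (Fr t) m b.
Proof. intros; apply is_CInt_unique, is_CInt_Chasles with m; apply is_CInt_Fr; lra. Qed.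

Lemma CInt_Ft_split (r a m b : R) : a <= m <= b -> 0 < r < 1 ->
  CInt (Ft r) a b = CInt (Ft r) a m + CInt (Ft r) m b.
Proof. intros; apply is_CInt_unique, is_CInt_Chasles with m; apply is_CInt_Ft; lra. Qed.

(** The tangent map of [f] at the point has a primitive, so its contour integral telescopes to zero.
    The remaining error is at most eps/2 * (b - a + (t - s)) on every side, and the four sides have
    total length at most twice b - a + (t - s), since the radii are below 1. The two increments
    below d/2 keep the rectangle within distance d of the point. *)
Lemma polar_contour_small (x y A B S T eps : R) : 0 < A -> B < 1 ->
  A <= x <= B -> 0 < eps -> exists d, 0 < d /\
  forall a b s t, A <= a <= x -> x <= b <= B -> S <= s <= y ->
    y <= t <= T -> b - a < d -> t - s < d ->
    Cmod (polar_contour a b s t) <= eps * (b - a + (t - s)) ^ 2.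
Proof.
intros A0 B1 Hx He.
set (z := x * expi y).
assert (Hz : Cmod z = x) by (apply Cmod_polar; lra).
destruct (holo z) as [l Hl]; [lra|].
destruct (Hl (eps / 2)%R) as [d [d0 Hd]]; [lra|].
exists (d / 2)%R; split; [lra|].
intros a b s t Ha Hb Hs Ht Hab Hst.
(* a primitive of the tangent map of [f] at [z] *)
set (P := fun w => f z * w + l / 2 * ((w - z) * (w - z))).
set (p := fun w => f z + (w - z) * l).
assert (two : RtoC 2 <> 0) by (intros K; apply RtoC_inj in K; lra).
assert (D1 : forall w, derC (fun w => w - z) w (1 + 0)).
{ intros w; apply (der_plus _ (fun w => w) (fun _ => - z)); [apply der_id|apply der_const]. }
assert (DP : forall w, derC P w (p w)).
{ intros w; unfold P.
  replace (p w) with (f z * 1 + l / 2 * ((1 + 0) * (w - z) + (w - z) * (1 + 0))) by (unfold p; field; auto).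
  apply (der_plus _ (fun w => f z * w)); apply der_scale; [apply der_id|].
  apply (der_mult _ (fun w => w - z) (fun w => w - z)); apply D1. }
assert (Cp : forall w, filterlim p (locally w) (locally (p w))).
{ intros w; eapply derC_continuous.
  apply (der_plus _ (fun _ => f z) (fun w => (w - z) * l)); [apply der_const|].
  apply (der_mult _ (fun w => w - z) (fun _ => l)); [apply D1|apply der_const]. }
set (e := (eps / 2 * (b - a + (t - s)))%R).
assert (NB : forall r u, a <= r <= b -> s <= u <= t ->
   Cmod (f (r * expi u)%C - p (r * expi u)%C) <= e).
{ intros r u Hr Hu.
  assert (D : Cmod (r * expi u - z) <= b - a + (t - s)).
  { eapply Rle_trans; [apply Cmod_polar_sub; lra|].
    apply Rplus_le_compat; apply Rabs_le; lra. }
  replace (f (r * expi u) - p (r * expi u)) with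
   (f (r * expi u) - f z - (r * expi u - z) * l) by (unfold p; ring).
  eapply Rle_trans; [apply Hd; auto; lra|].
  unfold e; apply Rmult_le_compat_l; lra. }
assert (R1 : forall u, s <= u <= t ->
  Cmod (CInt (Fr u) a b - (P (b * expi u)%C - P (a * expi u)%C)) <= e * (b - a)).
{ intros u Hu.
  apply (is_CInt_near_derive (Fr u) (fun r : R => P (r * expi u)) (fun r : R => expi u * p (r * expi u))).
  - lra.
  - intros r _; apply (derR_comp P (fun r : R => r * expi u)); [apply DP|apply derR_radius].
  - intros r _; apply filterlim_C_mult; [apply _|apply filterlim_const|].
    eapply filterlim_comp; [|apply Cp].
    eapply (derR_continuous (fun r : R => r * expi u)), derR_radius.
  - intros r Hr; unfold Fr.
    replace (f (r * expi u) * expi u - expi u * p (r * expi u)) with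
      ((f (r * expi u) - p (r * expi u)) * expi u) by ring.
    rewrite Cmod_mult, Cmod_expi, Rmult_1_r; apply NB; auto.
  - apply is_CInt_Fr; lra. }
assert (R2 : forall r, a <= r <= b ->
  Cmod (CInt (Ft r) s t - (P (r * expi t)%C - P (r * expi s)%C)) <= e * (t - s)).
{ intros r Hr.
  apply (is_CInt_near_derive (Ft r) (fun u => P (r * expi u)) (fun u => (r * (Ci * expi u)) * p (r * expi u))).
  - lra.
  - intros u _; apply (derR_comp P (fun u => r * expi u)); [apply DP|apply derR_angle].
  - intros u _; apply filterlim_C_mult; [apply _| |].
    + apply contR_tangent.
    + eapply filterlim_comp; [|apply Cp].
      eapply (derR_continuous (fun u => r * expi u)), derR_angle.
  - intros u Hu; unfold Ft.
    replace (f (r * expi u) * (r * (Ci * expi u)) - r * (Ci * expi u) * p (r * expi u)) with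
      ((f (r * expi u) - p (r * expi u)) * (Ci * (r * expi u))) by ring.
    rewrite Cmod_mult, (Cmod_mult Ci), Cmod_Ci, Cmod_polar by lra.
    specialize (NB r u Hr Hu); pose proof (Cmod_ge_0 (f (r * expi u) - p (r * expi u))); nra.
  - apply is_CInt_Ft; lra. }
pose proof (R1 s ltac:(lra)) as K1; pose proof (R1 t ltac:(lra)) as K2.
pose proof (R2 a ltac:(lra)) as K3; pose proof (R2 b ltac:(lra)) as K4.
unfold polar_contour.
replace (CInt (Fr s) a b + CInt (Ft b) s t - CInt (Fr t) a b - CInt (Ft a) s t) with
 (((CInt (Fr s) a b - (P (b * expi s) - P (a * expi s))) +
   (CInt (Ft b) s t - (P (b * expi t) - P (b * expi s)))) -
  ((CInt (Fr t) a b - (P (b * expi t) - P (a * expi t))) +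
   (CInt (Ft a) s t - (P (a * expi t) - P (a * expi s))))) by ring.
eapply Rle_trans; [apply Cmod_minus_le|].
eapply Rle_trans; [apply Rplus_le_compat; apply Cmod_triangle|].
replace (eps * (b - a + (t - s)) ^ 2)%R with ((e * (b - a) + e * (t - s)) + (e * (b - a) + e * (t - s)))%R
  by (unfold e; field).
lra.
Qed.

Lemma polar_contour_zero (A B S T : R) : 0 < A < B -> B < 1 -> S < T ->
  polar_contour A B S T = 0.
Proof.
intros HA HB HS; apply bisection_zero; try lra.
- intros a m b s t H1 H2 H3 H4; unfold polar_contour.
  rewrite !(CInt_Fr_split _ a m b) by lra; ring.
- intros a b s m t H1 H2 H3 H4; unfold polar_contour.
  rewrite !(CInt_Ft_split _ s m t) by lra; ring.
- intros x y Hx Hy eps He; apply polar_contour_small; auto; lra.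
Qed.

(** For the angles -pi and pi the two rays coincide and cancel, which leaves the two arcs.
    Holomorphy is assumed away from the origin only, so [f] may carry a negative power of z; this is
    how Fourier coefficients are reached. *)
Lemma holo_avg_const (a b : R) : 0 < a < 1 -> 0 < b < 1 ->
  avg (fun t => f (a * expi t) * (a * expi t)) = avg (fun t => f (b * expi t) * (b * expi t)).
Proof.
assert (K : forall a b, 0 < a < b -> b < 1 ->
  avg (fun t => f (a * expi t) * (a * expi t)) = avg (fun t => f (b * expi t) * (b * expi t))).
{ clear a b; intros a b Ha Hb.
  assert (PP : - PI < PI) by (pose proof PI_RGT_0; lra).
  pose proof (polar_contour_zero a b (- PI) PI Ha Hb PP) as Z.
  unfold polar_contour in Z.
  assert (E : Fr (- PI) = Fr PI).
  { apply functional_extensionality; intros r; unfold Fr.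
    replace (expi (- PI)) with (expi PI); auto.
    rewrite <- (expi_period (- PI)); f_equal; ring. }
  rewrite E in Z.
  assert (Z' : CInt (Ft b) (- PI) PI = CInt (Ft a) (- PI) PI).
  { replace (CInt (Ft a) (- PI) PI) with (CInt (Ft a) (- PI) PI + 0) by ring.
    rewrite <- Z; ring. }
  assert (G : forall r, 0 < r < 1 -> avg (fun t => f (r * expi t) * (r * expi t)) =
     - Ci * (RtoC (/ (2 * PI)) * CInt (Ft r) (- PI) PI)).
  { intros r Hr; change (RtoC (/ (2 * PI)) * CInt (Ft r) (- PI) PI) with (avg (Ft r)).
    rewrite <- avg_mult_l by (intros t; apply contR_Ft; auto).
    apply avg_ext; intros t; unfold Ft.
    replace (- Ci * (f (r * expi t) * (r * (Ci * expi t)))) with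
      (- (Ci * Ci) * (f (r * expi t) * (r * expi t))) by ring.
    replace (Ci * Ci) with (- (1)) by (unfold Ci, RtoC, Cmult, Copp; simpl; f_equal; ring).
    ring. }
  rewrite !G, Z' by lra; auto. }
intros Ha Hb; destruct (Rtotal_order a b) as [H|[->|H]]; auto.
- apply K; lra.
- symmetry; apply K; lra.
Qed.

End PolarGoursat.

(** * The Cauchy transform of a loop *)

Notation is_Cpseries := (@is_pseries C_AbsRing C_NormedModule).

Definition loop (u : R -> C) : Prop := contR u /\ forall t, u (t + 2 * PI)%R = u t.

(** The Cauchy kernel on the circle: for zeta = e^{it}, dzeta / (2 pi i (zeta - z)) equals this
    kernel times dt / (2 pi). *)
Definition kernel (z : C) (t : R) : C := / (1 - z * expi (- t)).

Definition cauchy (u : R -> C) (z : C) : C := avg (fun t => u t * kernel z t).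

Definition coef (u : R -> C) (n : nat) : C := avg (fun t => u t * expi (- t) ^ n).

Lemma Cmod_mult_expi (z : C) (t : R) : Cmod (z * expi t) = Cmod z.
Proof. rewrite Cmod_mult, Cmod_expi; ring. Qed.

Lemma kernel_den_neq_0 (z : C) (t : R) : Cmod z < 1 -> 1 - z * expi (- t) <> 0.
Proof. intros; apply one_minus_neq_0; rewrite Cmod_mult_expi; auto. Qed.

Lemma contR_kernel (z : C) : Cmod z < 1 -> contR (kernel z).
Proof.
intros H; apply contR_inv; [|intros; apply kernel_den_neq_0; auto].
apply (contR_minus (fun _ => 1) (fun t => z * expi (- t))); [apply contR_const|].
apply (contR_mult (fun _ => z)); [apply contR_const|apply contR_expi_opp].
Qed.

Lemma Cmod_kernel_le (z : C) (t : R) : Cmod z < 1 -> Cmod (kernel z t) <= / (1 - Cmod z).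
Proof.
intros H; unfold kernel; rewrite Cmod_inv by (apply kernel_den_neq_0; auto).
apply Rinv_le_contravar; [lra|].
rewrite <- (Cmod_mult_expi z (- t)), <- Cmod_1 at 1; apply Cmod_sub_ge.
Qed.

Lemma contR_bounded (u : R -> C) : contR u ->
  exists M : R, 0 < M /\ forall t, - PI <= t <= PI -> Cmod (u t) <= M.
Proof.
intros Hu.
destruct (bounded_continuity (V := C_R_NormedModule) u (- PI) PI) as [M HM].
{ intros x _; apply Hu. }
exists M.
assert (K : forall t, - PI <= t <= PI -> Cmod (u t) < M).
{ intros t Ht; rewrite <- norm_CR; apply HM, Ht. }
split; [|intros; apply Rlt_le; auto].
eapply Rle_lt_trans; [apply (Cmod_ge_0 (u 0%R))|apply K].
pose proof PI_RGT_0; lra.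
Qed.

Lemma angle_reduce (t : R) : exists n : Z, - PI <= t + IZR n * (2 * PI) <= PI.
Proof.
pose proof PI_RGT_0.
destruct (base_Int_part ((t + PI) / (2 * PI))) as [H1 H2].
set (k := Int_part ((t + PI) / (2 * PI))) in *; exists (- k)%Z; rewrite opp_IZR.
assert (E : (t + PI = (t + PI) / (2 * PI) * (2 * PI))%R) by (field; lra).
set (q := ((t + PI) / (2 * PI))%R) in *; nra.
Qed.

Lemma loop_bounded (u : R -> C) : loop u ->
  exists M : R, 0 < M /\ forall t, Cmod (u t) <= M.
Proof.
intros [Hu Hp]; destruct (contR_bounded u Hu) as [M [M0 HM]].
exists M; split; auto; intros t; destruct (angle_reduce t) as [n Hn].
rewrite <- (periodic_Z u Hp n t); auto.
Qed.

Lemma loop_mult (u v : R -> C) : loop u -> loop v -> loop (fun t => u t * v t).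
Proof.
intros [Hu Hp] [Hv Hq]; split; [apply contR_mult; auto|].
intros t; rewrite Hp, Hq; auto.
Qed.

Lemma loop_conj (u : R -> C) : loop u -> loop (fun t => Cconj (u t)).
Proof. intros [Hu Hp]; split; [apply contR_conj; auto|]; intros; rewrite Hp; auto. Qed.

Lemma loop_const (c : C) : loop (fun _ => c).
Proof. split; [apply contR_const|auto]. Qed.

Lemma contR_pow_expi_opp (n : nat) : contR (fun t => expi (- t) ^ n).
Proof. apply (contR_pow (fun t => expi (- t))), contR_expi_opp. Qed.

Lemma pow_n_Cpow (z : C) (n : nat) : @pow_n C_AbsRing z n = z ^ n.
Proof. induction n as [|n IH]; simpl; [auto|]. rewrite IH; auto. Qed.

(* The partial sum [sum_{k <= N} c_k z^k], in the form in which [is_pseries]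
   unfolds it. *)
Definition psum (c : nat -> C) (z : C) (N : nat) : C :=
  @sum_n C_NormedModule
    (fun k => @scal C_AbsRing C_NormedModule (@pow_n C_AbsRing z k) (c k)) N.

Lemma psum_0 (c : nat -> C) (z : C) : psum c z 0 = c 0%nat.
Proof. unfold psum; rewrite sum_O; apply Cmult_1_l. Qed.

Lemma psum_S (c : nat -> C) (z : C) (N : nat) :
  psum c z (S N) = psum c z N + z ^ S N * c (S N).
Proof. 
unfold psum at 1; rewrite sum_Sn.
change (psum c z N + @pow_n C_AbsRing z (S N) * c (S N) = psum c z N + z ^ S N * c (S N)).
rewrite (pow_n_Cpow z (S N)); reflexivity.
 Qed.

Lemma Cpseries_eps (c : nat -> C) (z l : C) : is_Cpseries c z l <->
  forall eps, 0 < eps -> exists N, forall n, (N <= n)%nat ->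
    Cmod (psum c z n - l) < eps.
Proof. apply (filterlim_Cmod eventually). Qed.

(** Iterating kernel = 1 + z e^{-it} kernel gives the geometric series with an exact remainder. *)
Lemma cauchy_partial (u : R -> C) (z : C) (N : nat) : contR u -> Cmod z < 1 ->
  cauchy u z = psum (coef u) z N
    + z ^ S N * avg (fun t => u t * expi (- t) ^ S N * kernel z t).
Proof.
intros Hu Hz.
assert (step : forall n, avg (fun t => u t * expi (- t) ^ n * kernel z t) =
  coef u n + z * avg (fun t => u t * expi (- t) ^ S n * kernel z t)).
{ intros n; unfold coef; pose proof (contR_kernel z Hz).
  rewrite <- avg_mult_l, <- avg_plus.
  - apply avg_ext; intros t; rewrite Cpow_S; unfold kernel; field.
    apply kernel_den_neq_0; auto.
  - solve_contR.
  - solve_contR.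
  - solve_contR. }
assert (E0 : cauchy u z = avg (fun t => u t * expi (- t) ^ 0 * kernel z t)).
{ apply avg_ext; intros t; simpl; ring. }
induction N as [|N IH].
- rewrite psum_0, E0, step.
  replace (z ^ 1) with z by (simpl; ring); auto.
- rewrite psum_S, IH, step, (Cpow_S z (S N)); ring.
Qed.

Lemma pow_small (x eps : R) : 0 <= x < 1 -> 0 < eps ->
  exists N, forall n, (N <= n)%nat -> x ^ n < eps.
Proof.
intros Hx He; destruct (pow_lt_1_zero x) with (y := eps) as [N HN]; auto.
{ rewrite Rabs_pos_eq; lra. }
exists N; intros n Hn; eapply Rle_lt_trans; [apply Rle_abs|apply HN; auto].
Qed.

Lemma cauchy_partial_bound (u : R -> C) (z : C) (M : R) (N : nat) : contR u -> Cmod z < 1 ->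
  (forall t, - PI <= t <= PI -> Cmod (u t) <= M) ->
  Cmod (psum (coef u) z N
    - cauchy u z) <= Cmod z ^ S N * (M / (1 - Cmod z)).
Proof.
intros Hu Hz HM; rewrite (cauchy_partial u z N) by auto.
match goal with |- (Cmod (?a - (?a + ?b)) <= _) =>
  replace (a - (a + b)) with (- b) by ring end.
rewrite Cmod_opp, Cmod_mult, Cmod_pow.
apply Rmult_le_compat_l; [apply pow_le, Cmod_ge_0|].
apply avg_bound_const.
- pose proof (contR_kernel z Hz); solve_contR.
- intros t Ht; apply Cmod_mult_le; [|apply Cmod_kernel_le; auto].
  rewrite Cmod_mult, Cmod_pow, Cmod_expi, pow1; specialize (HM t Ht); lra.
Qed.

Lemma cauchy_pseries (u : R -> C) (z : C) : contR u -> Cmod z < 1 ->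
  is_Cpseries (coef u) z (cauchy u z).
Proof.
intros Hu Hz; destruct (contR_bounded u Hu) as [M [M0 HM]].
apply Cpseries_eps; intros eps He.
pose proof (Cmod_ge_0 z).
set (K := (M / (1 - Cmod z))%R); assert (K0 : 0 < K) by (unfold K; rpos).
destruct (pow_small (Cmod z) (eps / K)) as [N HN]; [lra|rpos|].
exists N; intros n Hn.
eapply Rle_lt_trans; [apply (cauchy_partial_bound u z M n); auto|].
replace eps with (eps / K * K)%R by (field; lra).
apply Rmult_lt_compat_r; auto.
Qed.

Lemma Cpseries_unique (c : nat -> C) (z x y : C) :
  is_Cpseries c z x -> is_Cpseries c z y -> x = y.
Proof. apply (filterlim_locally_unique (V := C_NormedModule)). Qed.

Definition cauchy' (u : R -> C) (z : C) : C :=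
  avg (fun t => u t * (expi (- t) * (kernel z t * kernel z t))).

Lemma contR_cauchy' (u : R -> C) (z : C) : contR u -> Cmod z < 1 ->
  contR (fun t => u t * (expi (- t) * (kernel z t * kernel z t))).
Proof.
intros Hu Hz; pose proof (contR_kernel z Hz); solve_contR.
Qed.

(** The second-order remainder of the kernel between z and w is exactly (w - z)^2 e^{-2it} k_w
    k_z^2, with k the kernel. It is bounded by a multiple of |w - z|^2 as long as w stays at
    distance h/2 from the circle. *)
Lemma derC_cauchy (u : R -> C) (z : C) : contR u -> Cmod z < 1 ->
  derC (cauchy u) z (cauchy' u z).
Proof.
intros Hu Hz eps He; destruct (contR_bounded u Hu) as [M [M0 HM]].
pose proof (Cmod_ge_0 z).
set (h := (1 - Cmod z)%R); assert (h0 : 0 < h) by (unfold h; lra).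
set (K := (M * (/ (h / 2) * (/ h * / h)))%R).
assert (K0 : 0 < K) by (unfold K; rpos).
exists (Rmin (h / 2) (eps / K)); split; [apply Rmin_glb_lt; rpos|].
intros w _ Hw; apply Rmin_Rgt in Hw as [Hw1 Hw2].
assert (Hw : Cmod w <= 1 - h / 2).
{ pose proof (Cmod_triangle (w - z) z) as T; replace (w - z + z) with w in T by ring.
  unfold h in *; lra. }
assert (Hw' : Cmod w < 1) by lra.
pose proof (contR_kernel z Hz); pose proof (contR_kernel w Hw').
assert (CI : contR (fun t => u t * (expi (- t) * expi (- t) *
      (kernel w t * (kernel z t * kernel z t)))))
  by solve_contR.
replace (cauchy u w - cauchy u z - (w - z) * cauchy' u z) with
  ((w - z) * (w - z) * avg (fun t => u t * (expi (- t) * expi (- t) *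
      (kernel w t * (kernel z t * kernel z t))))).
2:{ unfold cauchy, cauchy'.
  rewrite <- avg_mult_l, <- avg_mult_l, <- avg_minus, <- avg_minus; try solve_contR.
  - apply avg_ext; intros t; unfold kernel; field.
    split; apply kernel_den_neq_0; auto. }
rewrite !Cmod_mult, Rmult_assoc, (Rmult_comm eps).
apply Rmult_le_compat_l; [apply Cmod_ge_0|].
apply Rle_trans with (Cmod (w - z) * K)%R.
- apply Rmult_le_compat_l; [apply Cmod_ge_0|].
  apply avg_bound_const; auto.
  intros t Ht; apply Cmod_mult_le; [auto|].
  rewrite !(Cmod_mult (expi _ * _)), (Cmod_mult (expi _)), !Cmod_expi, !Rmult_1_l.
  apply Cmod_mult_le; [|apply Cmod_mult_le; apply Cmod_kernel_le; auto].
  eapply Rle_trans; [apply Cmod_kernel_le; auto|].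
  apply Rinv_le_contravar; lra.
- replace eps with (eps / K * K)%R by (field; lra).
  apply Rmult_le_compat_r; lra.
Qed.

Lemma cauchy_minus (u v : R -> C) (z : C) : contR u -> contR v -> Cmod z < 1 ->
  cauchy (fun t => u t - v t) z = cauchy u z - cauchy v z.
Proof.
intros Hu Hv Hz; pose proof (contR_kernel z Hz); unfold cauchy.
rewrite <- avg_minus by solve_contR.
apply avg_ext; intros; ring.
Qed.

Lemma Cpseries_const (c : nat -> C) (z : C) :
  (forall n, c (S n) = 0) -> is_Cpseries c z (c 0%nat).
Proof.
intros H.
apply Cpseries_eps; intros eps He; exists 0%nat; intros n _.
assert (E : psum c z n = c 0%nat).
{ induction n as [|n IH]; [apply psum_0|rewrite psum_S, IH, H; ring]. }
rewrite E; replace (c 0%nat - c 0%nat) with (RtoC 0) by ring; rewrite Cmod_0; auto.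
Qed.

Lemma cauchy_const (c z : C) : Cmod z < 1 -> cauchy (fun _ => c) z = c.
Proof.
intros Hz.
apply (Cpseries_unique (coef (fun _ => c)) z); [apply cauchy_pseries; auto; apply contR_const|].
assert (E : coef (fun _ => c) 0 = c).
{ unfold coef; rewrite (avg_ext _ (fun _ => c)); [apply avg_const|intros; simpl; ring]. }
assert (Z : forall n, coef (fun _ => c) (S n) = 0).
2:{ pose proof (Cpseries_const _ z Z) as K; rewrite E in K; exact K. }
intros n; unfold coef.
rewrite (avg_mult_l (fun t => expi (- t) ^ S n)), avg_expi_pow by apply contR_pow_expi_opp; ring.
Qed.

Lemma cauchy'_const (c z : C) : Cmod z < 1 -> cauchy' (fun _ => c) z = 0.
Proof.
intros Hz.
apply (derC_unique (fun _ => c) z); [|apply der_const].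
apply derC_local_disk with (cauchy (fun _ => c)); auto; [intros; apply cauchy_const; auto|].
apply derC_cauchy; auto; apply contR_const.
Qed.

Lemma kernel_shift (r t x : R) : kernel (r * expi t) (x + t) = kernel r x.
Proof.
unfold kernel; f_equal; f_equal.
replace (- (x + t))%R with (- t + - x)%R by ring.
rewrite expi_plus.
replace (r * expi t * (expi (- t) * expi (- x))) with (r * (expi (- t) * expi t) * expi (- x)) by ring.
rewrite expi_opp_l; ring.
Qed.

Lemma loop_expi_opp : loop (fun t => expi (- t)).
Proof.
split; [apply contR_expi_opp|]; intros t.
rewrite <- (expi_period (- (t + 2 * PI))); f_equal; ring.
Qed.

Lemma loop_kernel (z : C) : Cmod z < 1 -> loop (kernel z).
Proof.
intros H; split; [apply contR_kernel; auto|]; intros t.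
unfold kernel; do 3 f_equal; apply (proj2 loop_expi_opp).
Qed.

Lemma cauchy_polar (u : R -> C) (r t : R) : loop u -> 0 <= r < 1 ->
  cauchy u (r * expi t) = avg (fun x => u (x + t)%R * kernel r x).
Proof.
intros Hu Hr.
assert (K : loop (kernel (r * expi t))) by (apply loop_kernel; rewrite Cmod_polar; lra).
destruct (loop_mult _ _ Hu K) as [L1 L2].
unfold cauchy; rewrite <- (avg_shift _ t L1 L2).
apply avg_ext; intros x; rewrite kernel_shift; auto.
Qed.

(** The rotation by t moves the near singularity to x = 0. The constant u(t) can be subtracted
    because its transform has zero derivative; the increment that appears is what a Hölder condition
    controls. *)
Lemma cauchy'_polar (u : R -> C) (r t : R) : loop u -> 0 <= r < 1 ->
  cauchy' u (r * expi t) =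
  expi (- t) * avg (fun x => (u (x + t)%R - u t) * (expi (- x) * (kernel r x * kernel r x))).
Proof.
intros Hu Hr.
assert (Z : Cmod (r * expi t) < 1) by (rewrite Cmod_polar; lra).
assert (Z' : Cmod r < 1) by (rewrite Cmod_RtoC_pos; lra).
replace (cauchy' u (r * expi t)) with (cauchy' (fun x => u x - u t) (r * expi t)).
2:{ replace (cauchy' u (r * expi t)) with (cauchy' u (r * expi t) - cauchy' (fun _ => u t) (r * expi t))
      by (rewrite cauchy'_const by auto; ring).
  unfold cauchy'; rewrite <- avg_minus by (apply contR_cauchy'; auto; try apply Hu; apply contR_const).
  apply avg_ext; intros; ring. }
assert (K : loop (kernel (r * expi t))) by (apply loop_kernel; auto).
assert (Hv : loop (fun x => u x - u t)).
{ destruct Hu as [H1 H2]; split; [apply contR_minus; auto; apply contR_const|].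
  intros; rewrite H2; auto. }
destruct (loop_mult _ _ Hv (loop_mult _ _ loop_expi_opp (loop_mult _ _ K K))) as [L1 L2].
unfold cauchy'; rewrite <- (avg_shift _ t L1 L2).
rewrite <- avg_mult_l.
- apply avg_ext; intros x; rewrite kernel_shift.
  replace (- (x + t))%R with (- t + - x)%R by ring; rewrite expi_plus; ring.
- pose proof (contR_kernel r Z').
  assert (S : contR (fun x => u (x + t)%R)); [|solve_contR].
  apply contR_comp; [apply Hu|].
  intros x; apply (continuous_plus (V := R_NormedModule) (fun y => y) (fun _ => t));
   [apply continuous_id|apply continuous_const].
Qed.

(** * Poisson's formula *)

Definition poisson (r x : R) : R := ((1 - r * r) / Cmod (1 - r * expi (- x)) ^ 2)%R.

Lemma kernel_poisson (r x : R) : 0 <= r < 1 ->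
  kernel r x + Cconj (kernel r x) - 1 = RtoC (poisson r x).
Proof.
intros Hr; unfold kernel, poisson.
set (w := r * expi (- x)).
assert (Hw : Cmod w = r) by (apply Cmod_polar; lra).
assert (w1 : 1 - w <> 0) by (apply one_minus_neq_0; lra).
assert (w2 : 1 - Cconj w <> 0) by (apply one_minus_neq_0; rewrite Cmod_conj; lra).
rewrite Cinv_conj, Cminus_conj by auto.
rewrite Cconj_RtoC.
assert (m0 : 0 < Cmod (1 - w)) by (apply Cmod_gt_0; auto).
assert (m1 : (Cmod (1 - w) ^ 2 <> 0)%R) by (apply pow_nonzero; lra).
rewrite RtoC_div, RtoC_minus by auto.
pose proof (Cmod2_conj w) as E1; pose proof (Cmod2_conj (1 - w)) as E2.
rewrite Hw in E1; rewrite Cminus_conj, Cconj_RtoC in E2.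
rewrite E2.
replace (r * r)%R with (r ^ 2)%R by ring; rewrite E1.
field; auto.
Qed.

Lemma poisson_pos (r x : R) : 0 <= r < 1 -> 0 <= poisson r x.
Proof.
intros Hr; unfold poisson.
assert (w1 : 1 - r * expi (- x) <> 0) by (apply one_minus_neq_0; rewrite Cmod_polar; lra).
apply Cmod_gt_0 in w1; apply Rlt_le, Rdiv_lt_0_compat; [nra|apply pow_lt; auto].
Qed.

(** Follows from [Cmod_kernel_lower] with 1 - r^2 <= 2 (1 - r) and x^2 <= (1 - r + |x|)^2, so that
    48 = 2 * 24. *)
Lemma poisson_tail (r x : R) : 1 / 2 <= r < 1 -> Rabs x <= PI ->
  x * x * poisson r x <= 48 * (1 - r).
Proof.
intros Hr Hx; unfold poisson.
pose proof (Cmod_kernel_lower r x Hr Hx) as K.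
set (D := (Cmod (1 - r * expi (- x)) ^ 2)%R) in *.
pose proof (Rabs_pos x) as X.
pose proof (Rabs_sqr x) as A.
assert (D0 : 0 < D).
{ eapply Rlt_le_trans; [|exact K]; apply Rdiv_lt_0_compat; [apply pow_lt|]; lra. }
apply Rmult_le_reg_r with D; auto.
replace (x * x * ((1 - r * r) / D) * D)%R with (x * x * (1 - r * r))%R by (field; lra).
apply Rle_trans with (48 * (1 - r) * ((1 - r + Rabs x) ^ 2 / 24))%R.
- replace (48 * (1 - r) * ((1 - r + Rabs x) ^ 2 / 24))%R with
    ((1 - r) * (2 * (1 - r + Rabs x) ^ 2))%R by field.
  replace (x * x * (1 - r * r))%R with ((1 - r) * (Rabs x * Rabs x * (1 + r)))%R by (rewrite A; ring).
  apply Rmult_le_compat_l; [lra|].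
  assert (Rabs x * Rabs x <= (1 - r + Rabs x) ^ 2) by nra.
  nra.
- apply Rmult_le_compat_l; lra.
Qed.

Lemma contR_poisson (r : R) : 0 <= r < 1 -> contR (fun x => RtoC (poisson r x)).
Proof.
intros Hr.
replace (fun x => RtoC (poisson r x)) with (fun x => kernel r x + Cconj (kernel r x) - 1)
  by (apply functional_extensionality; intros; apply kernel_poisson; auto).
assert (contR (kernel r)) by (apply contR_kernel; rewrite Cmod_RtoC_pos; lra).
solve_contR.
Qed.

Lemma contR_translate (u : R -> C) (t : R) : contR u -> contR (fun x => u (x + t)%R).
Proof.
intros Hu; apply contR_comp; auto; intros x.
apply (continuous_plus (V := R_NormedModule) (fun y => y) (fun _ => t));
  [apply continuous_id|apply continuous_const].
Qed.

(** The Poisson kernel is 2 Re(kernel) - 1: the Poisson integral is a holomorphic part plus an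
    antiholomorphic one, and the mean, counted in both, is subtracted once. *)
Lemma poisson_formula (u : R -> C) (r t : R) : loop u -> 0 <= r < 1 ->
  cauchy u (r * expi t) + Cconj (cauchy (fun x => Cconj (u x)) (r * expi t)) - avg u =
  avg (fun x => u (x + t)%R * RtoC (poisson r x)).
Proof.
intros Hu Hr.
assert (K : contR (kernel r)) by (apply contR_kernel; rewrite Cmod_RtoC_pos; lra).
pose proof (contR_translate u t (proj1 Hu)) as T.
rewrite cauchy_polar, cauchy_polar, <- avg_conj; auto using loop_conj; [|solve_contR].
rewrite <- (avg_shift u t) by apply Hu.
rewrite <- avg_plus, <- avg_minus by solve_contR.
apply avg_ext; intros x.
rewrite Cmult_conj, Cconj_conj, <- kernel_poisson by auto; ring.
Qed.

Lemma avg_poisson (r : R) : 0 <= r < 1 -> avg (fun x => RtoC (poisson r x)) = 1.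
Proof.
intros Hr; pose proof (poisson_formula _ r 0 (loop_const 1) Hr) as K.
assert (Z : Cmod (r * expi 0) < 1) by (rewrite Cmod_polar; lra).
rewrite !cauchy_const, avg_const, Cconj_conj in K by auto.
rewrite (avg_ext _ (fun x => 1 * RtoC (poisson r x))) by (intros; ring).
rewrite <- K; ring.
Qed.

Lemma is_RInt_poisson (r : R) : 0 <= r < 1 -> is_RInt (poisson r) (- PI) PI (2 * PI)%R.
Proof.
intros Hr; pose proof (avg_correct _ (contR_poisson r Hr)) as K.
rewrite avg_poisson in K by auto.
apply is_CInt_components in K as [K _].
rewrite Re_RtoC_mult in K; replace (2 * PI * Re 1)%R with (2 * PI)%R in K by (simpl; ring).
exact K.
Qed.

(** With K = 2M/d^2 the bound |u(x + t) - u(t)| <= eps/2 + K x^2 holds for all x: by continuity when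
    |x| < d, by the bound M beyond. Against the Poisson kernel the first term has mean eps/2 and
    [poisson_tail] controls the second, so the interval need not be split. *)
Lemma poisson_limit (u : R -> C) (t eps : R) : loop u -> 0 < eps ->
  exists d, 0 < d /\ forall r, 1 - d < r < 1 -> 0 <= r ->
  (Cmod (cauchy u (r * expi t) + Cconj (cauchy (fun x => Cconj (u x)) (r * expi t))
     - avg u - u t) <= eps)%R.
Proof.
intros Hu He.
destruct (loop_bounded u Hu) as [M [M0 HM]].
pose proof (proj1 Hu t) as Ct; unfold contR_at in Ct; rewrite filterlim_Cmod in Ct by apply _.
destruct (Ct (eps / 2)%R) as [[d d0] Hd]; [lra|].
set (K := (2 * M / (d * d))%R).
assert (K0 : 0 < K) by (unfold K; rpos).
destruct (exists_below (1 / 2) (eps / (96 * K))) as [m [m0 [m1 m2]]]; [lra|rpos|].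
exists m; split; auto; intros r Hr r0.
assert (Hr' : 1 / 2 <= r < 1) by lra.
assert (Hr2 : 0 <= r < 1) by lra.
pose proof (contR_translate u t (proj1 Hu)) as T.
pose proof (contR_poisson r Hr2) as CP.
rewrite poisson_formula by auto.
replace (u t) with (u t * avg (fun x => RtoC (poisson r x))) by (rewrite avg_poisson by auto; ring).
rewrite <- avg_mult_l, <- avg_minus by solve_contR.
assert (J : is_RInt (fun x => eps / 2 * poisson r x + K * (48 * (1 - r)))%R (- PI) PI
   (eps / 2 * (2 * PI) + (PI - - PI) * (K * (48 * (1 - r))))%R).
{ apply (is_RInt_plus (V := R_NormedModule)).
  - apply (is_RInt_scal (V := R_NormedModule)), is_RInt_poisson; auto.
  - apply (is_RInt_const (V := R_NormedModule)). }
eapply Rle_trans; [eapply avg_bound with (3 := J); [solve_contR|]|].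
- intros x Hx.
  assert (Hx' : Rabs x <= PI) by (apply Rabs_le; lra).
  pose proof (poisson_tail r x Hr' Hx') as PT.
  pose proof (poisson_pos r x Hr2) as P0.
  replace (u (x + t)%R * poisson r x - u t * poisson r x) with
    ((u (x + t)%R - u t) * poisson r x) by ring.
  rewrite Cmod_mult, (Cmod_RtoC_pos (poisson r x)) by auto.
  apply Rle_trans with ((eps / 2 + K * (x * x)) * poisson r x)%R.
  + apply Rmult_le_compat_r; auto.
    destruct (Rlt_dec (Rabs x) d) as [D|D].
    * assert (B : ball t d (x + t)%R).
      { change (Rabs (x + t - t) < d); replace (x + t - t)%R with x by ring; auto. }
      specialize (Hd _ B); assert (0 <= K * (x * x)) by (apply Rmult_le_pos; nra); lra.
    * assert (X : d * d <= x * x).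
      { pose proof (Rabs_pos x).
        pose proof (Rabs_sqr x) as A.
        nra. }
      pose proof (HM t); pose proof (HM (x + t)%R).
      apply Rle_trans with (2 * M)%R; [eapply Rle_trans; [apply Cmod_minus_le|lra]|].
      apply Rle_trans with (K * (d * d))%R; [right; unfold K; field; lra|].
      assert (K * (d * d) <= K * (x * x)) by (apply Rmult_le_compat_l; lra); lra.
  + rewrite Rmult_plus_distr_r, Rmult_assoc.
    assert (K * (x * x * poisson r x) <= K * (48 * (1 - r))) by (apply Rmult_le_compat_l; lra).
    lra.
- assert (E : 48 * (1 - r) <= eps / 2 / K).
  { apply Rle_trans with (48 * (eps / (96 * K)))%R; [|right; field; lra].
    apply Rmult_le_compat_l; lra. }
  pose proof PI_RGT_0.
  replace ((eps / 2 * (2 * PI) + (PI - - PI) * (K * (48 * (1 - r)))) / (2 * PI))%R with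
   (eps / 2 + K * (48 * (1 - r)))%R by (field; lra).
  apply Rmult_le_compat_l with (r := K) in E; [|lra].
  replace (K * (eps / 2 / K))%R with (eps / 2)%R in E by (field; lra).
  lra.
Qed.

(** * Holomorphic functions in the disk are analytic *)

Lemma derC_pow_ex (f : C -> C) (z l : C) (n : nat) : derC f z l ->
  exists m, derC (fun w => f w ^ n) z m.
Proof.
intros Hf; induction n as [|n [m IH]].
- exists 0; apply (der_const (fun _ => True) 1).
- eexists; apply (der_mult _ f (fun w => f w ^ n)); eauto.
Qed.

Lemma inv_expi (t : R) : / expi t = expi (- t).
Proof.
pose proof (expi_opp_l t) as K; pose proof (expi_neq_0 t) as H.
replace (/ expi t) with (expi (- t) * expi t * / expi t) by (rewrite K; ring).
field; auto.
Qed.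

Lemma contR_pow_expi (n : nat) : contR (fun t => expi t ^ n).
Proof. apply (contR_pow expi), contR_expi. Qed.

Lemma RtoC_neq_0 (r : R) : (r <> 0)%R -> RtoC r <> 0.
Proof. intros H K; apply H, RtoC_inj, K. Qed.

Section Analytic.

Context (f : C -> C) (Hf : forall z, Cmod z < 1 -> exists l, derC f z l).

Lemma contR_circle (r : R) : 0 <= r < 1 -> contR (fun t => f (r * expi t)).
Proof.
intros Hr t; destruct (Hf (r * expi t)) as [l Hl]; [rewrite Cmod_polar; lra|].
apply (derR_continuous (fun t => f (r * expi t)) t (r * (Ci * expi t) * l)).
apply (derR_comp f (fun t => r * expi t)); auto; apply derR_angle.
Qed.

Lemma loop_circle (r : R) : 0 <= r < 1 -> loop (fun t => f (r * expi t)).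
Proof.
intros Hr; split; [apply contR_circle; auto|]; intros t; rewrite expi_period; auto.
Qed.

(** Both sides are averages of f(z) z^{-n-1} z over circles, to which [holo_avg_const] applies. *)
Lemma coef_radius (a b : R) (n : nat) : 0 < a < 1 -> 0 < b < 1 ->
  / RtoC a ^ n * coef (fun t => f (a * expi t)) n =
  / RtoC b ^ n * coef (fun t => f (b * expi t)) n.
Proof.
intros Ha Hb.
assert (E : forall r, 0 < r < 1 -> / RtoC r ^ n * coef (fun t => f (r * expi t)) n =
  avg (fun t => f (r * expi t) * (/ (r * expi t)) ^ S n * (r * expi t))).
{ intros r Hr; unfold coef.
  pose proof (contR_circle r ltac:(lra)) as CC.
  rewrite <- avg_mult_l by (apply contR_mult; auto; apply contR_pow_expi_opp).
  assert (r0 : RtoC r <> 0) by (apply RtoC_neq_0; lra).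
  apply avg_ext; intros t; pose proof (expi_neq_0 t).
  rewrite <- inv_expi, !Cpow_inv by (auto using Cmult_neq_0).
  rewrite Cpow_S, Cpow_mult_l; field; repeat split; auto using Cpow_nz. }
rewrite !E by auto.
apply (holo_avg_const (fun z => f z * (/ z) ^ S n)); auto.
intros z Hz; destruct (Hf z) as [l Hl]; [lra|].
assert (z0 : z <> 0) by (apply Cmod_gt_0; lra).
destruct (derC_pow_ex (fun z => / z) z _ (S n) (der_inv _ (fun z => z) z _ (der_id _ z) z0)) as [m Hm].
eexists; apply (der_mult _ f (fun z => (/ z) ^ S n)); eauto.
Qed.

(** The coefficient of index -(n+1), multiplied by r^{n+1}, does not depend on r, and it tends to 0
    with r because [f] is bounded near the origin. *)
Lemma coef_neg (r : R) (n : nat) : 0 < r < 1 ->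
  avg (fun t => f (r * expi t) * expi t ^ S n) = 0.
Proof.
intros Hr.
set (G := fun r : R => avg (fun t => f (r * expi t) * (r * expi t) ^ n * (r * expi t))).
assert (EG : forall r, 0 < r < 1 ->
  G r = RtoC r ^ S n * avg (fun t => f (r * expi t) * expi t ^ S n)).
{ intros a Ha; unfold G.
  pose proof (contR_circle a ltac:(lra)) as CC.
  rewrite <- avg_mult_l by (apply contR_mult; auto; apply contR_pow_expi).
  apply avg_ext; intros t; rewrite !Cpow_S, Cpow_mult_l; ring. }
assert (GC : forall a b, 0 < a < 1 -> 0 < b < 1 -> G a = G b).
{ intros a b Ha Hb; unfold G.
  apply (holo_avg_const (fun z => f z * z ^ n)); auto.
  intros z Hz; destruct (Hf z) as [l Hl]; [lra|].
  destruct (derC_pow_ex (fun z => z) z _ n (der_id _ z)) as [m Hm].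
  eexists; apply (der_mult _ f (fun z => z ^ n)); eauto. }
destruct (Hf 0) as [l Hl]; [rewrite Cmod_0; lra|].
destruct (der_lipschitz _ _ _ _ Hl) as [d [d0 Hd]].
pose proof (Cmod_ge_0 l); pose proof (Cmod_ge_0 (f 0)).
assert (Z : G r = 0).
{ apply C_small_eq; intros eps He.
  set (B := (Cmod (f 0) + (1 + Cmod l) + 1)%R).
  assert (B0 : 0 < B) by (unfold B; lra).
  destruct (exists_below d (1 / 2)) as [m1 [m10 [m11 m12]]]; [lra|lra|].
  destruct (exists_below (m1 / 2) (eps / B)) as [e [e0 [e1 e3]]]; [lra|rpos|].
  rewrite (GC r e) by lra; rewrite EG by lra.
  replace (RtoC e ^ S n * avg (fun t => f (e * expi t) * expi t ^ S n) - 0) with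
   (RtoC e * (RtoC e ^ n * avg (fun t => f (e * expi t) * expi t ^ S n))) by (rewrite Cpow_S; ring).
  apply Rle_trans with (e * (1 * B))%R.
  - apply Cmod_mult_le; [rewrite Cmod_RtoC_pos; lra|].
    apply Cmod_mult_le.
    + rewrite Cmod_pow, Cmod_RtoC_pos by lra.
      rewrite <- (pow1 n); apply pow_incr; lra.
    + apply avg_bound_const.
      * apply contR_mult; [apply contR_circle; lra|apply contR_pow_expi].
      * intros t _; rewrite Cmod_mult, Cmod_pow, Cmod_expi, pow1, Rmult_1_r.
        assert (P : (Cmod (e * expi t - 0) = e)%R).
        { replace (e * expi t - 0) with (e * expi t) by ring; apply Cmod_polar; lra. }
        assert (Q : Cmod (f (e * expi t)%C - f 0) <= (1 + Cmod l) * e).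
        { rewrite <- P at 2; apply Hd; auto; rewrite P; lra. }
        replace (f (e * expi t)) with ((f (e * expi t) - f 0) + f 0) by ring.
        eapply Rle_trans; [apply Cmod_triangle|]; unfold B; nra.
  - rewrite Rmult_1_l; apply Rmult_le_compat_r with (r := B) in e3; [|lra].
    replace (eps / B * B)%R with eps in e3 by (field; lra); lra. }
rewrite EG in Z by auto.
assert (r0 : RtoC r ^ S n <> 0) by (apply Cpow_nz, RtoC_neq_0; lra).
replace (avg (fun t => f (r * expi t) * expi t ^ S n)) with
  (/ (RtoC r ^ S n) * (RtoC r ^ S n * avg (fun t => f (r * expi t) * expi t ^ S n))) by (field; auto).
rewrite Z; ring.
Qed.

(** Since the coefficients of negative index vanish, the antiholomorphic half of Poisson's formula
    reduces to the mean and cancels the mean subtracted there. The Cauchy transform alone then has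
    radial limit [f]. *)
Lemma cauchy_conj_circle (r : R) (z : C) : 0 < r < 1 -> Cmod z < 1 ->
  Cconj (cauchy (fun t => Cconj (f (r * expi t))) z) = avg (fun t => f (r * expi t)).
Proof.
intros Hr Hz.
pose proof (contR_circle r ltac:(lra)) as CC.
set (c := coef (fun t => Cconj (f (r * expi t)))).
assert (c0 : c 0%nat = Cconj (avg (fun t => f (r * expi t)))).
{ rewrite <- avg_conj by auto; apply avg_ext; intros t; simpl; ring. }
assert (cS : forall n, c (S n) = 0).
{ intros n; unfold c, coef.
  rewrite (avg_ext _ (fun t => Cconj (f (r * expi t) * expi t ^ S n))).
  - pose proof (contR_pow_expi (S n)).
    rewrite avg_conj, coef_neg by (auto; solve_contR).
    apply Cconj_RtoC.
  - intros t; rewrite Cmult_conj, Cpow_conj, expi_opp; auto. }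
transitivity (Cconj (c 0%nat)); [f_equal|rewrite c0; apply Cconj_conj].
apply (Cpseries_unique c z).
- apply cauchy_pseries; auto; solve_contR.
- apply Cpseries_const; auto.
Qed.

Lemma coef_cauchy_radius (a b : R) (w : C) : 0 < a < b -> b < 1 -> Cmod w < 1 ->
  cauchy (fun t => f (a * expi t)) w = cauchy (fun t => f (b * expi t)) (RtoC (a / b) * w).
Proof.
intros Ha Hb Hw.
assert (q : 0 < a / b < 1).
{ split; [apply Rdiv_lt_0_compat; lra|]; apply Rmult_lt_reg_r with b; [lra|].
  replace (a / b * b)%R with a by (field; lra); lra. }
assert (Hw' : Cmod (RtoC (a / b) * w) < 1).
{ rewrite Cmod_mult, Cmod_RtoC_pos by lra; pose proof (Cmod_ge_0 w); nra. }
pose proof (cauchy_pseries _ w (contR_circle a ltac:(lra)) Hw) as K1.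
pose proof (cauchy_pseries _ _ (contR_circle b ltac:(lra)) Hw') as K2.
apply (Cpseries_unique _ w _ _ K1).
apply Cpseries_eps; intros eps He.
rewrite Cpseries_eps in K2; destruct (K2 eps He) as [N HN]; exists N; intros n Hn.
replace (psum (coef (fun t => f (a * expi t))) w n) with
  (psum (coef (fun t => f (b * expi t))) (RtoC (a / b) * w) n); [exact (HN n Hn)|].
assert (a0 : RtoC a <> 0) by (apply RtoC_neq_0; lra).
assert (b0 : RtoC b <> 0) by (apply RtoC_neq_0; lra).
assert (E : forall k, (RtoC (a / b) * w) ^ k * coef (fun t => f (b * expi t)) k =
   w ^ k * coef (fun t => f (a * expi t)) k).
{ intros k.
  replace (coef (fun t => f (a * expi t)) k) with
   (RtoC a ^ k * (/ RtoC a ^ k * coef (fun t => f (a * expi t)) k)) by (field; apply Cpow_nz; auto).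
  rewrite (coef_radius a b k), Cpow_mult_l, RtoC_div by lra.
  unfold Cdiv; rewrite Cpow_mult_l, Cpow_inv by auto; ring. }
clear -E; induction n as [|n IH].
- rewrite !psum_0; specialize (E 0%nat); simpl in E; rewrite !Cmult_1_l in E; auto.
- rewrite !psum_S, IH, E; auto.
Qed.

(** Take the circle of radius a = |z|. By Poisson's formula the transform on that circle tends
    radially to f(z); by [coef_cauchy_radius] it is the transform on the larger circle b at the
    point r z, which is continuous at z since z lies strictly inside. *)
Lemma cauchy_radius (b : R) (z : C) : 0 < b < 1 -> Cmod z < b ->
  f z = cauchy (fun t => f (b * expi t)) (z / b).
Proof.
intros Hb Hz.
assert (b0 : RtoC b <> 0) by (apply RtoC_neq_0; lra).
set (g := fun w => cauchy (fun t => f (b * expi t)) (w / b)).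
change (f z = g z).
assert (Hq : forall w, Cmod w < b -> Cmod (w / b) < 1).
{ intros w Hw; rewrite Cmod_div, Cmod_RtoC_pos by (auto; lra).
  apply Rmult_lt_reg_r with b; [lra|]; replace (Cmod w / b * b)%R with (Cmod w) by (field; lra); lra. }
assert (Cg : forall w, Cmod w < b -> filterlim g (locally w) (locally (g w))).
{ intros w Hw; unfold g.
  eapply filterlim_comp.
  2:{ eapply (derC_continuous (cauchy (fun t => f (b * expi t))) (w / b)).
      apply derC_cauchy; [apply contR_circle; lra|apply Hq; auto]. }
  apply filterlim_C_mult; [apply _|apply filterlim_id|apply filterlim_const]. }
assert (NZ : forall z : C, z <> 0 -> Cmod z < b -> f z = g z).
{ clear z Hz; intros z z0 Hz.
  destruct (polar_form z) as [t [_ Ht]].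
  assert (a0 : 0 < Cmod z) by (apply Cmod_gt_0; exact z0).
  set (a := Cmod z) in *.
  assert (La : loop (fun t => f (a * expi t))) by (apply loop_circle; lra).
  apply C_small_eq; intros eps He.
  destruct (poisson_limit _ t (eps / 2) La) as [d [d0 Hd]]; [lra|].
  pose proof (Cg z Hz) as Cz; rewrite filterlim_Cmod in Cz by apply _.
  destruct (Cz (eps / 2)%R) as [[d' d0'] Hd']; [lra|].
  destruct (exists_below d 1) as [m1 [m10 [m11 m12]]]; [lra|lra|].
  destruct (exists_below m1 d') as [m [m0 [M1 M2]]]; [lra|lra|].
  set (r := (1 - m / 2)%R).
  assert (Hr : 0 <= r < 1) by (unfold r; lra).
  specialize (Hd r ltac:(unfold r; lra) ltac:(lra)).
  assert (Zr : Cmod (r * expi t) < 1) by (rewrite Cmod_polar; lra).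
  rewrite cauchy_conj_circle in Hd by (auto; lra).
  rewrite (coef_cauchy_radius a b) in Hd by (auto; lra).
  rewrite <- Ht in Hd.
  replace (RtoC (a / b) * (r * expi t)) with (r * z / b) in Hd
    by (rewrite RtoC_div by lra; rewrite Ht; field; auto).
  fold (g (r * z)) in Hd.
  assert (B : Cmod (g (r * z)%C - g z) < eps / 2).
  { apply Hd', C_NormedModule_mixin_compat1; simpl.
    change (Cmod (r * z - z) < d').
    replace (r * z - z) with (- RtoC (m / 2) * z) by (unfold r; rewrite RtoC_minus; ring).
    rewrite Cmod_mult, Cmod_opp, Cmod_RtoC_pos by lra; fold a; nra. }
  replace (f z - g z) with
   ((g (r * z) - g z) - (g (r * z) + avg (fun t => f (a * expi t)) - avg (fun t => f (a * expi t)) - f z)) by ring.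
  eapply Rle_trans; [apply Cmod_minus_le|]; lra. }
(* The circle through the origin degenerates, so this point is reached by continuity of both
   sides. *)
destruct (Ceq_dec z 0) as [->|z0]; [|apply NZ; auto].
destruct (Hf 0) as [l Hl]; [rewrite Cmod_0; lra|].
apply continuous_agree; [apply (derC_continuous _ _ _ Hl)|auto|]; intros d d0.
destruct (exists_below d b) as [m [m0 [m1 m2]]]; [lra|lra|].
assert (W : Cmod (RtoC (m / 2)) = (m / 2)%R) by (apply Cmod_RtoC_pos; lra).
exists (RtoC (m / 2)); replace (RtoC (m / 2) - 0) with (RtoC (m / 2)) by ring.
split; [lra|apply NZ; [apply RtoC_neq_0; lra|lra]].
Qed.

End Analytic.

(** * Continuity up to the boundary *)

Definition disk_limit (f : C -> C) : Prop :=
  forall z, Cmod z = 1%R ->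
    filterlim f (within (fun w => (Cmod w < 1)) (locally z)) (locally (f z)).

Lemma disk_limit_eps (f : C -> C) (z : C) (eps : R) : disk_limit f -> Cmod z = 1%R ->
  0 < eps -> exists d, 0 < d /\
  forall w, Cmod w < 1 -> Cmod (w - z) < d -> Cmod (f w - f z) < eps.
Proof.
intros Hf Hz He; specialize (Hf z Hz).
rewrite filterlim_Cmod in Hf by apply within_filter, locally_filter.
specialize (Hf eps He); unfold within in Hf; apply locally_C in Hf as [d [d0 Hd]].
exists d; split; auto.
Qed.

(** Boundary values are given point by point; compactness of the circle makes the radial convergence
    uniform, as needed to let the radius tend to 1 under an average. *)
Lemma disk_limit_radial (f : C -> C) (eps : R) :
  disk_limit f -> contR (fun t => f (expi t)) -> 0 < eps ->
  exists d, 0 < d /\ forall r t, 1 - d < r < 1 -> 0 <= r ->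
    Cmod (f (r * expi t)%C - f (expi t)) < eps.
Proof.
intros Hf Hc He.
assert (L : forall t0, exists d : posreal, forall r t, Rabs (t - t0) < d ->
   1 - d < r < 1 -> 0 <= r -> Cmod (f (r * expi t)%C - f (expi t)) < eps).
{ intros t0.
  destruct (disk_limit_eps f (expi t0) (eps / 2) Hf (Cmod_expi t0)) as [d [d0 Hd]]; [lra|].
  pose proof (Hc t0) as Ct; unfold contR_at in Ct; rewrite filterlim_Cmod in Ct by apply _.
  destruct (Ct (eps / 2)%R) as [[d' d0'] Hd']; [lra|].
  destruct (exists_below (d / 2) d') as [m [m0 [m1 m2]]]; [lra|lra|].
  exists (mkposreal _ m0); simpl; intros r t Ht Hr r0.
  assert (K1 : Cmod (f (r * expi t)%C - f (expi t0)) < eps / 2).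
  { apply Hd; [rewrite Cmod_polar; lra|].
    replace (expi t0) with (1 * expi t0) by ring.
    eapply Rle_lt_trans; [apply Cmod_polar_sub; lra|].
    rewrite (Rabs_left (r - 1)); lra. }
  assert (K2 : Cmod (f (expi t) - f (expi t0)) < eps / 2).
  { apply Hd'; change (Rabs (t - t0) < d'); lra. }
  replace (f (r * expi t) - f (expi t)) with
    ((f (r * expi t) - f (expi t0)) - (f (expi t) - f (expi t0))) by ring.
  eapply Rle_lt_trans; [apply Cmod_minus_le|lra]. }
set (delta := fun t0 => proj1_sig (constructive_indefinite_description _ (L t0))).
destruct (compactness_value_1d (- PI) PI delta) as [d Hd].
exists d; split; [apply cond_pos|]; intros r t Hr r0.
destruct (Cmod1_expi (expi t) (Cmod_expi t)) as [s [Hs ->]].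
(* [compactness_value_1d] yields its cover under a double negation, which is removed because the
   goal is decidable. *)
destruct (Rlt_dec (Cmod (f (r * expi s)%C - f (expi s))) eps) as [|N]; auto.
exfalso; apply (Hd s Hs); intros [t0 [_ [H1 H2]]]; apply N.
revert H1 H2; unfold delta; destruct constructive_indefinite_description as [dd Hdd]; simpl.
intros; apply Hdd; auto; lra.
Qed.

Lemma loop_expi_comp (f : C -> C) : contR (fun t => f (expi t)) -> loop (fun t => f (expi t)).
Proof. intros H; split; auto; intros t; rewrite expi_period; auto. Qed.

Section CauchyFormula.

Context (f : C -> C) (Hf : forall z, Cmod z < 1 -> exists l, derC f z l).
Context (Hb : disk_limit f) (Hc : contR (fun t => f (expi t))).

Lemma cauchy_formula (z : C) : Cmod z < 1 -> f z = cauchy (fun t => f (expi t)) z.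
Proof.
intros Hz; apply C_small_eq; intros eps He.
pose proof (Cmod_ge_0 z) as z0.
set (h := (1 - Cmod z)%R); assert (h0 : 0 < h <= 1) by (unfold h; lra).
(* The factor h/2 compensates the kernel, which is at most 2/h at z / b once b is close enough to
   1. *)
destruct (disk_limit_radial f (eps / 2 * (h / 2)) Hb Hc) as [d [d0 Hd]]; [rpos|].
pose proof (derC_continuous _ _ _ (derC_cauchy _ z Hc Hz)) as Cz.
rewrite filterlim_Cmod in Cz by apply _.
specialize (Cz (eps / 2)%R ltac:(lra)); apply locally_C in Cz as [d' [d0' Hd']].
destruct (exists_below (h / 2) (d' / 2)) as [m1 [m10 [m11 m12]]]; [lra|lra|].
destruct (exists_below d m1) as [m [m0 [M1 M2]]]; [lra|lra|].
set (b := (1 - m / 2)%R).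
assert (Hb' : 1 / 2 <= b < 1) by (unfold b; lra).
assert (bC : RtoC b <> 0) by (apply RtoC_neq_0; lra).
assert (Hzb : Cmod (z / b) <= 1 - h / 2).
{ rewrite Cmod_div, Cmod_RtoC_pos by (auto; lra).
  apply Rmult_le_reg_r with b; [lra|].
  replace (Cmod z / b * b)%R with (Cmod z) by (field; lra).
  unfold b, h in *; nra. }
rewrite (cauchy_radius f Hf b z) by (unfold b, h in *; lra).
pose proof (contR_circle f Hf b ltac:(lra)) as CC.
assert (Hzb' : Cmod (z / b) < 1) by lra.
replace (cauchy (fun t => f (b * expi t)) (z / b) - cauchy (fun t => f (expi t)) z) with
  (cauchy (fun t => f (b * expi t) - f (expi t)) (z / b) +
   (cauchy (fun t => f (expi t)) (z / b) - cauchy (fun t => f (expi t)) z))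
  by (rewrite cauchy_minus by auto; ring).
eapply Rle_trans; [apply Cmod_triangle|].
assert (K1 : (Cmod (cauchy (fun t => (f (b * expi t) - f (expi t))%C) (z / b)%C) <= eps / 2)%R).
{ pose proof (contR_kernel (z / b) Hzb').
  apply avg_bound_const; [solve_contR|].
  intros t _.
  replace (eps / 2)%R with ((eps / 2 * (h / 2)) * / (h / 2))%R by (field; lra).
  apply Cmod_mult_le; [apply Rlt_le, Hd; unfold b; lra|].
  eapply Rle_trans; [apply Cmod_kernel_le; auto|].
  apply Rinv_le_contravar; lra. }
assert (K2 : (Cmod (cauchy (fun t => f (expi t)) (z / b)%C - cauchy (fun t => f (expi t)) z) < eps / 2)%R).
{ apply Hd'.
  replace (z / b - z) with (z * (RtoC (1 - b) / b)) by (rewrite RtoC_minus; field; auto).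
  rewrite Cmod_mult, Cmod_div, !Cmod_RtoC_pos by (auto; lra).
  assert ((1 - b) / b < d'); [|].
  { apply Rmult_lt_reg_r with b; [lra|].
    replace ((1 - b) / b * b)%R with (1 - b)%R by (field; lra); unfold b in *; nra. }
  assert (0 < (1 - b) / b) by (apply Rdiv_lt_0_compat; lra).
  nra. }
lra.
Qed.

Lemma mean_value : f 0 = avg (fun t => f (expi t)).
Proof.
rewrite cauchy_formula by (rewrite Cmod_0; lra).
apply avg_ext; intros t; unfold kernel.
replace (1 - 0 * expi (- t)) with (RtoC 1) by ring; field.
Qed.

Lemma disk_pseries (z : C) : Cmod z < 1 ->
  is_Cpseries (coef (fun t => f (expi t))) z (f z).
Proof. intros Hz; rewrite cauchy_formula by auto; apply cauchy_pseries; auto. Qed.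

(** The function is dilated before its series is truncated: for a merely continuous boundary
    function the partial sums need not converge uniformly on the circle, while those of f(r z)
    do. *)
Lemma disk_polynomial_approx (eps : R) : 0 < eps ->
  exists (q : nat -> C) (N : nat), forall t,
    Cmod (f (expi t) - psum q (expi t) N) <= eps.
Proof.
intros He.
destruct (disk_limit_radial f (eps / 2) Hb Hc) as [d [d0 Hd]]; [lra|].
destruct (exists_below d 1) as [m [m0 [M1 M2]]]; [lra|lra|].
set (r := (1 - m / 2)%R); assert (Hr : 0 <= r < 1) by (unfold r; lra).
destruct (contR_bounded _ Hc) as [M [M0 HM]].
set (K := (M / (1 - r))%R); assert (K0 : 0 < K) by (unfold K; apply Rdiv_lt_0_compat; lra).
destruct (pow_small r (eps / 2 / K) Hr) as [N HN]; [rpos|].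
set (c := coef (fun t => f (expi t))).
exists (fun n => RtoC r ^ n * c n), N; intros t.
assert (Zr : Cmod (r * expi t) < 1) by (rewrite Cmod_polar; lra).
pose proof (cauchy_partial_bound _ (r * expi t) M N Hc Zr HM) as B.
rewrite <- cauchy_formula, Cmod_polar in B by (auto; lra).
replace (psum (fun n => RtoC r ^ n * c n) (expi t) N) with (psum c (r * expi t) N).
2:{ clear; induction N as [|N IH]; [rewrite !psum_0; simpl; ring|].
  rewrite !psum_S, IH, Cpow_mult_l; ring. }
specialize (Hd r t ltac:(unfold r; lra) ltac:(lra)).
specialize (HN (S N) ltac:(lia)); fold K in B.
apply Rmult_lt_compat_r with (r := K) in HN; auto.
replace (eps / 2 / K * K)%R with (eps / 2)%R in HN by (field; lra).
replace (f (expi t) - psum c (r * expi t) N) with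
  (- ((f (r * expi t) - f (expi t)) + (psum c (r * expi t) N - f (r * expi t)))) by ring.
rewrite Cmod_opp; eapply Rle_trans; [apply Cmod_triangle|]; fold c in B; lra.
Qed.

End CauchyFormula.

(** * Algebra of bounded Hölder functions *)

Definition bounded (u : R -> C) : Prop := exists M : R, forall t, Cmod (u t) <= M.

Definition holder (a : R) (u : R -> C) : Prop :=
  exists K : R, forall t t', t <> t' ->
    Cmod (u t - u t') <= K * Rpower (Rabs (t - t')) a.

(* Boundedness of every derivative makes the class an algebra on the whole
   line; for periodic functions it is automatic. *)
Fixpoint BH (k : nat) (a : R) (u : R -> C) : Prop :=
  bounded u /\
  match k with
  | O => holder a u
  | S k' => exists u', (forall t, derR u t (u' t)) /\ BH k' a u'
  end.

Lemma BH_bounded (k : nat) (a : R) (u : R -> C) : BH k a u -> bounded u.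
Proof. destruct k; intros [H _]; exact H. Qed.

Lemma Rpower_pos (x a : R) : 0 < Rpower x a.
Proof. apply exp_pos. Qed.

Lemma Rpower_incr (x y a : R) : 0 < x <= y -> 0 <= a -> Rpower x a <= Rpower y a.
Proof.
intros [x0 [xy|<-]] Ha; [|lra].
destruct Ha as [Ha|<-]; [|rewrite !Rpower_O; lra].
apply Rlt_le, Rlt_Rpower_l; lra.
Qed.

Lemma Rpower_ge (x a : R) : 0 < x <= 1 -> a <= 1 -> x <= Rpower x a.
Proof.
intros [x0 x1] Ha.
rewrite <- (Rpower_1 x) at 1 by auto; unfold Rpower.
assert (L : ln x <= 0) by (rewrite <- ln_1; apply ln_le; auto).
assert (1 * ln x <= a * ln x) by nra.
destruct (Rle_lt_or_eq_dec _ _ H) as [Q|Q]; [apply Rlt_le, exp_increasing; auto|rewrite Q; lra].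
Qed.

Lemma Rpower_ge_1 (x a : R) : 1 <= x -> 0 <= a -> 1 <= Rpower x a.
Proof.
intros Hx Ha; rewrite <- (Rpower_O x) by lra.
destruct Ha as [Ha|<-]; [|lra].
destruct Hx as [Hx|<-]; [apply Rlt_le, Rpower_lt; lra|].
unfold Rpower; rewrite ln_1, !Rmult_0_r; lra.
Qed.

Lemma Rpower_small (a eps : R) : 0 < a -> 0 < eps ->
  exists d, 0 < d /\ forall x, 0 < x < d -> Rpower x a < eps.
Proof.
intros Ha He; exists (Rpower eps (/ a)); split; [apply Rpower_pos|]; intros x Hx.
rewrite <- (Rpower_1 eps) by auto.
replace 1%R with (/ a * a)%R by (field; lra).
rewrite <- Rpower_mult; apply Rlt_Rpower_l; auto.
Qed.

Section Holder.

Context (a : R) (a01 : 0 < a < 1).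

Lemma Rabs_sub_pos (t t' : R) : t <> t' -> 0 < Rabs (t - t').
Proof. intros; apply Rabs_pos_lt; lra. Qed.

Lemma holder_pos (u : R -> C) : holder a u ->
  exists K : R, 0 < K /\ forall t t', t <> t' ->
    Cmod (u t - u t') <= K * Rpower (Rabs (t - t')) a.
Proof.
intros [K HK]; exists (Rabs K + 1)%R; split; [pose proof (Rabs_pos K); lra|].
intros t t' H; eapply Rle_trans; [apply HK; auto|].
apply Rmult_le_compat_r; [apply Rlt_le, Rpower_pos|].
pose proof (Rle_abs K); lra.
Qed.

Lemma bounded_pos (u : R -> C) : bounded u ->
  exists M : R, 0 < M /\ forall t, Cmod (u t) <= M.
Proof.
intros [M HM]; exists (Rabs M + 1)%R; split; [pose proof (Rabs_pos M); lra|].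
intros t; pose proof (Rle_abs M); specialize (HM t); lra.
Qed.

Lemma holder_continuous (u : R -> C) : holder a u -> contR u.
Proof.
intros H; destruct (holder_pos u H) as [K [K0 HK]].
intros t; apply filterlim_Cmod; [apply _|]; intros eps He.
destruct (Rpower_small a (eps / K)) as [d [d0 Hd]]; [lra|rpos|].
exists (mkposreal d d0); intros s Hs; change (Rabs (s - t) < d) in Hs.
destruct (Req_dec s t) as [->|st].
- replace (u t - u t) with (RtoC 0) by ring; rewrite Cmod_0; auto.
- eapply Rle_lt_trans; [apply HK; auto|].
  replace eps with (K * (eps / K))%R by (field; lra).
  apply Rmult_lt_compat_l; auto; apply Hd; split; auto; apply Rabs_sub_pos; auto.
Qed.

(** An increment h <= 1 satisfies h <= h^a; beyond 1 the Lipschitz bound is too large and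
    boundedness replaces it. *)
Lemma lipschitz_holder (u : R -> C) (L : R) : bounded u ->
  (forall t t', Cmod (u t - u t') <= L * Rabs (t - t')) -> holder a u.
Proof.
intros Hb HL; destruct (bounded_pos u Hb) as [M [M0 HM]].
exists (Rabs L + 2 * M)%R; intros t t' tt.
pose proof (Rabs_sub_pos t t' tt) as P; pose proof (Rpower_pos (Rabs (t - t')) a) as Q.
pose proof (Rabs_pos L); pose proof (Rle_abs L).
destruct (Rle_dec (Rabs (t - t')) 1) as [D|D].
- eapply Rle_trans; [apply HL|].
  pose proof (Rpower_ge (Rabs (t - t')) a ltac:(lra) ltac:(lra)) as E; nra.
- pose proof (Rpower_ge_1 (Rabs (t - t')) a ltac:(lra) ltac:(lra)) as E.
  eapply Rle_trans; [apply Cmod_minus_le|].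
  pose proof (HM t); pose proof (HM t'); nra.
Qed.

Lemma derR_lipschitz (u u' : R -> C) (M : R) :
  (forall t, derR u t (u' t)) -> (forall t, Cmod (u' t) <= M) ->
  forall t t', Cmod (u t - u t') <= M * Rabs (t - t').
Proof. intros Hd HM t t'; apply (mean_value_Rabs u u'); auto. Qed.

Lemma BH_lower (k : nat) (u : R -> C) : BH (S k) a u -> BH k a u.
Proof.
revert u; induction k as [|k IH]; intros u [Hb [u' [Hd Hu']]]; split; auto.
- destruct (BH_bounded _ _ _ Hu') as [M HM].
  apply lipschitz_holder with M; auto; apply derR_lipschitz with u'; auto.
- exists u'; auto.
Qed.

Lemma BH_0 (k : nat) (u : R -> C) : BH k a u -> BH 0 a u.
Proof. induction k as [|k IH]; auto; intros H; apply IH, BH_lower, H. Qed.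

Lemma BH_continuous (k : nat) (u : R -> C) : BH k a u -> contR u.
Proof. intros H; apply holder_continuous, (BH_0 k u H). Qed.

Lemma BH_const (k : nat) (c : C) : BH k a (fun _ => c).
Proof.
revert c; induction k as [|k IH]; intros c; split; try (exists (Cmod c); intros; lra).
- exists 0%R; intros; replace (c - c) with (RtoC 0) by ring; rewrite Cmod_0; lra.
- exists (fun _ => 0); split; auto; intros; apply derR_const.
Qed.

Lemma BH_plus (k : nat) (u v : R -> C) : BH k a u -> BH k a v -> BH k a (fun t => u t + v t).
Proof.
revert u v; induction k as [|k IH]; intros u v [[M HM] Hu] [[N HN] Hv].
- destruct Hu as [K HK], Hv as [L HL]; split.
  + exists (M + N)%R; intros t; eapply Rle_trans; [apply Cmod_triangle|].
    specialize (HM t); specialize (HN t); lra.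
  + exists (K + L)%R; intros t t' tt.
    replace (u t + v t - (u t' + v t')) with ((u t - u t') + (v t - v t')) by ring.
    eapply Rle_trans; [apply Cmod_triangle|].
    specialize (HK t t' tt); specialize (HL t t' tt); lra.
- destruct Hu as [u' [Hu Hu']], Hv as [v' [Hv Hv']]; split.
  + exists (M + N)%R; intros t; eapply Rle_trans; [apply Cmod_triangle|].
    specialize (HM t); specialize (HN t); lra.
  + exists (fun t => u' t + v' t); split; auto; intros; apply derR_plus; auto.
Qed.

Lemma BH_mult (k : nat) (u v : R -> C) : BH k a u -> BH k a v -> BH k a (fun t => u t * v t).
Proof.
revert u v; induction k as [|k IH]; intros u v Hu Hv;
 pose proof (BH_bounded _ _ _ Hu) as Bu; pose proof (BH_bounded _ _ _ Hv) as Bv;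
 destruct (bounded_pos _ Bu) as [M [M0 HM]]; destruct (bounded_pos _ Bv) as [N [N0 HN]];
 (split; [exists (M * N)%R; intros t; apply Cmod_mult_le; auto|]).
- destruct Hu as [_ Hu], Hv as [_ Hv].
  destruct (holder_pos u Hu) as [K [K0 HK]]; destruct (holder_pos v Hv) as [L [L0 HL]].
  exists (K * N + M * L)%R; intros t t' tt.
  replace (u t * v t - (u t' * v t')) with ((u t - u t') * v t + u t' * (v t - v t')) by ring.
  eapply Rle_trans; [apply Cmod_triangle|].
  specialize (HK t t' tt); specialize (HL t t' tt).
  pose proof (Cmod_mult_le _ _ _ _ HK (HN t)); pose proof (Cmod_mult_le _ _ _ _ (HM t') HL); lra.
- pose proof (BH_lower _ _ Hu) as Lu; pose proof (BH_lower _ _ Hv) as Lv.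
  destruct Hu as [_ [u' [Hu Hu']]], Hv as [_ [v' [Hv Hv']]].
  exists (fun t => u' t * v t + u t * v' t); split.
  + intros; apply derR_mult; auto.
  + apply BH_plus; auto.
Qed.

Lemma BH_opp (k : nat) (u : R -> C) : BH k a u -> BH k a (fun t => - u t).
Proof.
intros H.
replace (fun t => - u t) with (fun t => - (1) * u t)
  by (apply functional_extensionality; intros t; ring).
apply BH_mult; auto using BH_const.
Qed.

Lemma BH_minus (k : nat) (u v : R -> C) : BH k a u -> BH k a v -> BH k a (fun t => u t - v t).
Proof. intros Hu Hv; apply (BH_plus k u (fun t => - v t)); auto using BH_opp. Qed.

Lemma derR_conj (u : R -> C) (t : R) (l : C) : derR u t l -> derR (fun x => Cconj (u x)) t (Cconj l).
Proof.
intros H eps He; destruct (H eps He) as [d [d0 Hd]]; exists d; split; auto.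
intros w [s ->] Hw; specialize (Hd _ (ex_intro _ s eq_refl) Hw); simpl in *.
replace (RtoC s - RtoC t) with (Cconj (RtoC s - RtoC t)) at 1
  by (rewrite <- RtoC_minus; apply Cconj_RtoC).
rewrite <- Cmult_conj, <- !Cminus_conj, Cmod_conj; exact Hd.
Qed.

Lemma BH_conj (k : nat) (u : R -> C) : BH k a u -> BH k a (fun t => Cconj (u t)).
Proof.
revert u; induction k as [|k IH]; intros u [[M HM] Hu];
 (split; [exists M; intros; rewrite Cmod_conj; auto|]).
- destruct Hu as [K HK]; exists K; intros; rewrite <- Cminus_conj, Cmod_conj; auto.
- destruct Hu as [u' [Hu Hu']]; exists (fun t => Cconj (u' t)); split; auto.
  intros; apply derR_conj; auto.
Qed.

Lemma BH_inv (k : nat) (u : R -> C) (m : R) : 0 < m -> (forall t, m <= Cmod (u t)) ->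
  BH k a u -> BH k a (fun t => / u t).
Proof.
intros m0 Hm.
assert (nz : forall t, u t <> 0) by (intros t; apply Cmod_gt_0; specialize (Hm t); lra).
assert (B : bounded (fun t => / u t)).
{ exists (/ m)%R; intros t; rewrite Cmod_inv by auto; apply Rinv_le_contravar; auto. }
induction k as [|k IH]; intros Hu; (split; [auto|]).
- destruct Hu as [_ Hu]; destruct (holder_pos u Hu) as [K [K0 HK]].
  exists (K * (/ m * / m))%R; intros t t' tt.
  replace (/ u t - / u t') with ((u t' - u t) * (/ u t * / u t')) by (field; auto).
  rewrite Cmod_mult, Cmod_sub_sym, Cmod_mult, !Cmod_inv by auto.
  replace (K * (/ m * / m) * Rpower (Rabs (t - t')) a)%R with
    ((K * Rpower (Rabs (t - t')) a) * (/ m * / m))%R by ring.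
  assert (I : forall t, 0 < / Cmod (u t) <= / m).
  { intros x; specialize (Hm x); split; [apply Rinv_0_lt_compat; lra|apply Rinv_le_contravar; auto]. }
  apply Rmult_le_compat; auto using Cmod_ge_0.
  + pose proof (I t); pose proof (I t'); nra.
  + pose proof (I t); pose proof (I t'); apply Rmult_le_compat; lra.
- pose proof (IH (BH_lower _ _ Hu)) as Iu.
  destruct Hu as [_ [u' [Hd Hu']]].
  exists (fun t => - (u' t * (/ u t * / u t))); split.
  + intros t; apply (der_inv Real (fun w => u (Re w)) t (u' t) (Hd t)); apply nz.
  + apply BH_opp, BH_mult; auto; apply BH_mult; auto.
Qed.

Lemma BH_expi (k : nat) : BH k a expi.
Proof.
induction k as [|k IH]; (split; [exists 1%R; intros; rewrite Cmod_expi; lra|]).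
- apply lipschitz_holder with 1%R; [exists 1%R; intros; rewrite Cmod_expi; lra|].
  intros; rewrite Rmult_1_l; apply expi_lipschitz.
- exists (fun t => Ci * expi t); split; [apply derR_expi|].
  apply BH_mult; auto using BH_const.
Qed.

Lemma BH_Ck_holder (k : nat) (u : R -> C) : BH k a u -> Ck_holder k a u.
Proof.
revert u; induction k as [|k IH]; intros u [_ H]; auto.
destruct H as [u' [Hd Hu']]; exists u'; split; auto.
intros t; apply derR_is_derive; auto.
Qed.

Lemma derR_unique (u : R -> C) (t : R) (l m : C) : derR u t l -> derR u t m -> l = m.
Proof. apply der_unique; intros x; exists (t + x)%R; symmetry; apply RtoC_plus. Qed.

Lemma derR_translate (u : R -> C) (s t : R) (l : C) :
  derR u (t + s) l -> derR (fun x => u (x + s)%R) t l.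
Proof.
intros H eps He; destruct (H eps He) as [d [d0 Hd]]; exists d; split; auto.
intros w [x ->] Hw; simpl in *.
assert (E : RtoC (x + s) - RtoC (t + s) = RtoC x - RtoC t) by (rewrite !RtoC_plus; ring).
specialize (Hd (RtoC (x + s)) (ex_intro _ _ eq_refl)); rewrite E in Hd; auto.
Qed.

Lemma derR_periodic (u u' : R -> C) : (forall t, u (t + 2 * PI)%R = u t) ->
  (forall t, derR u t (u' t)) -> forall t, u' (t + 2 * PI)%R = u' t.
Proof.
intros Hp Hd t; apply (derR_unique u t); auto.
pose proof (derR_translate u (2 * PI) t _ (Hd (t + 2 * PI)%R)) as K.
replace u with (fun x => u (x + 2 * PI)%R) by (apply functional_extensionality; auto); auto.
Qed.

Lemma Ck_holder_BH (k : nat) (u : R -> C) : (forall t, u (t + 2 * PI)%R = u t) ->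
  Ck_holder k a u -> BH k a u.
Proof.
revert u; induction k as [|k IH]; intros u Hp Hu.
- assert (L : loop u) by (split; auto; apply holder_continuous; auto).
  destruct (loop_bounded u L) as [M [_ HM]]; split; auto; exists M; auto.
- destruct Hu as [u' [Hd Hu']].
  assert (D : forall t, derR u t (u' t)) by (intros; apply derR_is_derive; auto).
  assert (L : loop u).
  { split; auto; intros t; apply (derR_continuous u t _ (D t)). }
  destruct (loop_bounded u L) as [M [_ HM]]; split; [exists M; auto|].
  exists u'; split; auto; apply IH; auto.
  apply derR_periodic with u; auto.
Qed.

End Holder.

(** * Privalov's theorem *)

Lemma is_derive_Rpower (f : R -> R) (x df b : R) : 0 < f x -> is_derive f x df ->
  is_derive (fun y => Rpower (f y) b) x (df * (b * Rpower (f x) (b - 1)))%R.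
Proof.
intros H Hf; apply (is_derive_comp (fun y => Rpower y b) f); auto.
apply is_derive_Reals, derivable_pt_lim_power; auto.
Qed.

Section Privalov.

Context (a : R) (a01 : 0 < a < 1).

Lemma is_RInt_Rpower_abs (h : R) : 0 < h ->
  is_RInt (fun x => Rpower (h + Rabs x) (a - 2)) (- PI) PI
    (2 * ((Rpower h (a - 1) - Rpower (h + PI) (a - 1)) / (1 - a)))%R.
Proof.
intros h0; pose proof PI_RGT_0.
set (J := ((Rpower h (a - 1) - Rpower (h + PI) (a - 1)) / (1 - a))%R).
assert (D : forall b x, 0 <= x ->
  is_derive (fun x => Rpower (h + x) b) x (b * Rpower (h + x) (b - 1))%R).
{ intros b x Hx.
  replace (b * Rpower (h + x) (b - 1))%R with (1 * (b * Rpower (h + x) (b - 1)))%R by ring.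
  apply (is_derive_Rpower (fun x => h + x)%R); [lra|auto_derive; auto; ring]. }
assert (K : is_RInt (fun x => Rpower (h + x) (a - 2)) 0 PI J).
{ set (A := fun x => (- / (1 - a) * Rpower (h + x) (a - 1))%R).
  replace J with (minus (A PI) (A 0%R)).
  - apply (is_RInt_derive (V := R_CompleteNormedModule) A); rewrite Rmin_left, Rmax_right by lra; intros x Hx.
    + unfold A.
      replace (Rpower (h + x) (a - 2)) with
        (- / (1 - a) * ((a - 1) * Rpower (h + x) (a - 1 - 1)))%R
        by (replace (a - 1 - 1)%R with (a - 2)%R by ring; field; lra).
      apply is_derive_scal, D; lra.
    + apply (ex_derive_continuous (fun x => Rpower (h + x) (a - 2))).
      eexists; apply D; lra.
  - unfold A, J, minus, plus, opp; simpl; rewrite Rplus_0_r; field; lra. }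
assert (K1 : is_RInt (fun x => Rpower (h + Rabs x) (a - 2)) 0 PI J).
{ apply is_RInt_ext with (2 := K); rewrite Rmin_left, Rmax_right by lra; intros x Hx.
  rewrite Rabs_pos_eq by lra; auto. }
assert (K2 : is_RInt (fun x => Rpower (h + Rabs x) (a - 2)) (- PI) 0 J).
{ assert (Q : is_RInt (fun x => opp (Rpower (h + Rabs (- x)) (a - 2))) PI 0 J).
  { replace J with (opp (opp J)) by apply opp_opp.
    apply (is_RInt_opp (V := R_NormedModule)).
    apply (is_RInt_swap (V := R_NormedModule)).
    apply is_RInt_ext with (2 := K1); intros x _; rewrite Rabs_Ropp; auto. }
  replace 0%R with (- 0)%R in Q by ring.
  replace PI with (- - PI)%R in Q by ring.
  apply (is_RInt_comp_opp (V := R_NormedModule)) in Q.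
  apply is_RInt_ext with (2 := Q); intros x _.
  change (- - Rpower (h + Rabs (- - x)) (a - 2) = Rpower (h + Rabs x) (a - 2))%R.
  rewrite !Ropp_involutive; auto. }
replace (2 * J)%R with (plus J J) by (unfold plus; simpl; ring).
apply (is_RInt_Chasles (V := R_NormedModule)) with 0%R; auto.
Qed.

Lemma kernel_sqr_bound (r x : R) : 1 / 2 <= r < 1 -> Rabs x <= PI ->
  Cmod (kernel r x * kernel r x) <= 24 * Rpower (1 - r + Rabs x) (-2).
Proof.
intros Hr Hx; pose proof (Rabs_pos x).
pose proof (Cmod_kernel_lower r x Hr Hx) as K.
unfold kernel; set (w := 1 - r * expi (- x)) in *.
set (y := (1 - r + Rabs x)%R) in *; assert (y0 : 0 < y) by (unfold y; lra).
assert (y2 : 0 < y ^ 2) by (apply pow_lt; auto).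
assert (w0 : w <> 0).
{ apply one_minus_neq_0; rewrite Cmod_polar; lra. }
rewrite Cmod_mult, Cmod_inv by auto.
replace (Rpower y (-2)) with (/ y ^ 2)%R.
2:{ replace (-2)%R with (- INR 2)%R by (simpl; ring).
  rewrite Rpower_Ropp, Rpower_pow; auto. }
apply Cmod_gt_0 in w0.
replace (/ Cmod w * / Cmod w)%R with (/ (Cmod w ^ 2))%R by (field; lra).
replace (24 * / y ^ 2)%R with (/ (y ^ 2 / 24))%R by (field; lra).
apply Rinv_le_contravar; [apply Rdiv_lt_0_compat; lra|exact K].
Qed.

Definition derivative_bound (u : R -> C) (M : R) : Prop := forall r t, 1 / 2 <= r < 1 ->
  Cmod (cauchy' u (r * expi t)) <= M * Rpower (1 - r) (a - 1).

(** With y = 1 - r + |x| the increment of u is at most K y^a and the squared kernel at most 24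
    y^{-2}. Enlarging |x|^a to y^a makes the integral of y^{a-2} elementary; as a < 1, it is of
    order (1 - r)^{a-1}. *)
Lemma cauchy'_bound (u : R -> C) : loop u -> holder a u ->
  exists M : R, 0 < M /\ derivative_bound u M.
Proof.
intros Lu Hu; destruct (holder_pos a u Hu) as [K [K0 HK]].
exists (24 * K / (1 - a))%R; split; [apply Rdiv_lt_0_compat; lra|].
intros r t Hr.
rewrite cauchy'_polar by (auto; lra).
rewrite Cmod_mult, Cmod_expi, Rmult_1_l.
assert (h0 : 0 < 1 - r) by lra.
pose proof (is_RInt_scal (V := R_NormedModule) _ _ _ (24 * K)%R _ (is_RInt_Rpower_abs (1 - r) h0)) as J.
assert (Cu : contR (fun x => u (x + t)%R)) by (apply contR_translate, Lu).
assert (Ck : contR (kernel r)) by (apply contR_kernel; rewrite Cmod_RtoC_pos; lra).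
eapply Rle_trans; [eapply avg_bound with (3 := J); [solve_contR|]|].
- intros x Hx; assert (Hx' : Rabs x <= PI) by (apply Rabs_le; lra).
  change (scal ?b ?c) with (b * c)%R.
  destruct (Req_dec x 0) as [->|x0].
  + rewrite Rplus_0_l; replace (u t - u t) with (RtoC 0) by ring.
    rewrite Cmult_0_l, Cmod_0.
    apply Rmult_le_pos; [lra|apply Rlt_le, Rpower_pos].
  + assert (X : 0 < Rabs x) by (apply Rabs_pos_lt; auto).
    assert (tt : (x + t)%R <> t) by lra.
    specialize (HK _ _ tt); replace (x + t - t)%R with x in HK by ring.
    rewrite (Cmod_mult _ (expi _ * _)), (Cmod_mult (expi _)), Cmod_expi, Rmult_1_l.
    pose proof (kernel_sqr_bound r x Hr Hx') as KB.
    set (y := (1 - r + Rabs x)%R) in *.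
    apply Rle_trans with ((K * Rpower y a) * (24 * Rpower y (-2)))%R.
    * apply Rmult_le_compat; auto using Cmod_ge_0.
      eapply Rle_trans; [exact HK|]; apply Rmult_le_compat_l; [lra|].
      apply Rpower_incr; unfold y; lra.
    * replace (a - 2)%R with (a + (-2))%R by ring; rewrite Rpower_plus; lra.
- change (scal ?b ?c) with (b * c)%R.
  pose proof PI2_1; pose proof (Rpower_pos (1 - r) (a - 1)) as P1.
  pose proof (Rpower_pos (1 - r + PI) (a - 1)) as P2.
  set (p := Rpower (1 - r) (a - 1)) in *; set (q := Rpower (1 - r + PI) (a - 1)) in *.
  replace (24 * K * (2 * ((p - q) / (1 - a))) / (2 * PI))%R with
    ((24 * K / (1 - a)) * ((p - q) / PI))%R by (field; split; lra).
  apply Rmult_le_compat_l; [apply Rlt_le, Rdiv_lt_0_compat; lra|].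
  apply Rmult_le_reg_r with PI; [lra|].
  replace ((p - q) / PI * PI)%R with (p - q)%R by (field; lra).
  nra.
Qed.

Lemma cauchy_radial_bound (u : R -> C) (M : R) (t r r' : R) : loop u -> 0 < M ->
  derivative_bound u M ->
  1 / 2 <= r <= r' -> r' < 1 ->
  Cmod (cauchy u (r' * expi t) - cauchy u (r * expi t)) <= M / a * Rpower (1 - r) a.
Proof.
intros Lu M0 HM Hr Hr'.
(* A primitive of the derivative bound M (1 - x)^{a-1}; since a > 0 it stays bounded up to x = 1. *)
set (g := fun x => (- (M / a) * Rpower (1 - x) a)%R).
apply Rle_trans with (g r' - g r)%R.
- apply (mean_value_dominated (fun x => cauchy u (x * expi t))
    (fun x => expi t * cauchy' u (x * expi t)) g (fun x => M * Rpower (1 - x) (a - 1))%R); [lra| | |].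
  + intros x Hx; apply (derR_comp (cauchy u) (fun x => x * expi t)); [|apply derR_radius].
    apply derC_cauchy; [apply Lu|rewrite Cmod_polar; lra].
  + intros x Hx; unfold g.
    replace (M * Rpower (1 - x) (a - 1))%R with
      (- (M / a) * (- (1) * (a * Rpower (1 - x) (a - 1))))%R by (field; lra).
    apply is_derive_scal, (is_derive_Rpower (fun x => 1 - x)%R); [lra|auto_derive; auto; ring].
  + intros x Hx; rewrite Cmod_mult, Cmod_expi, Rmult_1_l; apply HM; lra.
- unfold g; pose proof (Rpower_pos (1 - r') a).
  assert (0 < M / a) by (apply Rdiv_lt_0_compat; lra); nra.
Qed.

Lemma cauchy_angular_bound (u : R -> C) (M : R) (t t' r : R) : loop u ->
  derivative_bound u M ->
  1 / 2 <= r < 1 ->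
  Cmod (cauchy u (r * expi t) - cauchy u (r * expi t')) <= M * Rpower (1 - r) (a - 1) * Rabs (t - t').
Proof.
intros Lu HM Hr.
apply (derR_lipschitz (fun t => cauchy u (r * expi t)) (fun t => (r * (Ci * expi t)) * cauchy' u (r * expi t))).
- intros x; apply (derR_comp (cauchy u) (fun x => r * expi x)); [|apply derR_angle].
  apply derC_cauchy; [apply Lu|rewrite Cmod_polar; lra].
- intros x; rewrite !Cmod_mult, Cmod_Ci, Cmod_expi, Cmod_RtoC_pos by lra.
  specialize (HM r x Hr).
  pose proof (Cmod_ge_0 (cauchy' u (r * expi x))); nra.
Qed.

Lemma cauchy_bound (u : R -> C) (M : R) (z : C) : contR u -> Cmod z < 1 ->
  (forall t, Cmod (u t) <= M) -> Cmod (cauchy u z) <= M * / (1 - Cmod z).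
Proof.
intros Hu Hz HM; pose proof (contR_kernel z Hz); apply avg_bound_const; [solve_contR|].
intros t _; apply Cmod_mult_le; auto; apply Cmod_kernel_le; auto.
Qed.

(** The rate of radial convergence, uniform in the angle, belongs to the notion: it converts
    estimates inside the disk into Hölder bounds for [v]. *)
Definition boundary_value (u v : R -> C) : Prop :=
  exists M : R, 0 < M /\ forall r t, 1 / 2 <= r < 1 ->
    Cmod (v t - cauchy u (r * expi t)) <= M * Rpower (1 - r) a.

Lemma boundary_value_near (u v : R -> C) (eps : R) : boundary_value u v -> 0 < eps ->
  exists d, 0 < d <= 1 / 2 /\ forall r t, 1 - d <= r < 1 ->
    Cmod (v t - cauchy u (r * expi t)) <= eps.
Proof.
intros [B [B0 HB]] He.
destruct (Rpower_small a (eps / B)) as [d [d0 Hd]]; [lra|rpos|].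
destruct (exists_below (d / 2) (1 / 2)) as [m [m0 [m1 m2]]]; [lra|lra|].
exists m; split; [lra|]; intros r t Hr; eapply Rle_trans; [apply HB; lra|].
replace eps with (B * (eps / B))%R by (field; lra).
apply Rmult_le_compat_l, Rlt_le, Hd; lra.
Qed.

Lemma boundary_value_exists (u : R -> C) : loop u -> holder a u ->
  exists v, boundary_value u v.
Proof.
intros Lu Hu; destruct (cauchy'_bound u Lu Hu) as [M [M0 HM]].
set (B := (M / a)%R); assert (B0 : 0 < B) by (apply Rdiv_lt_0_compat; lra).
assert (L : forall t, exists l, forall r, 1 / 2 <= r < 1 ->
  Cmod (l - cauchy u (r * expi t)) <= B * Rpower (1 - r) a).
{ intros t.
  assert (H := proj1 (filterlim_locally_cauchy (U := C_R_CompleteNormedModule) (F := at_left 1)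
    (fun r => cauchy u (r * expi t)))).
  destruct H as [l Hl].
  - intros [eps He]; destruct (Rpower_small a (eps / (2 * B))) as [d [d0 Hd]]; [lra|rpos|].
    destruct (exists_below d (1 / 2)) as [m [m0 [m1 m2']]]; [lra|lra|].
    set (r0 := (1 - m / 2)%R).
    exists (fun r => (r0 <= r < 1)); split.
    + assert (m2 : 0 < m / 2) by lra.
      exists (mkposreal _ m2); intros y Hy Hy1; change (Rabs (y - 1) < m / 2) in Hy.
      rewrite Rabs_left in Hy by lra; unfold r0; lra.
    + intros x y Hx Hy; apply C_NormedModule_mixin_compat1.
      change (Cmod (cauchy u (y * expi t) - cauchy u (x * expi t)) < eps).
      assert (Q : B * Rpower (1 - r0) a < eps / 2).
      { replace (eps / 2)%R with (B * (eps / (2 * B)))%R by (field; lra).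
        apply Rmult_lt_compat_l; auto; apply Hd; unfold r0; lra. }
      assert (Q1 := cauchy_radial_bound u M t r0 x Lu M0 HM ltac:(unfold r0 in *; lra) ltac:(lra)).
      assert (Q2 := cauchy_radial_bound u M t r0 y Lu M0 HM ltac:(unfold r0 in *; lra) ltac:(lra)).
      fold B in Q1, Q2.
      replace (cauchy u (y * expi t) - cauchy u (x * expi t)) with
        ((cauchy u (y * expi t) - cauchy u (r0 * expi t)) -
         (cauchy u (x * expi t) - cauchy u (r0 * expi t))) by ring.
      eapply Rle_lt_trans; [apply Cmod_minus_le|lra].
  - exists l; intros r Hr; apply Rle_plus_epsilon; intros eps He.
    assert (Hl' := proj1 (filterlim_Cmod (at_left 1) _ _) Hl eps He).
    destruct Hl' as [[d d0] Hd].
    destruct (exists_below (d / 2) ((1 - r) / 2)) as [m [m0 [m1 m2']]]; [lra|lra|].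
    assert (Hd1 : Cmod (cauchy u (RtoC (1 - m) * expi t) - l) < eps).
    { apply Hd; [|lra]; change (Rabs (1 - m - 1) < d); rewrite Rabs_left; lra. }
    assert (Q1 := cauchy_radial_bound u M t r (1 - m) Lu M0 HM ltac:(lra) ltac:(lra)).
    fold B in Q1.
    replace (l - cauchy u (r * expi t)) with
      ((cauchy u (RtoC (1 - m) * expi t) - cauchy u (r * expi t)) -
        (cauchy u (RtoC (1 - m) * expi t) - l)) by ring.
    eapply Rle_trans; [apply Cmod_minus_le|lra]. }
exists (fun t => proj1_sig (constructive_indefinite_description _ (L t))).
exists B; split; auto; intros r t Hr.
destruct constructive_indefinite_description as [l Hl]; simpl; auto.
Qed.

(** For h = |t - t'| <= 1/2 the path goes inwards to radius 1 - h, along the arc and back out. The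
    radial pieces cost B h^a each and the arc M h^{a-1} h, so this radius balances the two. Larger
    increments are covered by boundedness. *)
Lemma boundary_value_holder (u v : R -> C) : loop u -> holder a u ->
  boundary_value u v -> BH 0 a v.
Proof.
intros Lu Hu [B [B0 HB]]; destruct (cauchy'_bound u Lu Hu) as [M [M0 HM]].
destruct (loop_bounded u Lu) as [N [N0 HN]].
set (P := Rpower (1 / 2) a); assert (P0 : 0 < P) by apply Rpower_pos.
set (W := (B * P + N * 2)%R); assert (W0 : 0 < W) by (unfold W; nra).
assert (HW : forall t, Cmod (v t) <= W).
{ intros t; assert (H2 : 1 / 2 <= 1 / 2 < 1) by lra.
  specialize (HB (1 / 2)%R t H2); replace (1 - 1 / 2)%R with (1 / 2)%R in HB by field.
  fold P in HB.
  assert (Z : Cmod (RtoC (1 / 2) * expi t) = (1 / 2)%R) by (apply Cmod_polar; lra).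
  pose proof (cauchy_bound u N (RtoC (1 / 2) * expi t) (proj1 Lu) ltac:(lra) HN) as K.
  rewrite Z in K; replace (/ (1 - 1 / 2))%R with 2%R in K by field.
  replace (v t) with ((v t - cauchy u (RtoC (1 / 2) * expi t)) + cauchy u (RtoC (1 / 2) * expi t)) by ring.
  eapply Rle_trans; [apply Cmod_triangle|unfold W; lra]. }
split; [exists W; auto|].
exists (2 * B + M + 2 * W / P)%R; intros t t' tt.
pose proof (Rabs_sub_pos t t' tt) as T.
set (h := Rabs (t - t')) in *; pose proof (Rpower_pos h a) as Q.
assert (X : 0 < 2 * W / P) by (apply Rdiv_lt_0_compat; lra).
destruct (Rle_dec h (1 / 2)) as [D|D].
- assert (Hr : 1 / 2 <= 1 - h < 1) by lra.
  pose proof (HB _ t Hr) as B1; pose proof (HB _ t' Hr) as B2.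
  pose proof (cauchy_angular_bound u M t t' _ Lu HM Hr) as A; fold h in A.
  replace (1 - (1 - h))%R with h in * by ring.
  replace (M * Rpower h (a - 1) * h)%R with (M * Rpower h a)%R in A.
  2:{ replace a with ((a - 1) + 1)%R at 1 by ring; rewrite Rpower_plus, Rpower_1 by auto; ring. }
  set (z := RtoC (1 - h) * expi t) in *; set (z' := RtoC (1 - h) * expi t') in *.
  replace (v t - v t') with ((v t - cauchy u z) + (cauchy u z - cauchy u z') - (v t' - cauchy u z')) by ring.
  eapply Rle_trans; [apply Cmod_minus_le|].
  eapply Rle_trans; [apply Rplus_le_compat_r, Cmod_triangle|]; nra.
- eapply Rle_trans; [apply Cmod_minus_le|].
  pose proof (HW t); pose proof (HW t').
  assert (PP : P <= Rpower h a) by (apply Rpower_incr; lra).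
  assert (2 * W <= 2 * W / P * Rpower h a); [|nra].
  replace (2 * W)%R with (2 * W / P * P)%R at 1 by (field; lra).
  apply Rmult_le_compat_l; lra.
Qed.

(** * Derivatives of the boundary function *)

Lemma derR_remainder (u : R -> C) (t x : R) (c l m : C) : derR u x l ->
  derR (fun x => u x - c - (RtoC x - RtoC t) * m) x (l - m).
Proof.
intros H.
replace (l - m) with (l + 0 + (- m * (1 + 0))) by ring.
replace (fun x => u x - c - (RtoC x - RtoC t) * m) with
  (fun x => u x + (- c) + (- m) * (RtoC x + (- RtoC t)))
  by (apply functional_extensionality; intros; ring).
apply derR_plus; [apply derR_plus; auto; apply derR_const|].
apply derR_mult_l, derR_plus; [apply derR_RtoC|apply derR_const].
Qed.

Lemma holder_near (u : R -> C) (K h x t : R) : 0 < K -> 0 < h ->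
  (forall t t', t <> t' -> Cmod (u t - u t') <= K * Rpower (Rabs (t - t')) a) ->
  Rabs (x - t) <= h -> Cmod (u x - u t) <= K * Rpower h a.
Proof.
intros K0 h0 HK Hx; destruct (Req_dec x t) as [->|xt].
- replace (u t - u t) with (RtoC 0) by ring; rewrite Cmod_0.
  apply Rmult_le_pos; [lra|apply Rlt_le, Rpower_pos].
- eapply Rle_trans; [apply HK; auto|]; apply Rmult_le_compat_l; [lra|].
  apply Rpower_incr; [split; auto; apply Rabs_sub_pos; auto|lra].
Qed.

Lemma holder_taylor (u u' : R -> C) (K : R) : 0 < K ->
  (forall t, derR u t (u' t)) ->
  (forall t t', t <> t' -> Cmod (u' t - u' t') <= K * Rpower (Rabs (t - t')) a) ->
  forall s t, s <> t ->
  Cmod (u s - u t - (RtoC s - RtoC t) * u' t) <= K * Rpower (Rabs (s - t)) a * Rabs (s - t).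
Proof.
intros K0 Hd HK s t st.
set (w := fun x => u x - u t - (RtoC x - RtoC t) * u' t).
replace (u s - u t - (RtoC s - RtoC t) * u' t) with (w s - w t) by (unfold w; ring).
apply (mean_value_Rabs w (fun x => u' x - u' t)); intros x Hx.
split; [apply derR_remainder; auto|apply holder_near; auto; apply Rabs_sub_pos; auto].
Qed.

Lemma derR_holder_remainder (u : R -> C) (t : R) (l : C) (K : R) : 0 < K ->
  (forall s, s <> t -> Cmod (u s - u t - (RtoC s - RtoC t) * l) <=
     K * Rpower (Rabs (s - t)) a * Rabs (s - t)) -> derR u t l.
Proof.
intros K0 H eps He.
destruct (Rpower_small a (eps / K)) as [d [d0 Hd]]; [lra|rpos|].
exists d; split; auto; intros w [s ->] Hw; simpl.
rewrite <- RtoC_minus, Cmod_R in Hw |- *; rewrite RtoC_minus.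
destruct (Req_dec s t) as [->|st].
- replace (u t - u t - (RtoC t - RtoC t) * l) with (RtoC 0) by ring; rewrite Cmod_0.
  apply Rmult_le_pos; [lra|apply Rabs_pos].
- eapply Rle_trans; [apply H; auto|].
  apply Rmult_le_compat_r; [apply Rabs_pos|].
  replace eps with (K * (eps / K))%R by (field; lra).
  apply Rmult_le_compat_l; [lra|]; apply Rlt_le, Hd; split; auto; apply Rabs_sub_pos; auto.
Qed.

(** [cauchy_polar] moves the angle from the kernel into u, so differentiation under the average hits
    u alone. The Taylor remainder of u is uniform by [holder_taylor], which justifies the
    interchange. *)
Lemma derR_cauchy_angular (u u' : R -> C) (r t : R) : loop u -> loop u' -> holder a u' ->
  (forall t, derR u t (u' t)) -> 0 <= r < 1 ->
  derR (fun t => cauchy u (r * expi t)) t (cauchy u' (r * expi t)).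
Proof.
intros Lu Lu' Hu' Hd Hr.
destruct (holder_pos a u' Hu') as [K [K0 HK]].
set (N := (/ (1 - r))%R); assert (N0 : 0 < N) by (apply Rinv_0_lt_compat; lra).
assert (Zr : Cmod r = r) by (apply Cmod_RtoC_pos; lra).
assert (Ck : contR (kernel r)) by (apply contR_kernel; lra).
apply derR_holder_remainder with (K * N)%R; [nra|]; intros s st.
rewrite !cauchy_polar by auto.
pose proof (contR_translate u s (proj1 Lu)) as C1; pose proof (contR_translate u t (proj1 Lu)) as C2.
pose proof (contR_translate u' t (proj1 Lu')) as C3.
rewrite <- avg_mult_l, <- !avg_minus by solve_contR.
apply avg_bound_const; [solve_contR|]; intros x _.
replace (u (x + s)%R * kernel r x - u (x + t)%R * kernel r x -
  (RtoC s - RtoC t) * (u' (x + t)%R * kernel r x)) with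
  ((u (x + s)%R - u (x + t)%R - (RtoC (x + s) - RtoC (x + t)) * u' (x + t)%R) * kernel r x)
  by (rewrite !RtoC_plus; ring).
assert (xst : (x + s)%R <> (x + t)%R) by lra.
pose proof (holder_taylor u u' K K0 Hd HK _ _ xst) as T.
replace (x + s - (x + t))%R with (s - t)%R in T by ring.
replace (K * N * Rpower (Rabs (s - t)) a * Rabs (s - t))%R with
  ((K * Rpower (Rabs (s - t)) a * Rabs (s - t)) * N)%R by ring.
apply Cmod_mult_le; auto.
eapply Rle_trans; [apply Cmod_kernel_le; lra|rewrite Zr; unfold N; lra].
Qed.

(** At a radius r near 1 both transforms are uniformly within e of v and v'. The remainder of v then
    differs from that of the inner function by 2e, and the error in the derivative costs another e
    h, whence e = eps / (2 + h). *)
Lemma boundary_value_derive (u u' v v' : R -> C) : loop u -> loop u' ->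
  holder a u' -> holder a v' -> (forall t, derR u t (u' t)) ->
  boundary_value u v -> boundary_value u' v' -> forall t, derR v t (v' t).
Proof.
intros Lu Lu' Hu' Hv' Hd Bv Bv' t.
destruct (holder_pos a v' Hv') as [K [K0 HK]].
apply derR_holder_remainder with K; auto; intros s st.
apply Rle_plus_epsilon; intros eps He.
set (h := Rabs (s - t)); assert (h0 : 0 < h) by (apply Rabs_sub_pos; auto).
set (e := (eps / (2 + h))%R); assert (e0 : 0 < e) by (unfold e; apply Rdiv_lt_0_compat; lra).
destruct (boundary_value_near u v e Bv e0) as [d [Hd0 HB]].
destruct (boundary_value_near u' v' e Bv' e0) as [d' [Hd0' HB']].
destruct (exists_below d d') as [m [m0 [m1 m2]]]; [lra|lra|].
set (r := (1 - m)%R); assert (Hr : (1 - d <= r < 1 /\ 1 - d' <= r < 1 /\ 0 <= r < 1)) by (unfold r; lra).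
destruct Hr as [Hr [Hr' Hr0]].
set (F := fun x : R => cauchy u (r * expi x)).
set (F' := fun x : R => cauchy u' (r * expi x)).
assert (DF : forall x, derR F x (F' x)).
{ intros x; exact (derR_cauchy_angular u u' r x Lu Lu' Hu' Hd Hr0). }
set (w := fun x => F x - F t - (RtoC x - RtoC t) * v' t).
assert (Hw : Cmod (w s - w t) <= (e + K * Rpower h a) * h).
{ apply (mean_value_Rabs w (fun x => F' x - v' t)); intros x Hx; fold h in Hx.
  split; [apply derR_remainder; auto|].
  specialize (HB' r x Hr'); fold (F' x) in HB'.
  replace (F' x - v' t) with ((v' x - v' t) - (v' x - F' x)) by ring.
  eapply Rle_trans; [apply Cmod_minus_le|].
  pose proof (holder_near v' K h x t K0 h0 HK Hx); lra. }
pose proof (HB r s Hr) as B1; pose proof (HB r t Hr) as B2.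
fold (F s) in B1; fold (F t) in B2.
replace (v s - v t - (RtoC s - RtoC t) * v' t) with
  ((v s - F s) - (v t - F t) + (w s - w t)) by (unfold w; ring).
eapply Rle_trans; [apply Cmod_triangle|].
eapply Rle_trans; [apply Rplus_le_compat_r, Cmod_minus_le|].
assert (E : (e * (2 + h) = eps)%R) by (unfold e; field; lra).
nra.
Qed.

(** Angular derivatives commute with the transform, so induction on k applies the result to u' and
    reduces everything to the case of exponent a. *)
Lemma privalov (k : nat) (u : R -> C) : loop u -> BH k a u ->
  exists v, boundary_value u v /\ BH k a v.
Proof.
revert u; induction k as [|k IH]; intros u Lu Hu.
- destruct (boundary_value_exists u Lu (proj2 Hu)) as [v Hv].
  exists v; split; auto; apply boundary_value_holder with u; auto; apply Hu.
- assert (H0 : holder a u) by apply (BH_0 a a01 (S k) u Hu).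
  destruct Hu as [_ [u' [Hd Hu']]].
  assert (Lu' : loop u').
  { split; [apply (BH_continuous a a01 k u' Hu')|apply derR_periodic with u; auto; apply Lu]. }
  destruct (IH u' Lu' Hu') as [v' [Bv' Hv']].
  destruct (boundary_value_exists u Lu H0) as [v Bv].
  exists v; split; auto; split; [apply (boundary_value_holder u v Lu H0 Bv)|].
  exists v'; split; auto.
  apply boundary_value_derive with u u'; auto; [apply (BH_0 a a01 k _ Hu')|apply (BH_0 a a01 k _ Hv')].
Qed.

End Privalov.

(** * The algebra of holomorphic functions with Hölder boundary values *)

Section HolderDisk.

Context (k : nat) (a : R) (a01 : 0 < a < 1).

(** The working form of [H0_Cs_disk]: [BH] carries bounds on all derivatives, so that closure under
    products and inverses can be proved directly. *)
Definition As (f : C -> C) : Prop :=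
  (forall z, Cmod z < 1 -> exists l, derC f z l) /\ disk_limit f /\
  BH k a (fun t => f (expi t)).

Lemma As_continuous (f : C -> C) : As f -> contR (fun t => f (expi t)).
Proof. intros [_ [_ H]]; apply (BH_continuous a a01 k _ H). Qed.

Lemma As_loop (f : C -> C) : As f -> loop (fun t => f (expi t)).
Proof. intros H; apply loop_expi_comp, As_continuous, H. Qed.

Lemma within_locally_filter (z : C) : Filter (within (fun w => (Cmod w < 1)) (locally z)).
Proof. apply within_filter, locally_filter. Qed.

Lemma As_const (c : C) : As (fun _ => c).
Proof.
split; [|split].
- intros z _; exists 0; apply (der_const (fun _ => True)).
- intros z _; apply filterlim_const.
- apply BH_const.
Qed.

Lemma As_id : As (fun z => z).
Proof.
split; [|split].
- intros z _; exists 1; apply (der_id (fun _ => True)).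
- intros z _; apply filterlim_within_ext with (f := fun w => w); auto.
  intros P HP; unfold filtermap, within; generalize HP; apply filter_imp; auto.
- apply BH_expi; auto.
Qed.

Lemma As_plus (f g : C -> C) : As f -> As g -> As (fun z => f z + g z).
Proof.
intros [F1 [F2 F3]] [G1 [G2 G3]]; split; [|split].
- intros z Hz; destruct (F1 z Hz) as [l Hl], (G1 z Hz) as [m Hm].
  exists (l + m); apply der_plus; auto.
- intros z Hz; apply filterlim_C_plus; auto; apply within_locally_filter.
- apply BH_plus; auto.
Qed.

Lemma As_mult (f g : C -> C) : As f -> As g -> As (fun z => f z * g z).
Proof.
intros [F1 [F2 F3]] [G1 [G2 G3]]; split; [|split].
- intros z Hz; destruct (F1 z Hz) as [l Hl], (G1 z Hz) as [m Hm].
  eexists; apply (der_mult _ f g); eauto.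
- intros z Hz; apply filterlim_C_mult; auto; apply within_locally_filter.
- apply BH_mult; auto.
Qed.

Lemma As_ext (f g : C -> C) : (forall z, f z = g z) -> As f -> As g.
Proof. intros H; replace g with f; auto; apply functional_extensionality; auto. Qed.

Lemma As_opp (f : C -> C) : As f -> As (fun z => - f z).
Proof.
intros H; apply As_ext with (fun z => - (1) * f z); [intros; ring|].
apply As_mult; auto using As_const.
Qed.

Lemma As_minus (f g : C -> C) : As f -> As g -> As (fun z => f z - g z).
Proof. intros; apply (As_plus f (fun z => - g z)); auto using As_opp. Qed.

Lemma As_pow (f : C -> C) (n : nat) : As f -> As (fun z => f z ^ n).
Proof.
intros H; induction n as [|n IH]; [exact (As_const 1)|].
apply (As_mult f (fun z => f z ^ n)); auto.
Qed.

Lemma BH_inv_loop (u : R -> C) : loop u -> (forall t, u t <> 0) -> BH k a u -> BH k a (fun t => / u t).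
Proof.
intros Lu H0 Hu.
assert (L : loop (fun t => / u t)).
{ split; [apply contR_inv; auto; apply Lu|]; intros t; rewrite (proj2 Lu); auto. }
destruct (loop_bounded _ L) as [M [M0 HM]].
apply BH_inv with (/ M)%R; auto; [apply Rinv_0_lt_compat; auto|].
intros t; specialize (HM t); rewrite Cmod_inv in HM by auto.
assert (P : 0 < Cmod (u t)) by (apply Cmod_gt_0; auto).
rewrite <- (Rinv_inv (Cmod (u t))); apply Rinv_le_contravar; auto; apply Rinv_0_lt_compat; auto.
Qed.

Lemma As_inv (f : C -> C) : As f -> (forall z, Cmod z <= 1 -> f z <> 0) -> As (fun z => / f z).
Proof.
intros Hf H0; pose proof (As_loop f Hf) as L; destruct Hf as [F1 [F2 F3]]; split; [|split].
- intros z Hz; destruct (F1 z Hz) as [l Hl].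
  eexists; apply (der_inv _ f z l); auto; apply H0; lra.
- intros z Hz; apply filterlim_C_inv; auto; [apply within_locally_filter|apply H0; lra].
- apply (BH_inv_loop (fun t => f (expi t))); auto.
  intros t; apply H0; rewrite Cmod_expi; lra.
Qed.

Lemma boundary_value_unique (u v : R -> C) (t t' : R) : boundary_value a u v ->
  expi t = expi t' -> v t = v t'.
Proof.
intros Bv E; apply C_small_eq; intros eps He.
destruct (boundary_value_near a a01 u v (eps / 2) Bv) as [d [d0 Hd]]; [lra|].
assert (Hr : 1 - d <= 1 - d < 1) by lra.
pose proof (Hd _ t Hr) as K1; pose proof (Hd _ t' Hr) as K2; rewrite <- E in K2.
set (z := RtoC (1 - d) * expi t) in *.
replace (v t - v t') with ((v t - cauchy u z) - (v t' - cauchy u z)) by ring.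
eapply Rle_trans; [apply Cmod_minus_le|lra].
Qed.

(** The function on the closed disk is assembled from the transform inside and Privalov's boundary
    function on the circle. Full limits at the circle, not only radial ones, follow from the uniform
    radial rate and the continuity of that boundary function. *)
Lemma cauchy_As (u : R -> C) : loop u -> BH k a u ->
  exists F, As F /\ (forall z, Cmod z < 1 -> F z = cauchy u z) /\
    boundary_value a u (fun t => F (expi t)).
Proof.
intros Lu Hu; destruct (privalov a a01 k u Lu Hu) as [v [Bv Hv]].
assert (Lift : forall z, exists t, Cmod z = 1%R -> z = expi t).
{ intros z; destruct (Req_dec (Cmod z) 1) as [E|E].
  - destruct (Cmod1_expi z E) as [t [_ Ht]]; exists t; auto.
  - exists 0%R; intros K; contradiction. }
set (arg := fun z => proj1_sig (constructive_indefinite_description _ (Lift z))).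
assert (Harg : forall z, Cmod z = 1%R -> z = expi (arg z)).
{ intros z; unfold arg; destruct constructive_indefinite_description; auto. }
set (F := fun z => if Rlt_dec (Cmod z) 1 then cauchy u z else v (arg z)).
assert (F1 : forall z, Cmod z < 1 -> F z = cauchy u z).
{ intros z Hz; unfold F; destruct Rlt_dec; [auto|contradiction]. }
assert (F2 : forall t, F (expi t) = v t).
{ intros t; unfold F; destruct Rlt_dec as [L|_]; [rewrite Cmod_expi in L; lra|].
  apply boundary_value_unique with u; auto; symmetry; apply Harg, Cmod_expi. }
assert (FV : (fun t => F (expi t)) = v) by (apply functional_extensionality; auto).
exists F; split; [|split; [auto|rewrite FV; auto]].
split; [|split; [|rewrite FV; auto]].
- intros z Hz; exists (cauchy' u z).
  apply derC_local_disk with (cauchy u); auto; [intros; symmetry; auto|].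
  apply derC_cauchy; auto; apply Lu.
- intros z Hz; destruct (Cmod1_expi z Hz) as [t0 [_ ->]]; clear Hz.
  apply filterlim_Cmod; [apply within_locally_filter|]; intros eps He.
  rewrite F2.
  pose proof (BH_continuous a a01 k v Hv t0) as Cv; unfold contR_at in Cv.
  rewrite filterlim_Cmod in Cv by apply _.
  destruct (Cv (eps / 2)%R) as [[d d0] Hd]; [lra|].
  destruct (boundary_value_near a a01 u v (eps / 2) Bv) as [d' [d0' HB]]; [lra|].
  (* The angle x between w and the boundary point satisfies |x| <= 3 |e^{ix} - 1| <= 3 ((1 - |w|) +
     |w - e^{i t0}|) < 6 m. *)
  destruct (exists_below (d / 6) d') as [m [m0 [m1 m2]]]; [lra|lra|].
  unfold within; apply locally_C; exists m; split; auto; intros w Hw W1.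
  destruct (polar_form (w * expi (- t0))) as [x [Hx Ex]].
  assert (W2 : Cmod (w * expi (- t0)) = Cmod w) by (apply Cmod_mult_expi).
  rewrite W2 in Ex.
  assert (Ew : w = Cmod w * expi (x + t0)).
  { rewrite expi_plus, Cmult_assoc, <- Ex, <- Cmult_assoc, expi_opp_l; ring. }
  set (rho := Cmod w) in *.
  assert (R1 : 1 - m < rho).
  { pose proof (Cmod_sub_ge (expi t0) (expi t0 - w)) as K.
    replace (expi t0 - (expi t0 - w)) with w in K by ring.
    rewrite Cmod_expi, (Cmod_sub_sym (expi t0)) in K; fold rho in K; lra. }
  assert (X : Rabs x < d).
  { assert (Hx' : Rabs x <= PI) by (apply Rabs_le; lra).
    pose proof (Cmod_expi_sub1_lower x Hx') as K.
    assert (E1 : Cmod (expi x - 1) <= (1 - rho) + Cmod (w - expi t0)).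
    { replace (expi x - 1) with (RtoC (1 - rho) * expi x + (w - expi t0) * expi (- t0)).
      2:{ replace ((w - expi t0) * expi (- t0)) with (w * expi (- t0) - expi (- t0) * expi t0) by ring.
        rewrite Ex, expi_opp_l, RtoC_minus; ring. }
      eapply Rle_trans; [apply Cmod_triangle|].
      rewrite !Cmod_mult_expi, Cmod_RtoC_pos; lra. }
    lra. }
  assert (Vx : Cmod (v (x + t0)%R - v t0) < eps / 2).
  { apply Hd; change (Rabs (x + t0 - t0) < d).
    replace (x + t0 - t0)%R with x by ring; auto. }
  rewrite F1 by auto.
  specialize (HB rho (x + t0)%R ltac:(lra)); rewrite <- Ew in HB.
  replace (cauchy u w - v t0) with ((v (x + t0)%R - v t0) - (v (x + t0)%R - cauchy u w)) by ring.
  eapply Rle_lt_trans; [apply Cmod_minus_le|lra].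
Qed.

(** Poisson's formula in the limit r -> 1: [F] is the transform of u and [K] that of its conjugate
    with the mean removed, so that the constant term goes to [F] alone. *)
Lemma As_split (u : R -> C) : loop u -> BH k a u ->
  exists F K, As F /\ As K /\ K 0 = 0 /\
    forall t, u t = F (expi t) + Cconj (K (expi t)).
Proof.
intros Lu Hu.
destruct (cauchy_As u Lu Hu) as [F [HF [F1 BF]]].
destruct (cauchy_As _ (loop_conj u Lu) (BH_conj a k u Hu)) as [G [HG [G1 BG]]].
set (c := Cconj (avg u)).
exists F, (fun z => G z - c); split; [auto|split; [apply As_minus; auto using As_const|split]].
- rewrite G1 by (rewrite Cmod_0; lra).
  unfold c; rewrite <- avg_conj by apply Lu; unfold cauchy.
  rewrite (avg_ext (fun t => Cconj (u t) * kernel 0 t) (fun t => Cconj (u t))); [ring|].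
  intros t; unfold kernel; replace (1 - 0 * expi (- t)) with (RtoC 1) by ring; field.
- intros t; apply C_small_eq; intros eps He.
  destruct (poisson_limit u t (eps / 2) Lu) as [d [d0 Hd]]; [lra|].
  destruct (boundary_value_near a a01 _ _ (eps / 4) BF) as [d1 [d10 HB]]; [lra|].
  destruct (boundary_value_near a a01 _ _ (eps / 4) BG) as [d2 [d20 HB']]; [lra|].
  destruct (exists_below d1 d2) as [m [m0 [m1 m2]]]; [lra|lra|].
  destruct (exists_below (d / 2) m) as [m' [m0' [m1' m2']]]; [lra|lra|].
  set (r := (1 - m')%R).
  specialize (Hd r ltac:(unfold r; lra) ltac:(unfold r; lra)).
  specialize (HB r t ltac:(unfold r; lra)); specialize (HB' r t ltac:(unfold r; lra)).
  set (z := r * expi t) in *.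
  set (w := cauchy (fun x => Cconj (u x)) z) in *.
  rewrite <- (Cmod_conj (G (expi t) - w)), Cminus_conj in HB'.
  rewrite Cminus_conj; unfold c; rewrite Cconj_conj.
  replace (u t - (F (expi t) + (Cconj (G (expi t)) - avg u))) with
    (- ((cauchy u z + Cconj w - avg u - u t) +
      ((F (expi t) - cauchy u z) + (Cconj (G (expi t)) - Cconj w)))) by ring.
  rewrite Cmod_opp; eapply Rle_trans; [apply Cmod_triangle|].
  eapply Rle_trans; [apply Rplus_le_compat_l, Cmod_triangle|]; lra.
Qed.

Lemma disk_sub_neq_0 (z z0 : C) : Cmod z = 1%R -> Cmod z0 < 1 -> z - z0 <> 0.
Proof.
intros Hz H0 K; assert (E : z = z0) by (replace z with (z - z0 + z0) by ring; rewrite K; ring).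
subst; lra.
Qed.

(** Inside the disk [h] is the Cauchy transform of the boundary quotient (f - f(z0)) / (z - z0); it
    is holomorphic at z0 without any removal of singularities, and its membership in [BH] is visible
    on the circle. *)
Lemma As_divide (f : C -> C) (z0 : C) : As f -> Cmod z0 < 1 ->
  exists h, As h /\ forall z, Cmod z <= 1 -> f z = f z0 + (z - z0) * h z.
Proof.
intros Hf H0; pose proof (As_continuous f Hf) as Cf.
pose proof Hf as [F1 [F2 F3]].
set (q := fun z => (f z - f z0) * / (z - z0)).
set (u := fun t => q (expi t)).
assert (nz : forall t, expi t - z0 <> 0) by (intros t; apply disk_sub_neq_0; auto; apply Cmod_expi).
assert (Hu : BH k a u).
{ unfold u, q; apply BH_mult; auto.
  - apply BH_minus; auto; apply BH_const.
  - apply (BH_inv_loop (fun t => expi t - z0)); auto.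
    + apply (loop_expi_comp (fun z => z - z0)).
      apply contR_minus; [apply contR_expi|apply contR_const].
    + apply BH_minus; auto; [apply BH_expi; auto|apply BH_const]. }
assert (Lu : loop u) by (apply loop_expi_comp, (BH_continuous a a01 k u Hu)).
assert (E : forall z, Cmod z < 1 -> (z - z0) * cauchy u z = f z - f z0).
{ intros z Hz; pose proof (contR_kernel z Hz); pose proof (contR_kernel z0 H0).
  assert (Cu : contR u) by apply Lu.
  rewrite (cauchy_formula f F1 F2 Cf z Hz), (cauchy_formula f F1 F2 Cf z0 H0) at 1.
  unfold cauchy at 2 3; rewrite <- avg_minus by solve_contR.
  (* Subtracting this zero average makes the integrands of the two sides agree pointwise. *)
  assert (Z : avg (fun t => f z0 * (kernel z t - kernel z0 t)) = 0).
  { rewrite (avg_ext _ (fun t => f z0 * kernel z t - f z0 * kernel z0 t)) by (intros; ring).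
    rewrite avg_minus by solve_contR.
    change (cauchy (fun _ => f z0) z - cauchy (fun _ => f z0) z0 = 0).
    rewrite !cauchy_const by auto; ring. }
  match goal with |- _ = ?r => replace r with (r - avg (fun t => f z0 * (kernel z t - kernel z0 t)))
    by (rewrite Z; ring) end.
  unfold cauchy; rewrite <- avg_mult_l, <- avg_minus by solve_contR.
  apply avg_ext; intros t; unfold u, q, kernel.
  pose proof (kernel_den_neq_0 z t Hz) as n1; pose proof (kernel_den_neq_0 z0 t H0) as n2.
  specialize (nz t); pose proof (expi_neq_0 t) as n3.
  rewrite <- inv_expi in *.
  assert (n4 : expi t - z <> 0).
  { intros K; apply n1; replace z with (expi t) by (replace (expi t) with (expi t - z + z) by ring; rewrite K; ring).
    field; auto. }
  field; repeat split; auto. }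
set (h := fun z => if Rlt_dec (Cmod z) 1 then cauchy u z else q z).
assert (h1 : forall z, Cmod z < 1 -> h z = cauchy u z).
{ intros z Hz; unfold h; destruct Rlt_dec; [auto|contradiction]. }
assert (h2 : forall z, Cmod z = 1%R -> h z = q z).
{ intros z Hz; unfold h; destruct Rlt_dec; [lra|auto]. }
exists h; split; [split; [|split]|].
- intros z Hz; exists (cauchy' u z).
  apply derC_local_disk with (cauchy u); auto; [intros; symmetry; auto|].
  apply derC_cauchy; auto; apply Lu.
- intros z Hz; rewrite h2 by auto.
  assert (FF := within_locally_filter z).
  apply filterlim_ext_loc with q.
  2:{ apply filterlim_C_mult; [apply within_locally_filter| |].
    - apply filterlim_C_minus; [apply within_locally_filter|apply F2; auto|apply filterlim_const].
    - apply filterlim_C_inv; [apply within_locally_filter| |apply disk_sub_neq_0; auto].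
      apply filterlim_C_minus; [apply within_locally_filter| |apply filterlim_const].
      apply (proj1 (proj2 As_id)); auto. }
  unfold within; apply locally_C; exists (1 - Cmod z0)%R; split; [lra|]; intros w Hw W1.
  assert (wz : w - z0 <> 0).
  { intros K; assert (W : w = z0) by (replace w with (w - z0 + z0) by ring; rewrite K; ring).
    subst w; pose proof (Cmod_sub_ge z (z - z0)) as T.
    replace (z - (z - z0)) with z0 in T by ring; rewrite (Cmod_sub_sym z z0) in T; lra. }
  rewrite h1 by auto; unfold q; rewrite <- E by auto; field; auto.
- replace (fun t => h (expi t)) with u; auto.
  apply functional_extensionality; intros t; unfold u; rewrite h2; auto; apply Cmod_expi.
- intros z [Hz|Hz].
  + rewrite h1, E by auto; ring.
  + rewrite h2 by auto; unfold q; field; apply disk_sub_neq_0; auto.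
Qed.

End HolderDisk.

(** * Bezout identities *)

Section Bezout.

Context (k : nat) (al : R) (al01 : 0 < al < 1).

Local Notation A := (As k al).

(** On the circle conjugation turns z^j into z^{-j}, and z^M clears the negative powers. [M] may
    exceed the degree so that two approximations can share one exponent. *)
Lemma reflected_polynomial (q : nat -> C) (N M : nat) : (N <= M)%nat ->
  exists P, A P /\ forall t, P (expi t) = expi t ^ M * Cconj (psum q (expi t) N).
Proof.
intros NM.
assert (mono : forall j, A (fun z => Cconj (q j) * z ^ (M - j))).
{ intros j; apply (As_mult k al al01 (fun _ => Cconj (q j)) (fun z => z ^ (M - j)));
   [apply As_const|apply (As_pow k al al01 (fun z => z)), As_id; auto]. }
assert (val : forall j t, (j <= M)%nat ->
  Cconj (q j) * expi t ^ (M - j) = expi t ^ M * Cconj (expi t ^ j * q j)).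
{ intros j t jM; replace M with (M - j + j)%nat at 2 by lia.
  rewrite Cpow_add_r, Cmult_conj, Cpow_conj, <- expi_opp.
  replace (Cconj (q j) * expi t ^ (M - j)) with
    (Cconj (q j) * expi t ^ (M - j) * (expi (- t) * expi t) ^ j)
    by (rewrite expi_opp_l, Cpow_1_l; ring).
  rewrite Cpow_mult_l; ring. }
induction N as [|N IH].
- exists (fun z => Cconj (q 0%nat) * z ^ (M - 0)); split; auto.
  intros t; rewrite val, psum_0 by lia; f_equal; f_equal; simpl; ring.
- destruct IH as [P [HP EP]]; [lia|].
  exists (fun z => P z + Cconj (q (S N)) * z ^ (M - S N)); split; [apply As_plus; auto|].
  intros t; rewrite EP, val, psum_S, Cplus_conj by auto; ring.
Qed.

Lemma conj_approx (f : C -> C) (eps : R) : A f -> 0 < eps ->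
  exists N, forall M, (N <= M)%nat -> exists P, A P /\ forall t,
    Cmod (P (expi t) - expi t ^ M * Cconj (f (expi t))) <= eps.
Proof.
intros Hf He; pose proof Hf as [F1 [F2 F3]].
destruct (disk_polynomial_approx f F1 F2 (As_continuous k al al01 f Hf) eps He) as [q [N Hq]].
exists N; intros M NM; destruct (reflected_polynomial q N M NM) as [P [HP EP]].
exists P; split; auto; intros t; rewrite EP.
replace (expi t ^ M * Cconj (psum q (expi t) N) - expi t ^ M * Cconj (f (expi t))) with
  (- (expi t ^ M * Cconj (f (expi t) - psum q (expi t) N))) by (rewrite Cminus_conj; ring).
rewrite Cmod_opp, Cmod_mult, Cmod_pow, Cmod_expi, pow1, Cmod_conj, Rmult_1_l; auto.
Qed.

(** * Products of linear factors and the number of zeros *)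

Definition root_product (zs : list C) (z : C) : C :=
  fold_right (fun z0 p => (z - z0) * p) 1 zs.

Definition in_disk (zs : list C) : Prop := forall z, In z zs -> Cmod z < 1.

Lemma root_product_bound (zs : list C) (t : R) : in_disk zs ->
  root_product zs (expi t) <> 0 /\
  Cmod (root_product zs (expi t)) <= 2 ^ length zs.
Proof.
induction zs as [|z0 zs IH]; intros H; simpl.
- rewrite Cmod_1; split; [apply RtoC_neq_0; lra|lra].
- destruct IH as [I1 I2]; [intros z Hz; apply H; right; auto|].
  assert (H0 : Cmod z0 < 1) by (apply H; left; auto).
  split.
  + apply Cmult_neq_0; auto; apply disk_sub_neq_0; auto; apply Cmod_expi.
  + apply Cmod_mult_le; auto.
    eapply Rle_trans; [apply Cmod_minus_le|]; rewrite Cmod_expi; lra.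
Qed.

(** On the circle z times the conjugate of z - z0 is 1 - conj(z0) z, which has no zero in the closed
    disk; [Q] is the inverse of the product of these factors. *)
Lemma reflected_roots (zs : list C) : in_disk zs ->
  exists Q, A Q /\ forall t,
    Q (expi t) * (expi t ^ length zs * Cconj (root_product zs (expi t))) = 1.
Proof.
induction zs as [|z0 zs IH]; intros H.
- exists (fun _ => 1); split; [apply As_const|]; intros t; simpl.
  rewrite Cconj_RtoC; ring.
- destruct IH as [Q [HQ EQ]]; [intros z Hz; apply H; right; auto|].
  assert (H0 : Cmod z0 < 1) by (apply H; left; auto).
  assert (D : forall z, Cmod z <= 1 -> 1 - Cconj z0 * z <> 0).
  { intros z Hz; apply one_minus_neq_0; rewrite Cmod_mult, Cmod_conj.
    pose proof (Cmod_ge_0 z0); pose proof (Cmod_ge_0 z); nra. }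
  exists (fun z => Q z * / (1 - Cconj z0 * z)); split.
  + apply As_mult; auto; apply (As_inv k al al01 (fun z => 1 - Cconj z0 * z)); auto.
    apply (As_minus k al al01 (fun _ => 1) (fun z => Cconj z0 * z)); [apply As_const|].
    apply (As_mult k al al01 (fun _ => Cconj z0) (fun z => z)); [apply As_const|apply As_id; auto].
  + intros t; simpl root_product; simpl length; rewrite Cpow_S, Cmult_conj, Cminus_conj, <- expi_opp.
    assert (D' := D (expi t) ltac:(rewrite Cmod_expi; lra)).
    transitivity (Q (expi t) * (expi t ^ length zs * Cconj (root_product zs (expi t))) *
      (((expi (- t) * expi t) - Cconj z0 * expi t) * / (1 - Cconj z0 * expi t))); [ring|].
    rewrite EQ, expi_opp_l; field; auto.
Qed.

(* The number of zeros of [W] is bounded without the argument principle: if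
   [W] had [N + 1] zeros, with product of the linear factors [R], then
   [W / (z^N |R|^2)] would extend holomorphically to the disk with value [0]
   at the origin, while its real part is positive on the circle. *)
Lemma too_many_roots (W V : C -> C) (N : nat) (zs : list C) : A V ->
  (forall t, Cmod (W (expi t) - expi t ^ N) <= 1 / 2) ->
  in_disk zs -> length zs = S N ->
  (forall z, Cmod z <= 1 -> W z = root_product zs z * V z) -> False.
Proof.
intros HV HW Hz Hl E.
destruct (reflected_roots zs Hz) as [Q [HQ EQ]].
(* [Q] divides by z^{N+1}, one power per root, against the z^N that is compared with [W]; the spare
   factor z makes the function vanish at 0. *)
assert (HG : A (fun z => z * (V z * Q z))).
{ apply (As_mult k al al01 (fun z => z)); [apply As_id; auto|apply As_mult; auto]. }
pose proof (As_continuous k al al01 _ HG) as CG; pose proof HG as [G1 [G2 _]].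
pose proof (mean_value _ G1 G2 CG) as MV.
(* On the circle |R| <= 2^{N+1} and Re(W / z^N) >= 1/2, which gives this lower bound for the real
   part. *)
set (kap := (/ (2 ^ S N) ^ 2 / 2)%R).
assert (k0 : 0 < kap).
{ unfold kap; apply Rdiv_lt_0_compat; [apply Rinv_0_lt_compat, pow_lt, pow_lt|]; lra. }
assert (L : (kap <= Re (avg (fun t => (expi t * (V (expi t) * Q (expi t)))%C)))%R).
{ apply avg_Re_lower; [exact CG|]; intros t.
  destruct (root_product_bound zs t Hz) as [R0 R1]; rewrite Hl in R1.
  set (Rt := root_product zs (expi t)) in *.
  assert (R0' : Cconj Rt <> 0).
  { apply Cmod_gt_0; rewrite Cmod_conj; apply Cmod_gt_0; auto. }
  assert (e0 := expi_neq_0 t).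
  assert (r0 : 0 < Cmod Rt) by (apply Cmod_gt_0; auto).
  assert (r2 : (Cmod Rt ^ 2 <> 0)%R) by (apply pow_nonzero; lra).
  assert (EG : expi t * (V (expi t) * Q (expi t)) =
    RtoC (/ Cmod Rt ^ 2) * (W (expi t) * / expi t ^ N)).
  { assert (EV : V (expi t) = W (expi t) * / Rt).
    { rewrite E by (rewrite Cmod_expi; lra); fold Rt; field; auto. }
    assert (EQt : Q (expi t) = / (expi t ^ S N * Cconj Rt)).
    { specialize (EQ t); fold Rt in EQ; rewrite Hl in EQ.
      transitivity (Q (expi t) * (expi t ^ S N * Cconj Rt) * / (expi t ^ S N * Cconj Rt)).
      - field; split; auto; apply Cpow_nz; auto.
      - rewrite EQ; field; split; auto; apply Cpow_nz; auto. }
    rewrite EV, EQt, RtoC_inv, Cmod2_conj, Cpow_S by auto; field.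
    repeat split; auto; apply Cpow_nz; auto. }
  rewrite EG, Re_RtoC_mult.
  assert (RW : 1 / 2 <= Re (W (expi t) * / expi t ^ N)).
  { pose proof (re_le_Cmod (W (expi t) * / expi t ^ N - 1)) as P.
    replace (W (expi t) * / expi t ^ N - 1) with ((W (expi t) - expi t ^ N) * / expi t ^ N) in P
      by (field; apply Cpow_nz; auto).
    rewrite Cmod_mult, Cmod_inv, Cmod_pow, Cmod_expi, pow1, Rinv_1, Rmult_1_r in P by (apply Cpow_nz; auto).
    specialize (HW t); assert (P' := Rle_trans _ _ _ P HW); apply Rabs_le_between in P'.
    replace ((W (expi t) - expi t ^ N) * / expi t ^ N) with (W (expi t) * / expi t ^ N - 1) in P'
      by (field; apply Cpow_nz; auto).
    change (Re (W (expi t) * / expi t ^ N - 1)) with (Re (W (expi t) * / expi t ^ N) - 1)%R in P'.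
    lra. }
  unfold kap; apply Rmult_le_compat; try lra.
  - apply Rlt_le, Rinv_0_lt_compat, pow_lt, pow_lt; lra.
  - apply Rinv_le_contravar; [apply pow_lt; auto|].
    apply pow_incr; split; [lra|exact R1]. }
rewrite <- MV in L; replace (0 * (V 0 * Q 0)) with (RtoC 0) in L by ring; simpl in L; lra.
Qed.

Lemma zero_factorization (W : C -> C) (N : nat) : A W ->
  (forall t, Cmod (W (expi t) - expi t ^ N) <= 1 / 2) ->
  exists zs V, in_disk zs /\ A V /\ (forall z, Cmod z <= 1 -> V z <> 0) /\
    forall z, Cmod z <= 1 -> W z = root_product zs z * V z.
Proof.
intros HA HW.
match goal with |- ?G => destruct (classic G) as [|NG]; auto; exfalso end.
(* If the cofactor always has a zero in the closed disk, roots can be split off without end. Such a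
   zero lies in the open disk, because |W| >= 1/2 on the circle. *)
assert (S : forall n, exists zs V, length zs = n /\ in_disk zs /\ A V /\
   forall z, Cmod z <= 1 -> W z = root_product zs z * V z).
{ induction n as [|n [zs [V [L [Hz [HV E]]]]]].
  - exists nil, W; split; [auto|split; [intros z []|split; auto]]; intros z _; simpl; ring.
  - destruct (classic (exists z0, Cmod z0 < 1 /\ V z0 = 0)) as [[z0 [H0 V0]]|NZ].
    + destruct (As_divide k al al01 V z0 HV H0) as [h [Hh Eh]].
      exists (z0 :: zs), h; simpl; split; [auto|split; [|split; auto]].
      * intros z [<-|Q]; auto.
      * intros z Z; rewrite E, Eh, V0 by auto; ring.
    + exfalso; apply NG; exists zs, V; split; [auto|split; [auto|split; auto]].
      intros z [Z|Z] VZ; [apply NZ; exists z; auto|].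
      destruct (Cmod1_expi z Z) as [t [_ ->]].
      specialize (HW t); rewrite E, VZ, Cmult_0_r in HW by lra.
      replace (0 - expi t ^ N) with (- (expi t ^ N)) in HW by ring.
      rewrite Cmod_opp, Cmod_pow, Cmod_expi, pow1 in HW; lra. }
destruct (S (N + 1)%nat) as [zs [V [L [Hz [HV E]]]]].
apply (too_many_roots W V N zs); auto; lia.
Qed.

(** * The ideal generated by a and b *)

Section Ideal.

Context (a b : C -> C) (Ha : A a) (Hb : A b) (nc : no_common_zero a b).

Definition in_ideal (f : C -> C) : Prop :=
  exists p q, A p /\ A q /\ forall z, Cmod z <= 1 -> a z * q z - b z * p z = f z.

(** One of a, b is nonzero at z0, say a. Writing a = a(z0) + (z - z0) h gives a(z0) T = a T - h (z -
    z0) T, and both terms on the right lie in the ideal. *)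
Lemma in_ideal_remove_root (z0 : C) (T : C -> C) : Cmod z0 < 1 -> A T ->
  in_ideal (fun z => (z - z0) * T z) -> in_ideal T.
Proof.
intros H0 HT [p [q [Hp [Hq E]]]].
destruct (Ceq_dec (a z0) 0) as [A0|A0].
- assert (B0 : b z0 <> 0) by (intros B0; apply (nc z0 H0); auto).
  destruct (As_divide k al al01 b z0 Hb H0) as [h [Hh Eh]].
  exists (fun z => / b z0 * (- T z - h z * p z)), (fun z => / b z0 * (- (h z * q z))).
  split; [|split].
  + apply As_mult; auto using As_const; apply As_minus; auto using As_opp, As_mult.
  + apply As_mult; auto using As_const; apply As_opp; auto using As_mult.
  + intros z Z; specialize (E z Z); specialize (Eh z Z).
    transitivity (/ b z0 * (b z * T z - h z * (a z * q z - b z * p z))); [ring|].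
    rewrite E, Eh; field; auto.
- destruct (As_divide k al al01 a z0 Ha H0) as [h [Hh Eh]].
  exists (fun z => / a z0 * (- (h z * p z))), (fun z => / a z0 * (T z - h z * q z)).
  split; [|split].
  + apply As_mult; auto using As_const; apply As_opp; auto using As_mult.
  + apply As_mult; auto using As_const; apply As_minus; auto using As_mult.
  + intros z Z; specialize (E z Z); specialize (Eh z Z).
    transitivity (/ a z0 * (a z * T z - h z * (a z * q z - b z * p z))); [ring|].
    rewrite E, Eh; field; auto.
Qed.

Lemma As_root_product (zs : list C) (V : C -> C) : A V -> A (fun z => root_product zs z * V z).
Proof.
intros HV; induction zs as [|z0 zs IH]; simpl.
- apply (As_mult k al al01 (fun _ => 1)); auto using As_const.
- apply As_ext with (fun z => (z - z0) * (root_product zs z * V z)); [intros; ring|].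
  apply (As_mult k al al01 (fun z => z - z0)); auto.
  apply (As_minus k al al01 (fun z => z) (fun _ => z0)); [apply As_id; auto|apply As_const].
Qed.

Lemma in_ideal_unit (zs : list C) (V : C -> C) : in_disk zs -> A V ->
  in_ideal (fun z => root_product zs z * V z) -> in_ideal V.
Proof.
intros Hz HV; induction zs as [|z0 zs IH]; intros [p [q [Hp [Hq E]]]].
- exists p, q; split; [auto|split; auto]; intros z Z; rewrite E by auto; simpl; ring.
- apply IH; [intros z Q; apply Hz; right; auto|].
  apply in_ideal_remove_root with z0; [apply Hz; left; auto|apply As_root_product; auto|].
  exists p, q; split; [auto|split; auto]; intros z Z; rewrite E by auto; simpl; ring.
Qed.

(* On the circle the adjoints of [c] and [d] solve the Bezout equation; approximating it
   uniformly by [z^-N] times polynomials produces an element of the ideal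
   close to [z^N] on the circle, which has finitely many zeros. *)
Lemma bezout (c d : C -> C) : A c -> A d ->
  (forall t, a (expi t) * Cconj (d (expi t)) - b (expi t) * Cconj (c (expi t)) = 1) ->
  in_ideal (fun _ => 1).
Proof.
intros Hc Hd Edet.
destruct (loop_bounded _ (As_loop k al al01 a Ha)) as [M1 [M10 HM1]].
destruct (loop_bounded _ (As_loop k al al01 b Hb)) as [M2 [M20 HM2]].
(* The approximation error on the circle is at most M1 eps + M2 eps = 1/2, the threshold of
   [zero_factorization]. *)
set (eps := (/ (2 * (M1 + M2)))%R); assert (e0 : 0 < eps) by (apply Rinv_0_lt_compat; lra).
destruct (conj_approx c eps Hc e0) as [N1 K1], (conj_approx d eps Hd e0) as [N2 K2].
set (N := (N1 + N2)%nat).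
destruct (K1 N ltac:(unfold N; lia)) as [p [Hp Ep]], (K2 N ltac:(unfold N; lia)) as [q [Hq Eq]].
set (W := fun z => a z * q z - b z * p z).
assert (HW : A W) by (apply As_minus; auto using As_mult).
destruct (zero_factorization W N HW) as [zs [V [Hz [HV [V0 E]]]]].
{ intros t; unfold W.
  replace (a (expi t) * q (expi t) - b (expi t) * p (expi t) - expi t ^ N) with
    (a (expi t) * (q (expi t) - expi t ^ N * Cconj (d (expi t))) -
     b (expi t) * (p (expi t) - expi t ^ N * Cconj (c (expi t)))
     + expi t ^ N * (a (expi t) * Cconj (d (expi t)) - b (expi t) * Cconj (c (expi t)) - 1)) by ring.
  rewrite Edet; replace (1 - 1) with (RtoC 0) by ring; rewrite Cmult_0_r, Cplus_0_r.
  eapply Rle_trans; [apply Cmod_minus_le|].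
  apply Rle_trans with (M1 * eps + M2 * eps)%R.
  - apply Rplus_le_compat; apply Cmod_mult_le; auto.
  - right; unfold eps; field; lra. }
destruct (in_ideal_unit zs V Hz HV) as [p' [q' [Hp' [Hq' E']]]].
{ exists p, q; split; [auto|split; auto]. }
pose proof (As_inv k al al01 V HV V0) as HVi.
exists (fun z => p' z * / V z), (fun z => q' z * / V z); split; [|split].
- apply As_mult; auto.
- apply As_mult; auto.
- intros z Z; specialize (E' z Z); specialize (V0 z Z).
  transitivity ((a z * q' z - b z * p' z) * / V z); [ring|]; rewrite E'; field; auto.
Qed.

(** By Cramer's rule two rows with determinant 1 against (a, b) differ by u (a, b), where u is the
    determinant of one row against the other. The holomorphic part of u is absorbed into p and q,
    which keeps a q - b p = 1; only the adjoint of [K] remains. *)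
Lemma row_completion (c d : C -> C) : A c -> A d ->
  (forall t, a (expi t) * Cconj (d (expi t)) - b (expi t) * Cconj (c (expi t)) = 1) ->
  exists p q K, A p /\ A q /\ A K /\ K 0 = 0 /\
    (forall z, Cmod z <= 1 -> a z * q z - b z * p z = 1) /\
    forall t, Cconj (c (expi t)) = Cconj (K (expi t)) * a (expi t) + p (expi t) /\
      Cconj (d (expi t)) = Cconj (K (expi t)) * b (expi t) + q (expi t).
Proof.
intros Hc Hd Edet; destruct (bezout c d Hc Hd Edet) as [p [q [Hp [Hq E]]]].
set (u := fun t => Cconj (c (expi t)) * q (expi t) - Cconj (d (expi t)) * p (expi t)).
assert (Hu : BH k al u).
{ apply BH_minus; auto; apply BH_mult; auto; try apply BH_conj; try apply Hc; try apply Hd; try apply Hp; apply Hq. }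
assert (Lu : loop u).
{ split; [apply (BH_continuous al al01 k u Hu)|]; intros t; unfold u; rewrite expi_period; auto. }
destruct (As_split k al al01 u Lu Hu) as [F [K [HF [HK [K0 EK]]]]].
exists (fun z => p z + F z * a z), (fun z => q z + F z * b z), K.
split; [apply As_plus; auto using As_mult|split; [apply As_plus; auto using As_mult|]].
split; [auto|split; [auto|split]].
- intros z Z; rewrite <- (E z Z); ring.
- intros t; assert (Z : Cmod (expi t) <= 1) by (rewrite Cmod_expi; lra).
  specialize (E _ Z); specialize (EK t); specialize (Edet t); unfold u in EK.
  set (w := expi t) in *.
  assert (EK' : Cconj (K w) = Cconj (c w) * q w - Cconj (d w) * p w - F w) by (rewrite EK; ring).
  rewrite EK'; split.
  + transitivity (Cconj (c w) * (a w * q w - b w * p w) - p w * (a w * Cconj (d w) - b w * Cconj (c w) - 1)).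
    * rewrite E, Edet; ring.
    * ring.
  + transitivity (Cconj (d w) * (a w * q w - b w * p w) - q w * (a w * Cconj (d w) - b w * Cconj (c w) - 1)).
    * rewrite E, Edet; ring.
    * ring.
Qed.

End Ideal.

End Bezout.

(** * Adjoints of holomorphic functions *)

Lemma frac_part_nonint (s : R) : (forall n : Z, s <> IZR n) -> 0 < frac_part s < 1.
Proof.
intros H; destruct (base_fp s) as [H1 H2]; split; [|lra].
destruct (Req_dec (frac_part s) 0) as [E|]; [|lra].
exfalso; unfold frac_part in E; apply (H (Int_part s)); lra.
Qed.

Section Star.

Context (s : R) (s_nonint : forall n : Z, s <> IZR n).

Local Notation k := (Z.to_nat (Int_part s)).
Local Notation al := (frac_part s).
Local Notation A := (As k al).

Lemma al01 : 0 < al < 1.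
Proof. apply frac_part_nonint, s_nonint. Qed.

Lemma H0_Cs_disk_As (f : C -> C) : H0_Cs_disk s f <-> A f.
Proof.
split.
- intros [H1 [H2 H3]]; split; [|split; auto].
  + intros z Hz; destruct (H1 z Hz) as [l Hl]; exists l; apply derC_is_derive, Hl.
  + apply Ck_holder_BH; auto; [apply al01|].
    intros t; rewrite expi_period; auto.
- intros [H1 [H2 H3]]; split; [|split; auto].
  + intros z Hz; destruct (H1 z Hz) as [l Hl]; exists l; apply derC_is_derive, Hl.
  + apply (BH_Ck_holder al k _ H3).
Qed.

Lemma As_pseries (f : C -> C) : A f -> exists y : nat -> C, y 0%nat = f 0 /\
  forall z, Cmod z < 1 -> is_Cpseries y z (f z).
Proof.
intros Hf; pose proof (As_continuous _ _ al01 f Hf) as Cf; destruct Hf as [F1 [F2 _]].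
exists (coef (fun t => f (expi t))); split.
- rewrite (mean_value f F1 F2 Cf); apply avg_ext; intros; simpl; ring.
- intros z Hz; apply disk_pseries; auto.
Qed.

Lemma Cpseries_conj (y : nat -> C) (z l : C) : is_Cpseries y z l ->
  is_Cpseries (fun n => Cconj (y n)) (Cconj z) (Cconj l).
Proof.
rewrite !Cpseries_eps; intros H eps He; destruct (H eps He) as [N HN].
exists N; intros n Hn; specialize (HN n Hn).
replace (psum (fun n => Cconj (y n)) (Cconj z) n) with (Cconj (psum y z n)).
- rewrite <- Cminus_conj, Cmod_conj; auto.
- clear; induction n as [|n IH]; [rewrite !psum_0; auto|].
  rewrite !psum_S, Cplus_conj, IH, Cmult_conj, Cpow_conj; auto.
Qed.

Lemma conj_neq_0 (w : C) : w <> 0 -> Cconj w <> 0.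
Proof. intros; apply Cmod_gt_0; rewrite Cmod_conj; apply Cmod_gt_0; auto. Qed.

Lemma conj_inv_inv (w : C) : w <> 0 -> / Cconj (/ w) = Cconj w.
Proof. intros H; rewrite Cinv_conj by auto; apply conj_neq_0 in H; field; auto. Qed.

Lemma Cmod_pos_neq_0 (w : C) : 0 < Cmod w -> w <> 0.
Proof. apply Cmod_gt_0. Qed.

Lemma inv_conj_circle (z : C) : Cmod z = 1%R -> / Cconj z = z.
Proof.
intros Hz; destruct (Cmod1_expi z Hz) as [t [_ ->]].
rewrite <- expi_opp, inv_expi; f_equal; ring.
Qed.

(** Reflection in the circle: conj(f(1 / conj z)) has the expansion sum of conj(f_n) z^{-n}, and the
    formula covers the circle itself. *)
Definition star (f : C -> C) (x : sphere) : C :=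
  match x with Infty => Cconj (f 0) | Pt z => Cconj (f (/ Cconj z)) end.

Lemma star_circle (f : C -> C) (z : C) : Cmod z = 1%R -> star f (Pt z) = Cconj (f z).
Proof. intros Hz; simpl; rewrite inv_conj_circle; auto. Qed.

Lemma star_laurent (f : C -> C) (y : nat -> C) : y 0%nat = f 0 ->
  (forall z, Cmod z < 1 -> is_Cpseries y z (f z)) ->
  laurent_ext (fun n => Cconj (y n)) (star f).
Proof.
intros y0 Hy; split; [simpl; rewrite y0; auto|].
intros z Hz; assert (z0 : z <> 0) by (apply Cmod_pos_neq_0; lra).
pose proof (conj_neq_0 z z0).
replace (/ z) with (Cconj (/ Cconj z)) by (rewrite Cinv_conj, Cconj_conj; auto).
apply Cpseries_conj, Hy.
rewrite Cmod_inv, Cmod_conj, <- Rinv_1 by auto; apply Rinv_lt_contravar; lra.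
Qed.

(** In the chart w = 1/z the adjoint is conj(f(conj w)), also at w = 0, so infinity is no special
    case for the derivative. *)
Lemma star_holo (f : C -> C) : (forall z, Cmod z < 1 -> exists l, derC f z l) ->
  holo_ext (star f).
Proof.
intros Hf z Hz.
destruct (Hf (Cconj z)) as [l Hl]; [rewrite Cmod_conj; auto|].
exists (Cconj l); apply derC_is_derive.
apply derC_local with (fun w => Cconj (f (Cconj w))) 1%R; [lra| |].
- intros w _; unfold sphere_inv; destruct Ceq_dec as [->|w0]; simpl.
  + rewrite Cconj_RtoC; auto.
  + rewrite conj_inv_inv; auto.
- intros eps He; destruct (Hl eps He) as [d [d0 Hd]]; exists d; split; auto; intros w _ Hw.
  rewrite <- Cmod_conj, Cminus_conj in Hw; specialize (Hd (Cconj w) I Hw).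
  rewrite <- (Cmod_conj (w - z)), Cminus_conj.
  rewrite <- Cmod_conj.
  replace (Cconj (Cconj (f (Cconj w)) - Cconj (f (Cconj z)) - (w - z) * Cconj l)) with
    (f (Cconj w) - f (Cconj z) - (Cconj w - Cconj z) * l); auto.
  rewrite !Cminus_conj, Cmult_conj, Cminus_conj, !Cconj_conj; auto.
Qed.

Lemma star_bv (f : C -> C) : disk_limit f -> bv_ext (star f).
Proof.
intros Hf z Hz; rewrite star_circle by auto.
assert (FF : Filter (within (fun w => (1 < Cmod w)) (locally z))) by apply within_filter, locally_filter.
apply filterlim_C_conj; auto.
assert (L : filterlim (fun w => / Cconj w) (locally z) (locally z)).
{ rewrite <- (inv_conj_circle z Hz) at 2.
  assert (z0 : z <> 0) by (apply Cmod_pos_neq_0; lra).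
  apply filterlim_C_inv; [apply locally_filter| |apply conj_neq_0; auto].
  apply filterlim_C_conj; [apply locally_filter|apply filterlim_id]. }
apply filterlim_comp with (2 := Hf z Hz).
intros P HP; unfold filtermap, within in *.
specialize (L _ HP); unfold filtermap in L.
generalize L; apply filter_imp; intros w Hw W1; apply Hw.
assert (w0 : w <> RtoC 0) by (apply Cmod_pos_neq_0; lra).
rewrite Cmod_inv, Cmod_conj, <- Rinv_1 by (apply conj_neq_0; auto).
apply Rinv_lt_contravar; lra.
Qed.

Lemma star_Cs_bv (f : C -> C) : A f -> Cs_bv_ext s (star f).
Proof.
intros [F1 [F2 F3]]; split; [apply star_bv; auto|].
apply (BH_Ck_holder al k (fun t => star f (Pt (expi t)))).
replace (fun t => star f (Pt (expi t))) with (fun t => Cconj (f (expi t))).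
- apply BH_conj; auto.
- apply functional_extensionality; intros t; rewrite star_circle; auto; apply Cmod_expi.
Qed.

Lemma star_is_star (f : C -> C) : A f -> is_star f (star f).
Proof.
intros Hf; destruct (As_pseries f Hf) as [y [y0 Hy]]; split; [|apply star_bv, Hf].
exists y; split; auto; apply star_laurent; auto.
Qed.

(** The Laurent series fixes [F] only outside the closed disk; on the circle [F] and the reflection
    agree as limits of the same function from outside. *)
Lemma is_star_circle (f : C -> C) (F : sphere -> C) : A f -> is_star f F ->
  F Infty = Cconj (f 0) /\ forall z, Cmod z = 1%R -> F (Pt z) = Cconj (f z).
Proof.
intros Hf [[y [Hy [L0 L]]] bF].
assert (y0 : y 0%nat = f 0).
{ apply (Cpseries_unique y 0); [|apply Hy; rewrite Cmod_0; lra].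
  apply Cpseries_eps; intros eps He; exists 0%nat; intros n _.
  replace (psum y 0 n) with (y 0%nat).
  - replace (y 0%nat - y 0%nat) with (RtoC 0) by ring; rewrite Cmod_0; auto.
  - clear; induction n as [|n IH]; [rewrite psum_0; auto|].
    rewrite psum_S, <- IH, Cpow_S; ring. }
split; [rewrite L0, y0; auto|].
destruct (star_laurent f y y0 Hy) as [_ L'].
assert (E : forall z, 1 < Cmod z -> F (Pt z) = star f (Pt z)).
{ intros z Hz; apply (Cpseries_unique _ (/ z) _ _ (L z Hz) (L' z Hz)). }
intros z Hz; rewrite <- star_circle by auto.
pose proof (star_bv f (proj1 (proj2 Hf)) z Hz) as B; specialize (bF z Hz).
assert (FF : Filter (within (fun w => (1 < Cmod w)) (locally z))) by apply within_filter, locally_filter.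
apply C_small_eq; intros eps He.
pose proof (filterlim_C_minus _ _ _ _ _ bF B) as D.
rewrite filterlim_Cmod in D by auto; specialize (D eps He).
unfold within in D; apply locally_C in D as [d [d0 Hd]].
set (w := RtoC (1 + d / 2) * z).
assert (W : Cmod w = (1 + d / 2)%R).
{ unfold w; rewrite Cmod_mult, Cmod_RtoC_pos, Hz by lra; ring. }
assert (W1 : 1 < Cmod w) by (rewrite W; lra).
assert (Hw : Cmod (w - z) < d).
{ unfold w; replace (RtoC (1 + d / 2) * z - z) with (RtoC (d / 2) * z) by (rewrite RtoC_plus; ring).
  rewrite Cmod_mult, Cmod_RtoC_pos, Hz by lra; lra. }
specialize (Hd w Hw W1); rewrite E in Hd by auto.
match type of Hd with (Cmod (?x - ?x - ?y) < _) =>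
  replace (x - x - y) with (- y) in Hd by ring end.
rewrite Cmod_opp in Hd; lra.
Qed.

(** * Matrix loops *)

Lemma M2_eta (M : M2) : M = mat2 (entry M 0 0) (entry M 0 1) (entry M 1 0) (entry M 1 1).
Proof. destruct M as [[a [b []]] [[c [d []]] []]]; reflexivity. Qed.

Lemma inv_star_mat2 (a b c d : C) : det2 (mat2 a b c d) = 1 ->
  adj2 (inv2 (mat2 a b c d)) = mat2 (Cconj d) (- Cconj c) (- Cconj b) (Cconj a).
Proof.
intros H; unfold adj2, inv2; rewrite H.
assert (I1 : / RtoC 1 = 1) by (field; apply RtoC_neq_0; lra).
assert (CN : forall x, Cconj (- / 1 * x) = - Cconj x).
{ intros x; rewrite I1; replace (- (1) * x) with (- x) by ring; apply Copp_conj. }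
assert (CP : forall x, Cconj (/ 1 * x) = Cconj x).
{ intros x; rewrite I1; f_equal; ring. }
unfold mk_matrix, entry, mat2, coeff_mat; simpl.
rewrite !CN, !CP; reflexivity.
Qed.

Lemma det2_mat2 (a b c d : C) : det2 (mat2 a b c d) = a * d - b * c.
Proof. reflexivity. Qed.

Lemma third_factor_mat2 (u00 u01 u10 u11 : C -> C) : A u00 -> A u01 -> A u10 -> A u11 ->
  (forall z, Cmod z < 1 -> u00 z * u11 z - u01 z * u10 z = 1) ->
  u00 0 = 1 -> u10 0 = 0 -> u11 0 = 1 ->
  third_factor s (fun z => mat2 (u00 z) (u01 z) (u10 z) (u11 z)).
Proof.
intros H00 H01 H10 H11 Hdet E00 E10 E11; split; [|split; [|auto]].
- intros [|[|i]] [|[|j]] Hi Hj; try lia; apply H0_Cs_disk_As; auto.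
- intros z Hz; rewrite det2_mat2; auto.
Qed.

Lemma third_factor_rows (u : C -> M2) : third_factor s u ->
  no_common_zero (fun z => entry (u z) 0 0) (fun z => entry (u z) 0 1) /\
  no_common_zero (fun z => entry (u z) 1 0) (fun z => entry (u z) 1 1).
Proof.
intros [_ [Hd _]]; split; intros z Hz [E1 E2]; specialize (Hd z Hz); unfold det2 in Hd;
  rewrite E1, E2 in Hd; apply (RtoC_neq_0 1); try lra; rewrite <- Hd; ring.
Qed.

Lemma no_common_zero_scale (f h : C -> C) (x : C) : x <> 0 -> no_common_zero f h ->
  no_common_zero (fun z => x * f z) (fun z => x * h z).
Proof.
intros Hx H z Hz [E1 E2]; apply (H z Hz).
replace (f z) with (/ x * (x * f z)) by (field; auto).
replace (h z) with (/ x * (x * h z)) by (field; auto).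
rewrite E1, E2; split; ring.
Qed.

Lemma no_common_zero_opp_l (f h : C -> C) : no_common_zero f h -> no_common_zero (fun z => - h z) f.
Proof.
intros H z Hz [E1 E2]; apply (H z Hz); split; auto.
replace (h z) with (- - h z) by ring; rewrite E1; ring.
Qed.

Lemma no_common_zero_opp_r (f h : C -> C) : no_common_zero f h -> no_common_zero h (fun z => - f z).
Proof.
intros H z Hz [E1 E2]; apply (no_common_zero_opp_l h f) with z; auto.
intros w Hw [E3 E4]; apply (H w Hw); auto.
Qed.

Lemma As_scale (x : C) (f : C -> C) : A f -> A (fun z => x * f z).
Proof. intros; apply (As_mult k al al01 (fun _ => x)); auto; apply As_const. Qed.

Lemma Cinv_neq_0 (x : C) : x <> 0 -> / x <> 0.
Proof.
intros H; apply Cmod_pos_neq_0; rewrite Cmod_inv by auto; apply Rinv_0_lt_compat, Cmod_gt_0; auto.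
Qed.

(** The first row of a unipotent lower triangular matrix is (1, 0), so the first row of [g] is x
    times that of the third factor. The latter has determinant 1, which excludes common zeros. *)
Lemma lower_factorization_row (g : C -> M2) (x : C) : x <> 0 -> lower_factorization s g x ->
  exists a b, A a /\ A b /\ no_common_zero a b /\ a 0 = x /\
    forall z, Cmod z = 1%R -> entry (g z) 0 0 = a z /\ entry (g z) 0 1 = b z.
Proof.
intros x0 [y [Y [u [_ [_ [_ [Hu Eu]]]]]]]; pose proof Hu as [HA [_ [u00 _]]].
exists (fun z => x * entry (u z) 0 0), (fun z => x * entry (u z) 0 1).
split; [|split; [|split; [|split]]]; try (apply As_scale, H0_Cs_disk_As, HA; lia).
- apply no_common_zero_scale, third_factor_rows; auto.
- rewrite u00; ring.
- intros z Hz; rewrite Eu, (M2_eta (u z)), !mul2E by auto.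
  split; [change (entry (mat2 ?p ?q ?r ?t) 0 0) with p|change (entry (mat2 ?p ?q ?r ?t) 0 1) with q]; ring.
Qed.

(** The left factor now preserves the second row, which carries the diagonal constant 1/x. *)
Lemma upper_factorization_row (g : C -> M2) (x : C) : x <> 0 -> upper_factorization s g x ->
  exists c d, A c /\ A d /\ no_common_zero c d /\ c 0 = 0 /\ d 0 = / x /\
    forall z, Cmod z = 1%R -> entry (g z) 1 0 = c z /\ entry (g z) 1 1 = d z.
Proof.
intros x0 [y [Y [u [_ [_ [_ [Hu Eu]]]]]]]; pose proof Hu as [HA [_ [_ [u10 u11]]]].
exists (fun z => / x * entry (u z) 1 0), (fun z => / x * entry (u z) 1 1).
split; [|split; [|split; [|split; [|split]]]]; try (apply As_scale, H0_Cs_disk_As, HA; lia).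
- apply no_common_zero_scale, third_factor_rows; auto using Cinv_neq_0.
- rewrite u10; ring.
- rewrite u11; ring.
- intros z Hz; rewrite Eu, (M2_eta (u z)), !mul2E by auto.
  split; [change (entry (mat2 ?p ?q ?r ?t) 1 0) with r|change (entry (mat2 ?p ?q ?r ?t) 1 1) with t]; ring.
Qed.

Lemma circle_det (g : C -> M2) (a b c d : C -> C) :
  (forall z, Cmod z = 1%R -> det2 (g z) = 1) ->
  (forall z, Cmod z = 1%R -> g z = mat2 (a z) (b z) (c z) (d z)) ->
  forall t, a (expi t) * d (expi t) - b (expi t) * c (expi t) = 1.
Proof.
intros Hg E t; rewrite <- det2_mat2, <- E by apply Cmod_expi; apply Hg, Cmod_expi.
Qed.

Lemma lower_factorization_intro (g : C -> M2) (a b c d : C -> C) :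
  A a -> A b -> A c -> A d -> no_common_zero a b -> a 0 <> 0 ->
  (forall z, Cmod z = 1%R -> det2 (g z) = 1) ->
  (forall z, Cmod z = 1%R -> g z = mat2 (a z) (b z) (Cconj (c z)) (Cconj (d z))) ->
  lower_factorization s g (a 0).
Proof.
intros Ha Hb Hc Hd nc a0 Hg Eg.
pose proof (circle_det g a b (fun z => Cconj (c z)) (fun z => Cconj (d z)) Hg Eg) as Edet.
destruct (row_completion k al al01 a b Ha Hb nc c d Hc Hd Edet)
  as [p [q [K [Hp [Hq [HK [_ [E ER]]]]]]]].
assert (Z0 : Cmod 0 <= 1) by (rewrite Cmod_0; lra).
pose proof (E 0 Z0) as E0.
(* The constant moved from the series [Y] into the third factor so that its lower left entry
   vanishes at 0; its lower right entry at 0 is then a(0) q(0) - b(0) p(0) = 1. *)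
set (m := - p 0 * / a 0).
set (K1 := fun z => K z - Cconj m).
assert (HK1 : A K1) by (apply As_minus; auto using al01, As_const).
destruct (As_pseries K1 HK1) as [y [y0 Hy]].
exists y, (star K1), (fun z => mat2 (/ a 0 * a z) (/ a 0 * b z)
  (a 0 * (p z + m * a z)) (a 0 * (q z + m * b z))).
split; [apply star_laurent; auto|split; [apply star_holo, HK1|split; [apply star_Cs_bv; auto|split]]].
- apply third_factor_mat2; auto using al01, As_plus, As_scale.
  + intros z Hz; rewrite <- (E z) by lra; field; auto.
  + field; auto.
  + unfold m; field; auto.
  + transitivity (a 0 * q 0 - b 0 * p 0); [unfold m; field; auto|exact E0].
- intros z Hz; rewrite Eg, star_circle, !mul2E by auto.
  destruct (Cmod1_expi z Hz) as [t [_ Ez]].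
  destruct (ER t) as [R1 R2]; rewrite <- Ez in R1, R2; rewrite R1, R2.
  unfold K1; rewrite Cminus_conj, Cconj_conj.
  f_equal; clearbody m; field; auto.
Qed.

(** The series [X] has no constant term, so no shift is possible: [K 0 = 0] removes that term, and
    c(0) = 0 makes the third factor triangular at 0. Then d(0) q(0) = 1 makes it unipotent. *)
Lemma upper_factorization_intro (g : C -> M2) (a b c d : C -> C) :
  A a -> A b -> A c -> A d -> no_common_zero c d -> c 0 = 0 -> d 0 <> 0 ->
  (forall z, Cmod z = 1%R -> det2 (g z) = 1) ->
  (forall z, Cmod z = 1%R -> g z = mat2 (Cconj (a z)) (Cconj (b z)) (c z) (d z)) ->
  upper_factorization s g (/ d 0).
Proof.
intros Ha Hb Hc Hd nc c0 d0 Hg Eg.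
pose proof (circle_det g (fun z => Cconj (a z)) (fun z => Cconj (b z)) c d Hg Eg) as Edet.
assert (nc' : no_common_zero d c) by (intros z Hz [E1 E2]; apply (nc z Hz); auto).
(* Exchanging both rows and both columns preserves the determinant, so (d, c) plays the part of (a,
   b). *)
destruct (row_completion k al al01 d c Hd Hc nc' b a Hb Ha) as [p [q [K [Hp [Hq [HK [K0 [E ER]]]]]]]].
{ intros t; rewrite <- (Edet t); ring. }
assert (Z0 : Cmod 0 <= 1) by (rewrite Cmod_0; lra).
pose proof (E 0 Z0) as E0; rewrite c0 in E0.
destruct (As_pseries K HK) as [y [y0 Hy]].
exists y, (star K), (fun z => mat2 (d 0 * q z) (d 0 * p z) (/ d 0 * c z) (/ d 0 * d z)).
split; [|split; [apply star_holo, HK|split; [apply star_Cs_bv; auto|split]]].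
- replace (fun j => match j with O => RtoC 0 | S _ => Cconj (y j) end) with (fun j => Cconj (y j)).
  + apply star_laurent; auto.
  + apply functional_extensionality; intros [|j]; auto.
    rewrite y0, K0; apply Cconj_RtoC.
- apply third_factor_mat2; auto using As_scale.
  + intros z Hz; rewrite <- (E z) by lra; field; auto.
  + rewrite <- E0; ring.
  + rewrite c0; ring.
  + field; auto.
- intros z Hz; rewrite Eg, star_circle, !mul2E by auto.
  destruct (Cmod1_expi z Hz) as [t [_ Ez]].
  destruct (ER t) as [R1 R2]; rewrite <- Ez in R1, R2; rewrite R1, R2.
  f_equal; field; auto.
Qed.

(** * The four implications *)

Section Loop.

Context (g : C -> M2) (Hg : forall z, Cmod z = 1%R -> det2 (g z) = 1).

Lemma inv_star_circle (z : C) : Cmod z = 1%R -> inv_star g z =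
  mat2 (Cconj (entry (g z) 1 1)) (- Cconj (entry (g z) 1 0))
    (- Cconj (entry (g z) 0 1)) (Cconj (entry (g z) 0 0)).
Proof.
intros Hz; unfold inv_star; rewrite (M2_eta (g z)) at 1; apply inv_star_mat2.
rewrite <- M2_eta; auto.
Qed.

Lemma inv_star_det (z : C) : Cmod z = 1%R -> det2 (inv_star g z) = 1.
Proof.
intros Hz; rewrite inv_star_circle, det2_mat2, <- (Cconj_RtoC 1), <- (Hg z Hz) by auto.
unfold det2; rewrite Cminus_conj, !Cmult_conj; ring.
Qed.

(** On the circle g^{-*} has the same shape, with a, b, c, d replaced by d, -c, -b, a. Its diagonal
    constant is therefore d(0), and the normalization says that d(0) is the conjugate of a(0). *)
Lemma condition_I1_I3 : condition_I1 s g -> condition_I3 s g.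
Proof.
intros [a [b [c [d [cs [ds [Ha [Hb [Hc [Hd [Sc [Sd [Eg [Ea [ne [nab ncd]]]]]]]]]]]]]]]].
rewrite H0_Cs_disk_As in Ha, Hb, Hc, Hd.
destruct (is_star_circle c cs Hc Sc) as [_ Ec].
destruct (is_star_circle d ds Hd Sd) as [Id Ed].
assert (a0 : a 0 <> 0) by (rewrite Ea; auto).
assert (d0 : d 0 = Cconj (a 0)) by (rewrite Ea, Id, Cconj_conj; auto).
exists (a 0); split; auto; split.
- apply lower_factorization_intro with b c d; auto.
  intros z Hz; rewrite Eg, Ec, Ed; auto.
- rewrite <- d0.
  apply lower_factorization_intro with (fun z => - c z) (fun z => - b z) a;
    auto using al01, As_opp, no_common_zero_opp_r, inv_star_det.
  + rewrite d0; apply conj_neq_0; auto.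
  + intros z Hz; rewrite inv_star_circle, Eg, Ec, Ed by auto.
    change (mat2 (Cconj (Cconj (d z))) (- Cconj (Cconj (c z))) (- Cconj (b z)) (Cconj (a z)) =
      mat2 (d z) (- c z) (Cconj (- b z)) (Cconj (a z))).
    rewrite !Cconj_conj, Copp_conj; auto.
Qed.

(** The factorization of g yields a and b; the first row of g^{-*} is (d, -c), which gives the
    second row of g after conjugation. The conjugate constants in the two factorizations give back
    the normalization. *)
Lemma condition_I3_I1 : condition_I3 s g -> condition_I1 s g.
Proof.
intros [x [x0 [L1 L2]]]; pose proof (conj_neq_0 x x0) as x0'.
destruct (lower_factorization_row _ _ x0 L1) as [a [b [Ha [Hb [nab [a0 E1]]]]]].
destruct (lower_factorization_row _ _ x0' L2) as [d [e [Hd [He [nde [d0 E2]]]]]].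
assert (Hc : A (fun z => - e z)) by (auto using al01, As_opp).
exists a, b, (fun z => - e z), d, (star (fun z => - e z)), (star d).
rewrite !H0_Cs_disk_As.
do 4 (split; [auto|]); do 2 (split; [apply star_is_star; auto|]).
split; [|split; [|split; [|split]]]; auto using no_common_zero_opp_l.
- intros z Hz; rewrite !star_circle by auto.
  destruct (E1 z Hz) as [<- <-], (E2 z Hz) as [V1 V2].
  rewrite <- V1, <- V2, inv_star_circle by auto.
  change (g z = mat2 (entry (g z) 0 0) (entry (g z) 0 1)
    (Cconj (- - Cconj (entry (g z) 1 0))) (Cconj (Cconj (entry (g z) 1 1)))).
  replace (- - Cconj (entry (g z) 1 0)) with (Cconj (entry (g z) 1 0)) by ring.
  rewrite !Cconj_conj; apply M2_eta.
- simpl; rewrite d0, Cconj_conj; auto.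
- simpl; rewrite d0, Cconj_conj; auto.
Qed.

(** The same substitution a, b, c, d to d, -c, -b, a applies. The diagonal constants are 1/d(0) and
    1/a(0), and b(0) = 0 does for g^{-*} what c(0) = 0 does for g. *)
Lemma condition_II1_II3 : condition_II1 s g -> condition_II3 s g.
Proof.
intros [a [b [c [d [as_ [bs [Ha [Hb [Hc [Hd [Sa [Sb [Eg [b0 [c0 [Ea [ne [nab ncd]]]]]]]]]]]]]]]]]].
rewrite H0_Cs_disk_As in Ha, Hb, Hc, Hd.
destruct (is_star_circle a as_ Ha Sa) as [Ia Es].
destruct (is_star_circle b bs Hb Sb) as [_ Eb].
assert (a0 : a 0 = Cconj (d 0)) by (rewrite <- Ea, Ia, Cconj_conj; auto).
exists (/ d 0); split; [apply Cinv_neq_0; auto|split].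
- apply upper_factorization_intro with a b c; auto.
  intros z Hz; rewrite Eg, Es, Eb; auto.
- rewrite Cinv_conj, <- a0 by auto.
  apply upper_factorization_intro with d (fun z => - c z) (fun z => - b z);
    auto using al01, As_opp, no_common_zero_opp_l, inv_star_det.
  + rewrite b0; ring.
  + rewrite a0; apply conj_neq_0; auto.
  + intros z Hz; rewrite inv_star_circle, Eg, Es, Eb by auto.
    change (mat2 (Cconj (d z)) (- Cconj (c z)) (- Cconj (Cconj (b z))) (Cconj (Cconj (a z))) =
      mat2 (Cconj (d z)) (Cconj (- c z)) (- b z) (a z)).
    rewrite !Cconj_conj, Copp_conj; auto.
Qed.

Lemma condition_II3_II1 : condition_II3 s g -> condition_II1 s g.
Proof.
intros [x [x0 [L1 L2]]]; pose proof (conj_neq_0 x x0) as x0'.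
destruct (upper_factorization_row _ _ x0 L1) as [c [d [Hc [Hd [ncd [c0 [d0 E1]]]]]]].
destruct (upper_factorization_row _ _ x0' L2) as [e [a [He [Ha [nea [e0 [a0 E2]]]]]]].
assert (Hb : A (fun z => - e z)) by (auto using al01, As_opp).
exists a, (fun z => - e z), c, d, (star a), (star (fun z => - e z)).
rewrite !H0_Cs_disk_As.
do 4 (split; [auto|]); do 2 (split; [apply star_is_star; auto|]).
split; [|split; [|split; [|split; [|split; [|split]]]]]; auto using no_common_zero_opp_r.
- intros z Hz; rewrite !star_circle by auto.
  destruct (E1 z Hz) as [<- <-], (E2 z Hz) as [V1 V2].
  rewrite <- V1, <- V2, inv_star_circle by auto.
  change (g z = mat2 (Cconj (Cconj (entry (g z) 0 0))) (Cconj (- - Cconj (entry (g z) 0 1)))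
    (entry (g z) 1 0) (entry (g z) 1 1)).
  replace (- - Cconj (entry (g z) 0 1)) with (Cconj (entry (g z) 0 1)) by ring.
  rewrite !Cconj_conj; apply M2_eta.
- rewrite e0; ring.
- simpl; rewrite a0, d0, Cinv_conj, Cconj_conj; auto.
- rewrite d0; apply Cinv_neq_0; auto.
Qed.

End Loop.

End Star.

Local Close Scope C_scope.

Theorem theorem6 (s : R) (s_pos : 0 < s)
    (s_nonint : forall n : Z, s <> IZR n) :
  (forall g1 : C -> M2, Cs_SL2_loop s g1 ->
     (condition_I1 s g1 <-> condition_I3 s g1)) /\
  (forall g2 : C -> M2, Cs_SL2_loop s g2 ->
     (condition_II1 s g2 <-> condition_II3 s g2)).
Proof.
split; intros g [_ Hg]; split.
- apply condition_I1_I3; auto.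
- apply condition_I3_I1; auto.
- apply condition_II1_II3; auto.
- apply condition_II3_II1; auto.
Qed.
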